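(* Let $\mathbf{S}_n^{312}$ denote the set of all $312$-avoiding permutations in $\mathbf{S}_n$, and let $w\in \mathbf{S}_n^{312}$. If $X_w$ is a $T$-complexity one Schubert variety (that is, $c_T(X_w)=1$), then $X_w$ is a spherical variety. Furthermore, if $\mathbf{NT}_n^{312}$ denotes the subset of elements $w\in \mathbf{S}_n^{312}$ such that $X_w$ is a nearly toric Schubert variety, then $|\mathbf{NT}_n^{312}|=(n-2)2^{n-3}$.
   Context: $\mathbf{S}_n$ is the symmetric group of $\{1,\dots,n\}$. $G=\mathbf{GL}(n,\mathbb{C})$, $B\subset G$ is the Borel subgroup of upper triangular matrices, $T\subset B$ is the maximal torus of diagonal matrices, and $Fl(n,\mathbb{C})=G/B$ is the full flag variety. The symmetric group $\mathbf{S}_n$ is identified with the Weyl group of $G$ (via permutation matrices), and for $w\in\mathbf{S}_n$ the Schubert variety is the Zariski closure $X_w=\overline{BwB/B}\subseteq G/B$. In one-line notation $w=w_1\cdots w_n$, where $w_i$ is the value of $w$ at $i$; $w$ is $312$-avoiding if there are no indices $i<j<k$ with $w_j<w_k<w_i$. The $T$-complexity $c_T(X)$ is the transcendence degree over $\mathbb{C}$ of the field $\mathbb{C}(X)^T$ of $T$-invariant rational functions on $X$ (equivalently, the minimum codimension of a $T$-orbit in $X$). Let $L$ be the standard Levi subgroup (the one containing $T$) of the stabilizer of $X_w$ in $G$, and let $B_L\subseteq L$ be a Borel subgroup of $L$ containing $T$. $X_w$ is spherical if $B_L$ has only finitely many orbits in $X_w$ (equivalently, an open orbit). $X_w$ is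 a nearly toric Schubert variety if it is spherical and $c_T(X_w)=1$ (Schubert varieties are always normal).
   Formalization: The count |NT_n^{312}| = (n-2)2^{n-3} is stated for n ≥ 2 only: for n = 1 the set is empty, since X_w is a point with c_T = 0, while the formula gives -1/4. The claim that T-complexity one implies spherical is stated for all n. *)

(* Defs.v *)
From HB Require Import structures.
From mathcomp Require Import all_boot all_order all_algebra all_fingroup.
From mathcomp Require Import boolp classical_sets functions cardinality reals.
From mathcomp Require Import topology_structure quotient_topology.
From mathcomp Require Import connected.
From mathcomp Require Import complex.
From mathcomp Require Import mpoly.

Set Implicit Arguments.
Unset Strict Implicit.
Unset Printing Implicit Defensive.

Import GRing.Theory.

Local Open Scope classical_set_scope.
Local Open Scope quotient_scope.
Local Open Scope ring_scope.

(* Subgroups of a possibly infinite group, as classical sets. *)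
Section Subgroups.
Variable G : groupType.
Local Open Scope group_scope.

Definition subgroup (H : set G) : Prop :=
  [/\ H 1, forall x y, H x -> H y -> H (x * y) & forall x, H x -> H x^-1].

Definition generated (A : set G) : set G :=
  \bigcap_(H in [set H : set G | subgroup H /\ A `<=` H]) H.

Definition derived_subgroup (H : set G) : set G :=
  generated [set x^-1 * y^-1 * x * y | x in H & y in H].

Definition solvable_subgroup (H : set G) : Prop :=
  exists k : nat, iter k derived_subgroup H `<=` [set 1].

Definition normal_in (N P : set G) : Prop :=
  N `<=` P /\ forall x y, P x -> N y -> N (x * y * x^-1).

End Subgroups.

Section GeneralLinear.
Variables (R : realType) (n : nat).

Record GL : Type := MkGL { GLmx :> 'M[R[i]]_n; GLmx_unit : GLmx \in unitmx }.

HB.instance Definition _ := [isSub for GLmx].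
HB.instance Definition _ := [Choice of GL by <:].

Lemma GL_mul_subproof (g h : GL) : GLmx g *m GLmx h \in unitmx.
Proof. by rewrite unitmx_mul !GLmx_unit. Qed.
Lemma GL_inv_subproof (g : GL) : invmx (GLmx g) \in unitmx.
Proof. by rewrite unitmx_inv GLmx_unit. Qed.

Definition GL_one : GL := MkGL (unitmx1 _ n).
Definition GL_mul (g h : GL) : GL := MkGL (GL_mul_subproof g h).
Definition GL_inv (g : GL) : GL := MkGL (GL_inv_subproof g).

Lemma GL_mulA : associative GL_mul.
Proof. by move=> g h k; apply/val_inj; rewrite /= mulmxA. Qed.
Lemma GL_mul1 : left_id GL_one GL_mul.
Proof. by move=> g; apply/val_inj; rewrite /= mul1mx. Qed.
Lemma GL_mulr1 : right_id GL_one GL_mul.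
Proof. by move=> g; apply/val_inj; rewrite /= mulmx1. Qed.
Lemma GL_mulV : left_inverse GL_one GL_inv GL_mul.
Proof. by move=> g; apply/val_inj; rewrite /= mulVmx ?GLmx_unit. Qed.
Lemma GL_mulrV : right_inverse GL_one GL_inv GL_mul.
Proof. by move=> g; apply/val_inj; rewrite /= mulmxV ?GLmx_unit. Qed.

HB.instance Definition _ :=
  isGroup.Build GL GL_mulA GL_mul1 GL_mulr1 GL_mulV GL_mulrV.

(* A polynomial in the n * n matrix entries, evaluated at a matrix. *)
Definition peval (p : {mpoly R[i][n * n]}) (g : GL) : R[i] :=
  p.@[fun k => mxvec (GLmx g) 0 k].

(* Since det is invertible on GL, the zero loci of polynomials in the entries  *)
(* are all the zero loci of elements of the coordinate ring C[x_ij, 1/det].    *)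
Definition zero_locus (S : set ({mpoly R[i][n * n]})) : set GL :=
  [set g | forall p, S p -> peval p g = 0].

Definition zariski_open (U : set GL) : Prop :=
  exists S, U = ~` zero_locus S.

Lemma zariski_openT : zariski_open setT.
Proof.
exists [set 1 : {mpoly R[i][n * n]}].
apply/esym/seteqP; split=> // g _ /(_ 1 erefl) /eqP.
by rewrite /peval meval1 oner_eq0.
Qed.

Lemma zariski_openI : setI_closed zariski_open.
Proof.
move=> _ _ [S ->] [S' ->]; exists [set p * q | p in S & q in S'].
rewrite -setCU; congr (~` _); apply/seteqP; split=> g.
  move=> Sg _ [p Sp [q Sq <-]]; rewrite /peval mevalM.
  case: Sg => Sg.
    by have := Sg _ Sp; rewrite /peval => ->; rewrite mul0r.
  by have := Sg _ Sq; rewrite /peval => ->; rewrite mulr0.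
move=> Sg; apply: contrapT => /not_orP[/existsNP[p /not_implyP[Sp /eqP p0]]].
move=> /existsNP[q /not_implyP[Sq /eqP q0]].
have := Sg (p * q) (ex_intro2 _ _ p Sp (ex_intro2 _ _ q Sq erefl)).
rewrite /peval mevalM => /eqP; rewrite mulf_eq0.
by move: p0 q0; rewrite /peval => /negbTE -> /negbTE ->.
Qed.

Lemma zariski_open_bigU (J : Type) (f : J -> set GL) :
  (forall i, zariski_open (f i)) -> zariski_open (\bigcup_i f i).
Proof.
move=> /choice[S fE]; exists (\bigcup_i S i).
under eq_bigcupr do rewrite fE.
rewrite -setC_bigcap; congr (~` _); apply/seteqP; split=> g Sg.
  by move=> p [i _ Sp]; exact: (Sg i I).
by move=> i _ p Sp; apply: Sg; exists i.
Qed.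

HB.instance Definition _ := isOpenTopological.Build GL
  zariski_openT zariski_openI zariski_open_bigU.

(* MathComp's [is_trig_mx] means lower triangular. *)
Definition upper_tri (g : GL) : bool := is_trig_mx (GLmx g)^T.
Definition borel : set GL := [set g | upper_tri g].
Definition torus : set GL := [set g | is_diag_mx (GLmx g)].

(* The matrix sending the basis vector e_j to e_(w j). *)
Lemma permGL_subproof (w : 'S_n) :
  \matrix_(i, j) (i == w j)%:R \in @unitmx R[i] n.
Proof.
rewrite -unitmx_tr (_ : _^T = perm_mx w) ?unitmx_perm//.
by apply/matrixP => i j; rewrite !mxE eq_sym.
Qed.
Definition permGL (w : 'S_n) : GL := MkGL (permGL_subproof w).

Lemma upper_tri1 : upper_tri 1%g.
Proof. by rewrite /upper_tri /= trmx1 scalar_mx_is_trig. Qed.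

Lemma upper_triM (g h : GL) :
  upper_tri g -> upper_tri h -> upper_tri (g * h)%g.
Proof.
move=> /is_trig_mxP gB /is_trig_mxP hB; apply/is_trig_mxP => i j ij.
rewrite !mxE big1// => k _; have [kj|jk] := ltnP k j.
  by have := gB _ _ kj; rewrite mxE => ->; rewrite mul0r.
by have := hB _ _ (leq_trans ij jk); rewrite mxE => ->; rewrite mulr0.
Qed.

Lemma upper_triV (g : GL) : upper_tri g -> upper_tri g^-1%g.
Proof.
move=> gB; have /is_trig_mxP gT := gB.
have gD i : GLmx g i i != 0.
  have := GLmx_unit g; rewrite unitmxE -det_tr (det_trig gB) unitfE.
  by move=> /prodf_neq0 /(_ i isT); rewrite mxE.
apply/is_trig_mxP => i j; rewrite mxE.
have [m] := ubnP (n - j); elim: m j => // m IH j le_nj ij.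
have := congr1 (fun h : GL => GLmx h j i) (mulgV g).
rewrite /= !mxE (bigD1 j)//= big1 ?addr0 => [|k kj].
  rewrite -val_eqE /= gtn_eqF// => /eqP; rewrite mulf_eq0 (negbTE (gD j))/=.
  by move/eqP.
have [lt_kj|le_jk] := ltnP k j.
  by have := gT _ _ lt_kj; rewrite mxE => ->; rewrite mul0r.
have lt_jk : (j < k)%N by rewrite ltn_neqAle le_jk eq_sym kj.
suff -> : invmx g k i = 0 by rewrite mulr0.
apply: IH; last exact: ltn_trans ij lt_jk.
by rewrite (leq_trans (ltn_sub2l (ltn_ord j) lt_jk)).
Qed.

Definition flag_rel : rel GL := fun g h => upper_tri (g^-1 * h)%g.

Lemma flag_rel_refl : reflexive flag_rel.
Proof. by move=> g; rewrite /flag_rel mulVg upper_tri1. Qed.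
Lemma flag_rel_sym : ssrbool.symmetric flag_rel.
Proof.
suff imp g h : flag_rel g h -> flag_rel h g by move=> g h; apply/idP/idP; exact: imp.
by rewrite /flag_rel => /upper_triV; rewrite invMg invgK.
Qed.
Lemma flag_rel_trans : transitive flag_rel.
Proof.
move=> h g k gh hk; rewrite /flag_rel -(mulKVg h k) mulgA.
exact: upper_triM.
Qed.

Definition flag_equiv := EquivRel flag_rel flag_rel_refl flag_rel_sym flag_rel_trans.

(* The flag variety G/B; its Zariski topology is the quotient topology. *)
Definition Fl : Type := quotient_topology {eq_quot flag_equiv}.
HB.instance Definition _ := Topological.on Fl.
HB.instance Definition _ := Quotient.on Fl.

Definition coset (g : GL) : Fl := \pi_Fl g.

(* Left translation by g; well defined on cosets by [act_coset]. *)
Definition act (g : GL) (x : Fl) : Fl := coset (g * generic_quotient.repr x)%g.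

Lemma coset_eq (g h : GL) : coset g = coset h <-> borel (g^-1 * h)%g.
Proof. by split=> [/eqmodP|gh]; [|apply/eqmodP]. Qed.

Lemma act_coset (g h : GL) : act g (coset h) = coset (g * h)%g.
Proof.
apply/coset_eq; rewrite invMg mulgA mulgKV; apply/coset_eq.
by rewrite /coset reprK.
Qed.

Definition orbit_under (H : set GL) (x : Fl) : set Fl := [set act g x | g in H].

Definition schubert (w : 'S_n) : set Fl :=
  closure (orbit_under borel (coset (permGL w))).

(* Regular functions. On GL they are locally quotients of polynomials; the     *)
(* structure sheaf of G/B consists of the functions that are regular after     *)
(* pullback to GL; a subvariety X of G/B carries the induced sheaf.            *)
Definition regular_GL (V : set GL) (F : GL -> R[i]) : Prop :=
  forall g, V g -> exists p q : {mpoly R[i][n * n]}, peval q g != 0 /\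
    forall h, V h -> peval q h != 0 -> F h = peval p h / peval q h.

Definition regular_Fl (V : set Fl) (F : Fl -> R[i]) : Prop :=
  regular_GL (coset @^-1` V) (F \o coset).

Definition regular_on (U : set Fl) (f : Fl -> R[i]) : Prop :=
  forall x, U x -> exists (V : set Fl) (F : Fl -> R[i]),
    [/\ open V, V x, regular_Fl V F & forall y, U y -> V y -> f y = F y].

(* A rational function on an irreducible X is represented by a regular         *)
(* function on a nonempty open subset of X; [rval] is irrelevant off [rdom].   *)
(* Representatives are identified when they agree [generically].               *)
Record ratfun (X : set Fl) := RatFun {
  rdom : set Fl;
  rval : Fl -> R[i];
  rdom_open : exists2 V : set Fl, open V & rdom = X `&` V;
  rdom_neq0 : rdom !=set0;
  rval_regular : regular_on rdom rval }.

Definition generically (X : set Fl) (Q : Fl -> Prop) : Prop :=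
  exists V : set Fl, [/\ open V, X `&` V !=set0 & forall x, X x -> V x -> Q x].

Definition torus_invariant (X : set Fl) (f : ratfun X) : Prop :=
  forall t, torus t -> generically X (fun x =>
    [/\ rdom f x, rdom f (act t x) & rval f (act t x) = rval f x]).

(* P(f_1, ..., f_k) = 0 in the function field only for P = 0. *)
Definition alg_independent (X : set Fl) (k : nat) (f : 'I_k -> ratfun X) : Prop :=
  forall P : {mpoly R[i][k]},
    generically X (fun x => (forall j, rdom (f j) x) /\
                            P.@[fun j => rval (f j) x] = 0) -> P = 0.

(* d is the transcendence degree over C of the subfield K of C(X). *)
Definition trdeg_is (X : set Fl) (K : set (ratfun X)) (d : nat) : Prop :=
  (exists f : 'I_d -> ratfun X, (forall j, K (f j)) /\ alg_independent f) /\
  (forall (k : nat) (f : 'I_k -> ratfun X),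
     (forall j, K (f j)) -> alg_independent f -> (k <= d)%N).

Definition T_complexity_is (X : set Fl) (d : nat) : Prop :=
  trdeg_is [set f : ratfun X | torus_invariant f] d.

Definition stabilizer (X : set Fl) : set GL := [set g | act g @` X = X].

Definition unipotent (g : GL) : Prop :=
  exists k : nat, (GLmx g - 1%:M) ^+ k = 0.

Definition unip_normal_subgroup (P U : set GL) : Prop :=
  [/\ subgroup U, normal_in U P, closed U, connected U &
      forall g, U g -> unipotent g].

Definition unipotent_radical (P U : set GL) : Prop :=
  unip_normal_subgroup P U /\
  forall U', unip_normal_subgroup P U' -> U' `<=` U.

(* L is a Levi subgroup of P, i.e. P is the semidirect product of its          *)
(* unipotent radical by the closed subgroup L.                                 *)
Definition levi_subgroup (P L : set GL) : Prop :=
  [/\ subgroup L, closed L & exists U, [/\ unipotent_radical P U,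
      L `&` U = [set 1%g] & P = [set (l * u)%g | l in L & u in U]]].

Definition connected_solvable_in (L H : set GL) : Prop :=
  [/\ subgroup H, H `<=` L, closed H, connected H & solvable_subgroup H].

Definition borel_subgroup (L H : set GL) : Prop :=
  connected_solvable_in L H /\
  forall H', connected_solvable_in L H' -> H `<=` H' -> H' = H.

(* The Levi subgroup of the stabilizer containing T is unique, and its Borel   *)
(* subgroups containing T are conjugate in it, so the choices do not matter.   *)
Definition spherical (X : set Fl) : Prop :=
  exists L BL : set GL,
    [/\ levi_subgroup (stabilizer X) L, torus `<=` L,
        borel_subgroup L BL, torus `<=` BL &
        finite_set [set orbit_under BL x | x in X]].

(* Schubert varieties are normal, so normality is not required separately. *)
Definition nearly_toric (w : 'S_n) : Prop :=
  spherical (schubert w) /\ T_complexity_is (schubert w) 1%N.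

End GeneralLinear.

Arguments permGL R {n} w.
Arguments schubert R {n} w.
Arguments nearly_toric R {n} w.

Definition avoids312 (n : nat) (w : 'S_n) : bool :=
  ~~ [exists i : 'I_n, exists j : 'I_n, exists k : 'I_n,
       [&& (i < j)%N, (j < k)%N, (w j < w k)%N & (w k < w i)%N]].

Definition S312 (n : nat) : {set 'S_n} := [set w : 'S_n | avoids312 w]%SET.

Definition NT312 (R : realType) (n : nat) : {set 'S_n} :=
  [set w in S312 n | `[< nearly_toric R w >]]%SET.

(* Main.v *)
From HB Require Import structures.
From mathcomp Require Import all_boot all_order all_algebra all_fingroup.
From mathcomp Require Import boolp classical_sets cardinality reals.
From mathcomp Require Import topology_structure connected.
From mathcomp Require Import complex mpoly ring zify.
Require Import Defs.

(* For a position i let N(i) be the set of later positions carrying a smaller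
   value. The open cell of X_w is the space of unitriangular matrices supported
   on the pairs (j, i) with j in N(i), and T scales the entry (j, i) by a
   character of weight e_j - e_i. When w avoids 312 each N(i) spans a decreasing
   subsequence, so the weights of the first elements of the N(i) form a basis of
   the weights that occur, every other entry yields a T-invariant monomial of a
   321-pattern, and the T-complexity is the sum of the (#|N(i)| - 1)^+.
   Complexity one thus means that #|N(i0)| = 2 for one i0 and #|N(i)| <= 1
   otherwise. Then w(i0) = i0 + 2 (counting from 0), the simple root
   (i0 + 1, i0 + 2) belongs to the Levi subgroup, and its root subgroup moves
   every point of X_w into the Hessenberg flags g B with g_{am} = 0 for
   a > m + 1, up to a simple reflection. On these T has finitely many orbits, by
   the Bruhat decomposition.
   In terms of the Lehmer code i |-> #|N(i)|, the permutations to be counted are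
   those whose code has a single 2, followed by a 1, ends with 0 and is otherwise
   an arbitrary 0/1 sequence. *)

Set Implicit Arguments.
Unset Strict Implicit.
Unset Printing Implicit Defensive.

Import Order.TTheory GRing.Theory Num.Theory.

(** * Inversions and Lehmer codes *)

(** Two devices stand in for algebraic geometry. Density and irreducibility are checked on lines:
    the coordinates of a cell, B and its block subgroups contain the invertible points of the line
    through any two of their points, and two nonzero polynomials in one variable have a common
    non-root. The Levi and Borel subgroups required by sphericality are obtained without computing
    the stabilizer: for any closed group Q containing B, inclusion of root subgroups in Q is a
    preorder on the indices, and its classes are the Levi blocks. Of the stabilizer it then suffices
    to exhibit one lower root subgroup. It is needed because column i0 of a flag in X_w reaches one
    row too far to be Hessenberg: with the opposite root (i0 + 2, i0 + 1) in the stabilizer, the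
    upper root subgroup lies in the Levi factor and may be used to clear an entry before two rows
    are exchanged. The invariant of a 321-pattern is a monomial in cell coordinates, but a rational
    function must be given on G/B; quotients of flag minors with equal B-characters provide it. *)

Section LehmerCode.
Variables (n : nat).
Implicit Types (w : 'S_n) (i j k m : 'I_n).

Definition inversions w i : {set 'I_n} := [set j : 'I_n | (i < j)%N && (w j < w i)%N].

Definition triangle w i j k : bool :=
  [&& (i < j)%N, (j < k)%N, (w j < w i)%N & (w k < w j)%N].

Lemma card_ord_lt (k : 'I_n) : #|[set a : 'I_n | (a < k)%N]| = k.
Proof.
have wI : injective (widen_ord (ltnW (ltn_ord k))).
  by move=> a b /(congr1 val) /= /val_inj.
rewrite -[RHS]card_ord -(card_imset _ wI).
apply: eq_card => a; rewrite inE; apply/idP/imsetP => [ak|[b _ ->]]; last by rewrite /= ltn_ord.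
by exists (Ordinal ak) => //; apply/val_inj.
Qed.

Lemma card_smaller w m : #|[set j | (w j < w m)%N]| = w m.
Proof.
rewrite -[RHS]card_ord_lt -(card_imset _ (@perm_inj _ w)).
apply: eq_card => a; rewrite inE; apply/imsetP/idP => [[j + ->]|am]; first by rewrite inE.
by exists (w^-1%g a); rewrite ?inE permKV.
Qed.

Lemma smaller_split w m :
  [set j | (w j < w m)%N] = [set j : 'I_n | (j < m)%N && (w j < w m)%N] :|: inversions w m.
Proof.
apply/setP => j; rewrite !inE -andb_orl; case: (ltngtP j m) => //= /val_inj ->.
by rewrite ltnn.
Qed.

(** Of the [w m] positions with a value below [w m], at most m lie before m; the others are the
    inversions of m. *)
Lemma perm_leq_inversions w m : (w m <= m + #|inversions w m|)%N.
Proof.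
rewrite -{1}card_smaller smaller_split (leq_trans (leq_card_setU _ _))// leq_add2r.
rewrite -[X in (_ <= X)%N]card_ord_lt; apply/subset_leq_card/fintype.subsetP => j.
by rewrite !inE => /andP[].
Qed.

(** The i positions before i and the inversions of i are disjoint, and [w] sends all of them to
    values at most i, of which there are only i + 1. *)
Lemma hess_perm_inversions w i : (forall j, (w j <= j.+1)%N) -> (#|inversions w i| <= 1)%N.
Proof.
move=> wH; rewrite -(leq_add2l i) addn1 -[X in (X + _)%N](card_ord_lt i) -cardsUI.
rewrite [_ :&: inversions w i](_ : _ = finset.set0) ?cards0 ?addn0; last first.
  by apply/setP => j; rewrite !inE; case: (ltngtP j i).
rewrite -(card_imset _ (@perm_inj _ w)).
have le_i : (#|i |: [set a : 'I_n | (a < i)%N]| <= i.+1)%N.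
  by rewrite cardsU1 card_ord_lt inE ltnn.
apply: leq_trans le_i; apply/subset_leq_card/fintype.subsetP => _ /imsetP[j + ->].
rewrite !inE -val_eqE /= -leq_eqVlt => /orP[ji|/andP[_ wji]].
  exact: leq_trans (wH j) ji.
by rewrite -ltnS; exact: leq_trans wji (wH i).
Qed.

(** An earlier position with a larger value would have i0 and both inversions of i0 among its own
    inversions, three in all. So exactly i0 + 2 positions carry smaller values: all the earlier ones
    and the two inversions. *)
Lemma hyper_perm_value w i0 : #|inversions w i0| = 2 ->
  (forall i, i != i0 -> (#|inversions w i| <= 1)%N) -> w i0 = i0.+2 :> nat.
Proof.
move=> c2 c1; have sm j : (j < i0)%N -> (w j < w i0)%N.
  move=> ji; rewrite ltnNge; apply/negP => wij.
  have {}wij : (w i0 < w j)%N.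
    by rewrite ltn_neqAle wij andbT val_eqE (inj_eq perm_inj) -val_eqE gtn_eqF.
  have : (#|i0 |: inversions w i0| <= #|inversions w j|)%N.
    apply/subset_leq_card/fintype.subsetP => k; rewrite !inE => /orP[/eqP->|/andP[ik wki]].
      by rewrite ji wij.
    by rewrite (ltn_trans ji ik) (ltn_trans wki wij).
  have jN : j != i0 by rewrite -val_eqE ltn_eqF.
  by rewrite cardsU1 inE ltnn c2 => /leq_trans/(_ (c1 j jN)).
have := card_smaller w i0; rewrite smaller_split cardsU.
rewrite [_ :&: inversions w i0](_ : _ = finset.set0) ?cards0 ?subn0; last first.
  by apply/setP => j; rewrite !inE; case: (ltngtP j i0) => _; rewrite /= ?andbF.
rewrite c2 (_ : [set j : 'I_n | _] = [set j : 'I_n | (j < i0)%N]) ?card_ord_lt; last first.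
  by apply/setP => j; rewrite !inE; case: (ltnP j i0) => //= /sm ->.
by move=> <-; rewrite addn2.
Qed.

End LehmerCode.

Section Excess.
Variables (n : nat).
Implicit Types (w : 'S_n) (i j k : 'I_n).

Definition excess w : nat := \sum_i #|inversions w i|.-1.

Lemma avoids312P w : reflect
  (forall i j k, (i < j)%N -> (j < k)%N -> (w j < w k)%N -> (w k < w i)%N -> False)
  (avoids312 w).
Proof.
apply: (iffP idP) => [/existsPn H i j k ij jk wjk wki|H].
  by have /existsPn/(_ j)/existsPn/(_ k) := H i; rewrite ij jk wjk wki.
apply/existsPn => i; apply/existsPn => j; apply/existsPn => k.
by apply/negP => /and4P[]; exact: H.
Qed.

Lemma avoids312_triangle w i j k : avoids312 w ->
  j \in inversions w i -> k \in inversions w i -> (j < k)%N -> triangle w i j k.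
Proof.
move=> /avoids312P av; rewrite !inE => /andP[ij wji] /andP[ik wki] jk.
rewrite /triangle ij jk wji /= ltn_neqAle leqNgt; apply/andP; split.
  by rewrite val_eqE (inj_eq perm_inj) -val_eqE gtn_eqF.
by apply/negP => wjk; exact: av ij jk wjk wki.
Qed.

(* Taking j to be the first inversion of i, the other inversions all span triangles. *)
Lemma first_inversion w i : avoids312 w -> (0 < #|inversions w i|)%N ->
  exists j, j \in inversions w i /\
    forall k, k \in inversions w i :\ j -> triangle w i j k.
Proof.
move=> av /card_gt0P[j0 j0i].
have [j ji jmin] := @arg_minnP _ j0 (fun j => j \in inversions w i) val j0i.
exists j; split=> // k; rewrite in_setD1 => /andP[kj ki].
apply: avoids312_triangle => //; rewrite ltn_neqAle (jmin k ki) andbT.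
by rewrite val_eqE eq_sym.
Qed.

Lemma excess0 w : excess w = 0 -> forall i, (#|inversions w i| <= 1)%N.
Proof.
move=> /eqP; rewrite sum_nat_eq0 => /forallP H i.
by have := H i; rewrite implyTb; case: #|_| => [|[]].
Qed.

Lemma excess_gt0 w : (0 < excess w)%N -> exists i, (1 < #|inversions w i|)%N.
Proof.
move=> e0; apply/existsP; rewrite -[X in is_true X]negbK; apply/negP => /existsPn H.
move: e0; rewrite /excess big1// => i _; have := H i; rewrite -leqNgt.
by case: #|_| => [|[]].
Qed.

Lemma excess1 w : excess w = 1 -> exists i0, #|inversions w i0| = 2 /\
  forall i, i != i0 -> (#|inversions w i| <= 1)%N.
Proof.
move=> e1; have [|i0 c2] := @excess_gt0 w; first by rewrite e1.
move: e1; rewrite /excess (bigD1 i0)//= => e1.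
have {c2} [c2 /eqP] : #|inversions w i0| = 2 /\ \sum_(i < n | i != i0) #|inversions w i|.-1 = 0.
  by move: c2 e1; move: #|_| => c; move: (\sum_(i < n | _) _) => s; lia.
rewrite sum_nat_eq0 => /forallP H; exists i0; split=> // i ii0.
by have := H i; rewrite ii0 implyTb; case: #|_| => [|[]].
Qed.

Lemma one_triangle w : avoids312 w -> (0 < excess w)%N -> exists i j k, triangle w i j k.
Proof.
move=> av /excess_gt0[i ci]; have [j [ji jP]] := first_inversion av (ltnW ci).
have /card_gt0P[k ki] : (0 < #|inversions w i :\ j|)%N.
  by move: ci; rewrite (cardsD1 j) ji.
by exists i, j, k; exact: jP.
Qed.

(** The inequalities say that the long edge of the first triangle is no edge of the second, as
    [triangles_independent] requires. Either one position has three inversions and the triangles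
    share their first edge, or two positions have at least two each; then the triangle starting
    further left comes first, and no edge of the other one lies in its first column. *)
Lemma two_triangles w : avoids312 w -> (1 < excess w)%N ->
  exists i1 j1 k1 i2 j2 k2, [/\ triangle w i1 j1 k1, triangle w i2 j2 k2,
    (k1, i1) != (k2, i2), (k1, i1) != (j2, i2) & (k1, i1) != (k2, j2)].
Proof.
move=> av e2; have [i ci] := excess_gt0 (ltnW e2).
have [j [ji jP]] := first_inversion av (ltnW ci).
have [c3|c3] := ltnP 2 #|inversions w i|.
  have /card_gt1P[k [k' [ki k'i kk']]] : (1 < #|inversions w i :\ j|)%N.
    by move: c3; rewrite (cardsD1 j) ji.
  exists i, j, k, i, j, k'; rewrite !xpair_eqE !eqxx !andbT; split; [exact: jP|exact: jP|by []| |].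
    by move: ki; rewrite in_setD1 => /andP[].
  rewrite negb_and; apply/orP; right; move: ji; rewrite inE => /andP[ij _].
  by rewrite -val_eqE ltn_eqF.
have [i' [ii' ci']] : exists i', i' != i /\ (1 < #|inversions w i'|)%N.
  have : (0 < \sum_(i' | i' != i) #|inversions w i'|.-1)%N.
    move: e2; rewrite /excess (bigD1 i)//=; move: c3; move: #|_| => c.
    by move: (\sum_(i' < n | _) _) => s; lia.
  move=> s0; apply: contrapT => /forallNP H.
  move: s0; rewrite big1// => l li; have [cl|cl] := leqP #|inversions w l| 1.
    by move: cl; case: #|_| => [|[]].
  by case: (H l).
have [j' [j'i jP']] := first_inversion av (ltnW ci').
have /card_gt0P[k ki] : (0 < #|inversions w i :\ j|)%N.
  by move: ci; rewrite (cardsD1 j) ji.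
have /card_gt0P[k' k'i'] : (0 < #|inversions w i' :\ j'|)%N.
  by move: ci'; rewrite (cardsD1 j') j'i.
have sep (a b c d e f : 'I_n) : (a < d)%N -> triangle w d e f ->
    [/\ (c, a) != (f, d), (c, a) != (e, d) & (c, a) != (f, e)].
  move=> ad /and4P[de _ _ _]; rewrite !xpair_eqE -!val_eqE /=.
  by rewrite (ltn_eqF ad) (ltn_eqF (ltn_trans ad de)) !andbF.
case: (ltngtP i i') => [lt_ii|lt_ii|/val_inj iE].
- have [s1 s2 s3] := sep i j k i' j' k' lt_ii (jP' _ k'i').
  by exists i, j, k, i', j', k'; split; [exact: jP | exact: jP' | | |].
- have [s1 s2 s3] := sep i' j' k' i j k lt_ii (jP _ ki).
  by exists i', j', k', i, j, k; split; [exact: jP' | exact: jP | | |].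
- by rewrite iE eqxx in ii'.
Qed.

End Excess.

(** * Permutations correspond to their Lehmer codes *)

Section LehmerBijection.
Variable n : nat.
Implicit Types (w : 'S_n) (i j k : 'I_n).

Lemma card_inversions_lt w i : (#|inversions w i| < n - i)%N.
Proof.
have : (#|inversions w i :|: [set j : 'I_n | (j < i)%N] :|: [set i]| <= n)%N.
  by rewrite -[X in (_ <= X)%N](card_ord n) max_card.
rewrite finset.setUC cardsU1 !inE ltnn /= cardsU card_ord_lt.
rewrite [_ :&: _](_ : _ = finset.set0) ?cards0 ?subn0; last first.
  by apply/setP => j; rewrite !inE; case: (ltngtP j i); rewrite ?andbF.
by rewrite add1n ltn_subRL addnC.
Qed.

Definition lehmer w : {ffun 'I_n -> 'I_n.+1} := [ffun i => inord #|inversions w i|].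

Lemma lehmerE w i : lehmer w i = #|inversions w i| :> nat.
Proof.
rewrite ffunE inordK// ltnS; have := card_inversions_lt w i.
by move/ltnW/leq_trans; apply; exact: leq_subr.
Qed.

Lemma card_unused_values w i :
  #|[set a : 'I_n | (a < w i)%N && (i < w^-1%g a)%N]| = #|inversions w i|.
Proof.
rewrite -[RHS](card_imset _ (@perm_inj _ w)); apply: eq_card => a; rewrite inE.
apply/andP/imsetP => [[awi iwa]|[j + ->]].
  by exists (w^-1%g a); rewrite ?inE ?permKV ?iwa.
by rewrite inE permK => /andP[ij wji].
Qed.

Lemma lehmer_inj : injective lehmer.
Proof.
move=> w w' ww; have cE i : #|inversions w i| = #|inversions w' i|.
  by rewrite -!lehmerE ww.
apply/permP => i; have [m] := ubnP (nat_of_ord i); elim: m i => // m IH i im.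
have prev j : (j < i)%N -> w j = w' j by move=> ji; apply: IH; exact: leq_trans ji im.
have used (v v' : 'S_n) a : (forall j, (j < i)%N -> v j = v' j) ->
    (i <= (v : 'S_n)^-1%g a)%N -> (i <= (v' : 'S_n)^-1%g a)%N.
  move=> vv; apply: contraTT; rewrite -!ltnNge => lt_i.
  by have := vv _ lt_i; rewrite permKV => <-; rewrite permK.
have main (v v' : 'S_n) : (forall j, (j < i)%N -> v j = v' j) ->
    #|inversions v i| = #|inversions v' i| -> (v' i <= v i)%N.
  move=> vv cvv; rewrite leqNgt; apply/negP => lt_v.
  move: cvv; rewrite -!card_unused_values => /eqP; apply/negP; rewrite neq_ltn.
  apply/orP; left; apply: proper_card; apply/properP; split.
    apply/fintype.subsetP => a; rewrite !inE => /andP[av iva].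
    rewrite (ltn_trans av lt_v) ltn_neqAle (used _ _ _ vv (ltnW iva)) andbT.
    apply: contraTneq av => /val_inj ia; have -> : a = v' i by rewrite ia permKV.
    by rewrite -leqNgt ltnW.
  exists (v i); rewrite !inE ?ltnn// lt_v ltn_neqAle.
  rewrite (used _ _ _ vv) ?permK// andbT.
  apply: contraTneq lt_v => /val_inj ia; have -> : v' i = v i by rewrite [in LHS]ia permKV.
  by rewrite ltnn.
apply/val_inj/eqP; rewrite /= eqn_leq.
by apply/andP; split; apply: main => // j /prev.
Qed.

Lemma card_ltn_pred m : (m <= n)%N -> #|[pred c : 'I_n.+1 | (c < m)%N]| = m.
Proof.
move=> mn; have := card_ord_lt (inord m : 'I_n.+1); rewrite inordK// => E.
by rewrite -[RHS]E; apply: eq_card => c; rewrite !inE.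
Qed.

Lemma card_familyE (G : 'I_n -> pred 'I_n.+1) : #|family G| = \prod_i #|G i|.
Proof. by rewrite card_family foldrE big_image. Qed.

(** By counting: [lehmer] is injective, and there are n! admissible codes because n - i runs through
    n, .., 1. *)
Lemma lehmer_onto (f : {ffun 'I_n -> 'I_n.+1}) :
  (forall i, (f i < n - i)%N) -> exists w, lehmer w = f.
Proof.
move=> fP; pose G i := [pred c : 'I_n.+1 | (c < n - i)%N].
have cG : #|family G| = n`!.
  rewrite card_familyE (eq_bigr (fun i : 'I_n => n - i)%N) => [|i _]; last first.
    by rewrite card_ltn_pred// leq_subr.
  rewrite fact_prod big_add1 /= big_mkord (reindex_inj rev_ord_inj) /=.
  by apply: eq_bigr => i _; have := ltn_ord i; lia.
have sub : lehmer @: [set: 'S_n] \subset family G.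
  apply/fintype.subsetP => _ /imsetP[w _ ->]; apply/familyP => i.
  by rewrite inE lehmerE card_inversions_lt.
have := subset_cardP _ sub; rewrite card_imset; last exact: lehmer_inj.
rewrite cardsT card_Sn cG => /(_ erefl)/(_ f) fE.
have : f \in family G by apply/familyP => i; rewrite inE.
by rewrite -fE => /imsetP[w _ ->]; exists w.
Qed.

Lemma card_lehmer_preim (D : {set {ffun 'I_n -> 'I_n.+1}}) :
  (forall f, f \in D -> forall i, (f i < n - i)%N) ->
  #|[set w | lehmer w \in D]| = #|D|.
Proof.
move=> DP; rewrite -(card_imset _ lehmer_inj); apply: eq_card => f.
apply/imsetP/idP => [[w + ->]|fD]; first by rewrite inE.
by have [w wf] := lehmer_onto (DP f fD); exists w; rewrite ?inE wf.
Qed.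

End LehmerBijection.

(** * Counting the 312-avoiding permutations of excess one *)

Section Count.
Variable n : nat.
Implicit Types (w : 'S_n) (i j k : 'I_n).

Definition hyper_range (i0 i : 'I_n) : pred 'I_n.+1 :=
  if i == i0 then [pred c : 'I_n.+1 | c == 2 :> nat]
  else if i == i0.+1 :> nat then [pred c : 'I_n.+1 | c == 1 :> nat]
  else if i == n.-1 :> nat then [pred c : 'I_n.+1 | c == 0 :> nat]
  else [pred c : 'I_n.+1 | (c <= 1)%N].

Definition hyper_codes (i0 : 'I_n) : {set {ffun 'I_n -> 'I_n.+1}} :=
  [set f in family (hyper_range i0)].

Lemma hyper_codesP (i0 : 'I_n) (f : {ffun 'I_n -> 'I_n.+1}) : f \in hyper_codes i0 ->
  [/\ f i0 = 2 :> nat, forall i, i = i0.+1 :> nat -> f i = 1 :> nat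
    & forall i, i != i0 -> (f i <= 1)%N].
Proof.
rewrite inE => /familyP H; split.
- by have := H i0; rewrite /hyper_range eqxx => /eqP.
- move=> i iE; have := H i; rewrite /hyper_range -(val_eqE i i0) /= iE eqxx gtn_eqF// inE.
  by move=> /eqP.
- move=> i ii0; have := H i; rewrite /hyper_range (negbTE ii0).
  by case: ifP => [_ /eqP->//|_]; case: ifP => [_ /eqP->//|_]; rewrite inE.
Qed.

(** Otherwise [w i <= w i'], and every inversion of i would be one of i', which has too few. *)
Lemma inversions_succ w i i' : i' = i.+1 :> nat ->
  (1 < #|inversions w i|)%N -> (#|inversions w i'| <= 1)%N -> i' \in inversions w i.
Proof.
move=> i'E c2 c1; rewrite inE i'E ltnSn /= ltnNge; apply/negP => wi.
suff /subset_leq_card : inversions w i \subset inversions w i'.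
  by move/(leq_trans c2); rewrite ltnNge c1.
apply/fintype.subsetP => j; rewrite !inE => /andP[ij wji].
rewrite (leq_trans wji wi) andbT ltn_neqAle i'E ij andbT.
apply: contraTneq wji => i'j; rewrite -leqNgt (leq_trans wi)//.
by rewrite (_ : i' = j)//; apply/val_inj; rewrite /= i'E.
Qed.

(** The entry 1 after the 2 encodes avoidance: the inversions of i0 are i0 + 1 and some k, and they
    decrease exactly when k is an inversion of i0 + 1. A 312-pattern can start only at i0, the one
    position with two inversions. *)
Lemma hyper_permP w : avoids312 w && (excess w == 1) =
  [exists i0 : 'I_n, (i0.+2 < n)%N && (lehmer w \in hyper_codes i0)].
Proof.
apply/andP/existsP => [[av /eqP e1]|[i0 /andP[i0n /hyper_codesP[f2 f1 fle]]]].
  have [i0 [c2 c1]] := excess1 e1; exists i0.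
  have i0n : (i0.+2 < n)%N by have := card_inversions_lt w i0; rewrite c2; lia.
  rewrite i0n inE; apply/familyP => i; rewrite /hyper_range.
  have [->|ii0] := eqVneq i i0; first by rewrite inE lehmerE c2.
  case: eqP => [iE|_].
    rewrite inE lehmerE eqn_leq c1//=; apply/card_gt0P.
    have i_inv : i \in inversions w i0 by apply: inversions_succ => //; rewrite ?c2 ?c1.
    have /card_gt0P[k] : (0 < #|inversions w i0 :\ i|)%N.
      by move: c2; rewrite (cardsD1 i) i_inv add1n => -[->].
    rewrite in_setD1 => /andP[ki k_inv]; exists k.
    have ik : (i < k)%N.
      move: (k_inv); rewrite inE iE => /andP[lt_k _].
      by rewrite ltn_neqAle lt_k andbT -iE val_eqE eq_sym.
    have /and4P[_ _ _ wki] := avoids312_triangle av i_inv k_inv ik.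
    by rewrite inE ik.
  case: eqP => [iE|_]; rewrite inE lehmerE; last exact: c1.
  have := card_inversions_lt w i; rewrite iE (_ : n - n.-1 = 1)%N; last by lia.
  by rewrite ltnS leqn0.
have {f2} c2 : #|inversions w i0| = 2 by rewrite -lehmerE.
have {fle} c1 i : i != i0 -> (#|inversions w i| <= 1)%N by rewrite -lehmerE; apply: fle.
split; last first.
  rewrite /excess (bigD1 i0)//= c2 big1// => i /c1.
  by case: #|_| => [|[]].
pose i1 := Ordinal (ltnW i0n).
have i1N : i1 != i0 by rewrite -val_eqE /= gtn_eqF.
have i1_inv : i1 \in inversions w i0 by apply: inversions_succ; rewrite ?c2 ?c1.
have i1c : #|inversions w i1| = 1 by rewrite -lehmerE f1.
apply/avoids312P => i j k ij jk wjk wki.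
have ji : j \in inversions w i by rewrite inE ij (ltn_trans wjk wki).
have ki : k \in inversions w i by rewrite inE (ltn_trans ij jk) wki.
have jNk : j != k by rewrite -val_eqE ltn_eqF.
have ii0 : i = i0.
  apply: contraTeq isT => /c1 ci; have : (1 < #|inversions w i|)%N.
    by apply/card_gt1P; exists j, k.
  by rewrite ltnNge ci.
rewrite {}ii0 {i} in ij wki ji ki.
have inv_jk : inversions w i0 = [set j; k].
  apply/esym/eqP; rewrite eqEcard cards2 jNk c2 leqnn andbT.
  by apply/fintype.subsetP => l /set2P[]->.
have i1j : i1 = j.
  move: i1_inv; rewrite inv_jk !inE => /orP[/eqP//|/eqP i1k].
  by move: jk; rewrite -i1k /= ltnNge ij.
(* An inversion [l] of i1 = j is again an inversion of i0, hence j or k; but l comes after j with a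
   smaller value, while [w j < w k]. *)
have /card_gt0P[l] : (0 < #|inversions w i1|)%N by rewrite i1c.
rewrite i1j inE => /andP[jl wlj].
have : l \in inversions w i0.
  by rewrite inE (ltn_trans ij jl) (ltn_trans wlj (ltn_trans wjk wki)).
rewrite inv_jk !inE => /orP[/eqP lj|/eqP lk]; first by rewrite lj ltnn in jl.
by move: wlj; rewrite lk ltnNge (ltnW wjk).
Qed.

Lemma card_hyper_codes (i0 : 'I_n) : (i0.+2 < n)%N -> #|hyper_codes i0| = (2 ^ (n - 3))%N.
Proof.
move=> i0n; rewrite cardsE card_familyE.
have n1 : (n.-1 < n)%N by lia.
pose i1 := Ordinal (ltnW i0n); pose i2 := Ordinal n1.
(* The three positions with a prescribed entry are distinct because i0 + 2 < n; each of the other n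
   - 3 offers two choices. *)
pose A := [set i0; i1; i2].
have cA : #|~: A| = (n - 3)%N.
  rewrite cardsCs finset.setCK card_ord /A finset.setUC cardsU1 cards2 !inE -!val_eqE /=.
  by congr (n - _)%N; lia.
rewrite -cA -prod_nat_const [RHS]big_mkcond /=; apply: eq_bigr => i _.
rewrite !inE !negb_or /hyper_range -!val_eqE /=.
have cn m : (m <= n)%N -> #|[pred c : 'I_n.+1 | c == m :> nat]| = 1.
  move=> mn; rewrite -(card1 (inord m : 'I_n.+1)); apply: eq_card => c.
  by rewrite !inE -val_eqE /= inordK.
case: eqP => _; first by rewrite cn//; lia.
case: eqP => _; first by rewrite cn//; lia.
case: eqP => _; first by rewrite cn.
rewrite -[RHS](@card_ltn_pred n 2); last by lia.
by apply: eq_card => c; rewrite !inE.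
Qed.

Lemma hyper_codes_bound (i0 : 'I_n) (f : {ffun 'I_n -> 'I_n.+1}) : (i0.+2 < n)%N ->
  f \in hyper_codes i0 -> forall i, (f i < n - i)%N.
Proof.
move=> i0n; rewrite inE => /familyP H i; have := H i; rewrite /hyper_range.
have lt_in := ltn_ord i.
case: eqP => [->|_]; first by rewrite inE => /eqP ->; lia.
case: eqP => [iE|_]; first by rewrite inE iE => /eqP ->; lia.
case: eqP => iE; rewrite inE; first by move=> /eqP ->; lia.
by move=> fi; apply: leq_ltn_trans fi _; lia.
Qed.

Lemma card_hyper_perms : (1 < n)%N ->
  #|[set w : 'S_n | avoids312 w && (excess w == 1)]| = ((n - 2) * 2 ^ (n - 3))%N.
Proof.
move=> n1.
(* A code in [hyper_codes i0] has its only 2 at i0, so at most one i0 contributes and the inner sum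
   is an indicator. *)
have -> : #|[set w : 'S_n | avoids312 w && (excess w == 1)]| =
    (\sum_w \sum_(i0 : 'I_n | (i0.+2 < n)%N) (lehmer w \in hyper_codes i0))%N.
  rewrite -sum1_card big_mkcond; apply: eq_bigr => w _; rewrite inE hyper_permP.
  case: existsP => [[i0 /andP[i0n wi0]]|H].
    rewrite (bigD1 i0)//= wi0 big1 ?addn0// => i /andP[i_n ii0].
    apply/eqP; rewrite eqb0; apply/negP => /hyper_codesP[fi2 _ _].
    by have [_ _ /(_ i ii0)] := hyper_codesP wi0; rewrite fi2.
  rewrite big1// => i0 i0n; apply/eqP; rewrite eqb0; apply/negP => wi0.
  by apply: H; exists i0; rewrite i0n.
rewrite exchange_big /= (eq_bigr (fun=> 2 ^ (n - 3))%N) => [|i0 i0n].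
  rewrite sum_nat_const; congr (_ * _)%N.
  have n2 : (n - 2 < n)%N by lia.
  rewrite -[RHS](card_ord_lt (Ordinal n2)); apply: eq_card => i.
  by rewrite [RHS]inE -topredE /=; lia.
rewrite -(card_hyper_codes i0n) -(card_lehmer_preim (fun f => @hyper_codes_bound i0 f i0n)).
rewrite -sum1_card [RHS]big_mkcond /=; apply: eq_bigr => w _.
by rewrite [w \in _]inE; case: (lehmer w \in _).
Qed.

End Count.

Local Open Scope ring_scope.

(** * Polynomial functions *)

Section Subalg.
Variables (T : Type) (F : comNzRingType).

(** One closure principle for several notions of polynomial function: it is instantiated with
    [polyfn], [pfun], [linefn] and [regular_at], so that determinants, products and evaluations need
    no separate treatment. *)
Definition subalg (K : (T -> F) -> Prop) : Prop :=
  [/\ forall c, K (fun=> c),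
      forall f g, K f -> K g -> K (fun x => f x + g x)
    & forall f g, K f -> K g -> K (fun x => f x * g x)].

Variable K : (T -> F) -> Prop.
Hypothesis KA : subalg K.

Lemma subalgC c : K (fun=> c). Proof. by case: KA. Qed.
Lemma subalgD f g : K f -> K g -> K (fun x => f x + g x). Proof. by case: KA => _ + _; apply. Qed.
Lemma subalgM f g : K f -> K g -> K (fun x => f x * g x). Proof. by case: KA => _ _; apply. Qed.

Lemma subalgB f g : K f -> K g -> K (fun x => f x - g x).
Proof.
move=> Kf Kg; have -> : (fun x => f x - g x) = (fun x => f x + (-1) * g x).
  by apply/funext => x; rewrite mulN1r.
by apply: subalgD => //; apply: subalgM => //; apply: subalgC.
Qed.

Lemma subalg_ext f g : f =1 g -> K g -> K f.
Proof. by move=> /funext ->. Qed.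

Lemma subalg_sum (I : Type) (r : seq I) (P : pred I) (f : I -> T -> F) :
  (forall i, P i -> K (f i)) -> K (fun x => \sum_(i <- r | P i) f i x).
Proof.
move=> Kf; elim: r => [|i r IH].
  by apply: (@subalg_ext _ (fun=> 0)) (subalgC 0) => x; rewrite big_nil.
have [Pi|nPi] := boolP (P i).
  apply: subalg_ext (subalgD (Kf i Pi) IH) => x.
  by rewrite big_cons Pi.
by apply: subalg_ext IH => x; rewrite big_cons (negbTE nPi).
Qed.

Lemma subalg_prod (I : Type) (r : seq I) (P : pred I) (f : I -> T -> F) :
  (forall i, P i -> K (f i)) -> K (fun x => \prod_(i <- r | P i) f i x).
Proof.
move=> Kf; elim: r => [|i r IH].
  by apply: (@subalg_ext _ (fun=> 1)) (subalgC 1) => x; rewrite big_nil.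
have [Pi|nPi] := boolP (P i).
  apply: subalg_ext (subalgM (Kf i Pi) IH) => x.
  by rewrite big_cons Pi.
by apply: subalg_ext IH => x; rewrite big_cons (negbTE nPi).
Qed.

Lemma subalgX f m : K f -> K (fun x => f x ^+ m).
Proof.
move=> Kf; elim: m => [|m IH].
  by apply: (@subalg_ext _ (fun=> 1)) (subalgC 1) => x; rewrite expr0.
by apply: subalg_ext (subalgM Kf IH) => x; rewrite exprS.
Qed.

Lemma subalg_meval m (p : {mpoly F[m]}) (v : T -> 'I_m -> F) :
  (forall k, K (fun x => v x k)) -> K (fun x => p.@[v x]).
Proof.
move=> Kv; apply: subalg_ext => [x|]; first by rewrite mevalE.
apply: subalg_sum => i _; apply: subalgM; first exact: subalgC.
by apply: subalg_prod => j _; apply: subalgX.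
Qed.

Lemma subalg_det m (A : T -> 'M[F]_m) :
  (forall i j, K (fun x => A x i j)) -> K (fun x => \det (A x)).
Proof.
move=> KAx; rewrite /determinant; apply: subalg_sum => i _.
by apply: subalgM; [exact: subalgC | apply: subalg_prod].
Qed.

Lemma subalg_mulmx a b c (A : T -> 'M[F]_(a, b)) (B : T -> 'M[F]_(b, c)) :
  (forall i j, K (fun x => A x i j)) -> (forall i j, K (fun x => B x i j)) ->
  forall i j, K (fun x => (A x *m B x) i j).
Proof.
move=> KAx KB i j; apply: subalg_ext => [x|]; first by rewrite mxE.
by apply: subalg_sum => k _; apply: subalgM.
Qed.

End Subalg.

Section Univariate.
Variable F : numFieldType.

Definition polyfn (f : F -> F) : Prop := exists q : {poly F}, f =1 horner q.

Lemma polyfn_subalg : subalg polyfn.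
Proof.
split=> [c|f g [p fp] [q gq]|f g [p fp] [q gq]].
- by exists c%:P => s; rewrite hornerC.
- by exists (p + q) => s; rewrite hornerD fp gq.
- by exists (p * q) => s; rewrite hornerM fp gq.
Qed.

Lemma polyfn_id : polyfn id.
Proof. by exists 'X => s; rewrite hornerX. Qed.

(** In characteristic 0 the numbers 0, .., size q - 1 are distinct, more than q can have as
    roots. *)
Lemma poly_nonroot (q : {poly F}) : q != 0 -> exists s, q.[s] != 0.
Proof.
move=> q0; apply/not_existsP => q_all.
pose rs := [seq (i%:R : F) | i <- iota 0 (size q)].
have : (size rs < size q)%N.
  apply: max_poly_roots => //; first by apply/allP => s _; apply/negPn/negP/q_all.
  by rewrite map_inj_uniq ?iota_uniq// => i j /eqP; rewrite eqr_nat => /eqP.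
by rewrite size_map size_iota ltnn.
Qed.

(** Irreducibility of the affine line. Applied along lines, it yields all later statements that two
    nonempty open sets meet. *)
Lemma polyfn_neq0M f g : polyfn f -> polyfn g ->
  (exists s, f s != 0) -> (exists s, g s != 0) -> exists s, f s != 0 /\ g s != 0.
Proof.
move=> [p fp] [q gq] [s fs] [t gt].
have p0 : p != 0 by apply: contraNneq fs => p0; rewrite fp p0 horner0.
have q0 : q != 0 by apply: contraNneq gt => q0; rewrite gq q0 horner0.
have [r] := @poly_nonroot (p * q) (mulf_neq0 p0 q0).
by rewrite hornerM mulf_eq0 negb_or => /andP[pr qr]; exists r; rewrite fp gq.
Qed.

Lemma polyfn_eq0 f g : polyfn f -> polyfn g -> (exists s, g s != 0) ->
  (forall s, g s != 0 -> f s = 0) -> forall s, f s = 0.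
Proof.
move=> pf pg gN fg s; apply/eqP/negPn/negP => fs.
have [t [ft gt]] := polyfn_neq0M pf pg (ex_intro _ s fs) gN.
by rewrite fg// eqxx in ft.
Qed.

End Univariate.

(** Induction on the number of variables, with P seen through [muni] as a polynomial in the last
    one. For fixed values v of the others it has no non-root and hence zero coefficients; so every
    coefficient of [muni P] vanishes at all v, and the induction hypothesis applies to it. *)
Lemma mpoly_eq0 (F : numFieldType) k (P : {mpoly F[k]}) :
  (forall v, P.@[v] = 0) -> P = 0.
Proof.
elim: k P => [|k IH] P P0.
  apply/mpolyP => m; rewrite mcoeff0 (_ : m = 0%MM); last by apply/mnmP; case.
  have := P0 (fun=> 0); rewrite mevalE.
  under eq_bigr do rewrite big_ord0 mulr1.
  have [m0|] := boolP (0%MM \in msupp P); last by rewrite -mcoeff_eq0 => /eqP.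
  rewrite (bigD1_seq 0%MM) ?msupp_uniq//= big1 ?addr0// => m'.
  by rewrite (_ : m' = 0%MM) ?eqxx//; apply/mnmP; case.
pose wd := widen_ord (leqnSn k).
pose rs (m : 'X_{1..k.+1}) := [multinom m (wd i) | i < k].
have coefP j : (muni P)`_j =
    \sum_(m <- msupp P | m ord_max == j) P@_m *: 'X_[rs m].
  rewrite muniE coef_sum [RHS]big_mkcond /=; apply: eq_bigr => m _.
  by rewrite coefZ coefXn eq_sym; case: eqP; rewrite ?mulr1 ?mulr0.
have P0coef j : (muni P)`_j = 0.
  apply: IH => v; pose q := \sum_(m <- msupp P)
    (P@_m * \prod_(i < k) v i ^+ m (wd i)) *: ('X^(m ord_max) : {poly F}).
  have q0 : q = 0.
    apply: contrapT => /eqP /poly_nonroot[s /eqP]; apply.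
    pose u (i : 'I_k.+1) := if insub (i : nat) is Some i' then v i' else s.
    rewrite -[RHS](P0 u) mevalE /q horner_sum; apply: eq_bigr => m _.
    rewrite hornerZ hornerXn -mulrA; congr (_ * _).
    rewrite big_ord_recr /= {2}/u insubF ?ltnn//; congr (_ * _).
    apply: eq_bigr => i _; rewrite /u insubT /= ?ltn_ord// => lt_ik.
    by congr (v _ ^+ _); apply/val_inj.
  have := congr1 (coefp j) q0; rewrite /= coef0 coefP /q coef_sum raddf_sum /=.
  move=> E; rewrite -[RHS]E [LHS]big_mkcond /=; apply: eq_bigr => m _.
  rewrite coefZ coefXn eq_sym; case: eqP => _; rewrite ?mulr0// mulr1 mevalZ mevalX.
  by congr (_ * _); apply: eq_bigr => i _; rewrite mnmE.
apply/mpolyP => m0; rewrite mcoeff0.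
have [m0P|] := boolP (m0 \in msupp P); last by rewrite -mcoeff_eq0 => /eqP.
have := congr1 (mcoeff (rs m0)) (P0coef (m0 ord_max)).
rewrite coefP mcoeff0 raddf_sum /= -big_filter (bigD1_seq m0) /=; last 2 first.
- by rewrite mem_filter eqxx.
- by rewrite filter_uniq ?msupp_uniq.
rewrite mcoeffZ mcoeffX eqxx mulr1 big_filter_cond big1 ?addr0// => m /andP[/eqP mm].
move=> mN; rewrite mcoeffZ mcoeffX; case: eqP => [rsm|]; rewrite ?mulr0//.
case/eqP: mN; apply/mnmP => i; have [lt_ik|] := ltnP i k.
  have /mnmP/(_ (Ordinal lt_ik)) := rsm; rewrite !mnmE.
  by rewrite (_ : wd _ = i)//; apply/val_inj.
move=> le_ki; suff -> : i = ord_max by [].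
by apply/val_inj/eqP; rewrite /= eqn_leq le_ki -ltnS ltn_ord.
Qed.

(** * The general linear group and Bruhat decomposition *)

Section ElementaryMatrix.
Variables (F : comNzRingType) (n : nat).
Implicit Types (x y : 'I_n) (M : 'M[F]_n).

Definition elemmx x y (s : F) : 'M[F]_n := 1%:M + s *: delta_mx x y.

Lemma elemmx_entry x y s a b :
  elemmx x y s a b = (a == b)%:R + s * ((a == x) && (b == y))%:R.
Proof. by rewrite !mxE. Qed.

Lemma elemmx_mull x y s M a b :
  (elemmx x y s *m M) a b = M a b + (if a == x then s * M y b else 0).
Proof.
rewrite mulmxDl mul1mx !mxE; congr (_ + _).
under eq_bigr do rewrite !mxE.
case: eqP => [_|_]; last by rewrite big1// => c _; rewrite mulr0 mul0r.
rewrite (bigD1 y)//= !eqxx mulr1 big1 ?addr0// => c /negbTE->.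
by rewrite mulr0 mul0r.
Qed.

Lemma elemmx_mulr x y s M a b :
  (M *m elemmx x y s) a b = M a b + (if b == y then M a x * s else 0).
Proof.
rewrite mulmxDr mulmx1 !mxE; congr (_ + _).
under eq_bigr do rewrite !mxE.
case: eqP => [_|_]; last by rewrite big1// => c _; rewrite andbF !mulr0.
rewrite (bigD1 x)//= !eqxx mulr1 big1 ?addr0// => c /negbTE->.
by rewrite !mulr0.
Qed.

Lemma elemmxM x y (s t : F) : x != y ->
  elemmx x y s *m elemmx x y t = elemmx x y (s + t).
Proof.
move=> xy; apply/matrixP => a b; rewrite elemmx_mull !elemmx_entry.
have [->|_] := eqVneq a x; rewrite /= ?mulr0 ?addr0// (eq_sym y x) (negbTE xy) /=.
rewrite mulr0 addr0 (eq_sym y b); ring.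
Qed.

Lemma elemmx0 x y : elemmx x y 0 = 1%:M.
Proof. by rewrite /elemmx scale0r addr0. Qed.

Lemma elemmx_perm (v : 'S_n) x y s a b :
  elemmx (v x) (v y) s (v a) (v b) = elemmx x y s a b.
Proof. by rewrite !elemmx_entry !(inj_eq perm_inj). Qed.

Lemma elemmxV x y (s : F) : x != y ->
  elemmx x y s *m elemmx x y (- s) = 1%:M.
Proof. by move=> xy; rewrite elemmxM// subrr elemmx0. Qed.

Lemma elemmx_comm x y z (s t : F) : x != y -> y != z -> x != z ->
  elemmx x z (s * t) *m (elemmx y z t *m elemmx x y s) =
  elemmx x y s *m elemmx y z t.
Proof.
move=> xy yz xz; apply/matrixP => a b; rewrite !(elemmx_mull, elemmx_entry).
rewrite eqxx (eq_sym z y) (negbTE yz) (eq_sym z x) (negbTE xz) (eq_sym z b).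
rewrite (eq_sym y b) /=; case: (eqVneq a x) => [->|_].
  by rewrite (negbTE xy) /=; ring.
by case: (a == y); rewrite /=; ring.
Qed.

End ElementaryMatrix.

(** The value 1 at a singular matrix is a filler; [mkGLE] is the computation rule at invertible
    ones. *)
HB.lock Definition mkGL (R : realType) (n : nat) (M : 'M[R[i]]_n) : GL R n :=
  insubd (1%g : GL R n) M.

Lemma mkGLE (R : realType) (n : nat) (M : 'M[R[i]]_n) :
  M \in unitmx -> GLmx (mkGL M) = M.
Proof. by move=> uM; rewrite mkGL.unlock -[LHS]/(val _) insubdK. Qed.

HB.lock Definition elemGL (R : realType) (n : nat) (x y : 'I_n) (s : R[i]) : GL R n :=
  mkGL (elemmx x y s).

HB.lock Definition diagGL (R : realType) (n : nat) (d : 'I_n -> R[i]) : GL R n :=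
  mkGL (diag_mx (\row_a d a)).

Section Matrices.
Variables (R : realType) (n : nat).
Local Notation C := R[i].
Local Notation GL := (GL R n).
Local Notation borel := (@borel R n).
Local Notation torus := (@torus R n).
Implicit Types (g h : GL) (x y z : 'I_n) (M : 'M[C]_n) (s t : C) (d : 'I_n -> C).

Lemma GLP g h : GLmx g = GLmx h -> g = h.
Proof. exact: val_inj. Qed.

Lemma GLmxM g h : GLmx (g * h)%g = GLmx g *m GLmx h. Proof. by []. Qed.
Lemma GLmx1 : GLmx (1%g : GL) = 1%:M. Proof. by []. Qed.
Lemma GLmxV g : GLmx g^-1%g = invmx (GLmx g). Proof. by []. Qed.
Lemma GLmx_mulV g : GLmx g *m GLmx g^-1%g = 1%:M.
Proof. by rewrite -GLmxM mulgV. Qed.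
Lemma GLmx_Vmul g : GLmx g^-1%g *m GLmx g = 1%:M.
Proof. by rewrite -GLmxM mulVg. Qed.

Lemma elemE x y s : x != y -> GLmx (elemGL x y s) = elemmx x y s.
Proof.
move=> xy; have [uM _] := mulmx1_unit (elemmxV s xy).
by rewrite elemGL.unlock mkGLE.
Qed.

Lemma diagE d : (forall a, d a != 0) -> GLmx (diagGL d) = diag_mx (\row_a d a).
Proof.
move=> d0; rewrite diagGL.unlock; apply: mkGLE; rewrite unitmxE det_diag unitfE.
by apply/prodf_neq0 => a _; rewrite mxE.
Qed.

Lemma elemM x y (s t : C) : x != y -> (elemGL x y s * elemGL x y t)%g = elemGL x y (s + t).
Proof. by move=> xy; apply: GLP; rewrite GLmxM !(elemE _ xy) elemmxM. Qed.

Lemma elem0 x y : x != y -> elemGL x y 0 = 1%g :> GL.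
Proof. by move=> xy; apply: GLP; rewrite elemE// elemmx0. Qed.

Lemma elemV x y (s : C) : x != y -> (elemGL x y s)^-1%g = elemGL x y (- s).
Proof.
move=> xy; apply: (mulgI (elemGL x y s)).
by rewrite mulgV; apply: GLP; rewrite GLmxM !(elemE _ xy) elemmxV.
Qed.

Lemma elem_comm x y z (s t : C) : x != y -> y != z -> x != z ->
  elemGL x z (s * t) = (elemGL x y s * elemGL y z t * (elemGL x y s)^-1 * (elemGL y z t)^-1)%g.
Proof.
move=> xy yz xz; apply/(mulIg (elemGL y z t))/(mulIg (elemGL x y s)).
rewrite !mulgKV; apply: GLP; rewrite !GLmxM -mulmxA.
rewrite (elemE _ xy) (elemE _ yz) (elemE _ xz).
exact: elemmx_comm.
Qed.

Lemma upper_triP g : reflect (forall a b : 'I_n, (b < a)%N -> GLmx g a b = 0) (upper_tri g).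
Proof.
apply: (iffP is_trig_mxP) => H a b lt_ab; first by have := H _ _ lt_ab; rewrite mxE.
by rewrite mxE; apply: H.
Qed.

Lemma borelP g : borel g <-> forall a b : 'I_n, (b < a)%N -> GLmx g a b = 0.
Proof. by split=> [/upper_triP|?]; last apply/upper_triP. Qed.

Lemma borel_subgroup_GL : subgroup borel.
Proof. by split; [exact: upper_tri1 | exact: upper_triM | exact: upper_triV]. Qed.

Lemma borel_diag_neq0 g a : borel g -> GLmx g a a != 0.
Proof.
move=> gB; have := GLmx_unit g; rewrite unitmxE -det_tr (det_trig gB) unitfE.
by move=> /prodf_neq0 /(_ a isT); rewrite mxE.
Qed.

Lemma elem_borel x y s : (x < y)%N -> borel (elemGL x y s).
Proof.
move=> lt_xy; apply/borelP => a b lt_ba; rewrite elemE; last first.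
  by apply: contraTneq lt_xy => ->; rewrite ltnn.
rewrite elemmx_entry -val_eqE gtn_eqF//= add0r; case: eqP => [ax|]; rewrite ?mulr0//=.
case: eqP => [yb|]; rewrite ?mulr0//; move: lt_ba.
by rewrite ax yb ltnNge (ltnW lt_xy).
Qed.

Lemma torusP g : torus g <-> forall a b, a != b -> GLmx g a b = 0.
Proof. by split=> [/is_diag_mxP|?]; last apply/is_diag_mxP. Qed.

Lemma torus_borel : (torus `<=` borel)%classic.
Proof.
move=> t /torusP tT; apply/borelP => a b lt_ba; apply: tT.
by rewrite -val_eqE gtn_eqF.
Qed.

Lemma diag_entry d a b : (forall a, d a != 0) ->
  GLmx (diagGL d) a b = d a *+ (a == b).
Proof. by move=> d0; rewrite diagE// !mxE; case: eqP => //= ->. Qed.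

Lemma diag_mull d M a b : (forall a, d a != 0) ->
  (GLmx (diagGL d) *m M) a b = d a * M a b.
Proof. by move=> d0; rewrite diagE// mul_diag_mx !mxE. Qed.

Lemma diag_mulr d M a b : (forall a, d a != 0) ->
  (M *m GLmx (diagGL d)) a b = M a b * d b.
Proof. by move=> d0; rewrite diagE// mul_mx_diag !mxE. Qed.

Lemma diag_torus d : (forall a, d a != 0) -> torus (diagGL d).
Proof. by move=> d0; apply/torusP => a b /negbTE ab; rewrite diag_entry// ab. Qed.

Lemma diagV d : (forall a, d a != 0) -> (diagGL d)^-1%g = diagGL (fun a => (d a)^-1).
Proof.
move=> d0; have d0' a : (d a)^-1 != 0 by rewrite invr_eq0.
apply: (mulgI (diagGL d)); rewrite mulgV; apply: GLP; rewrite GLmxM.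
apply/matrixP => a b; rewrite diag_mull// diag_entry// mxE mulrnAr mulfV//.
Qed.

Lemma torus_diag g : torus g -> exists2 d, (forall a, d a != 0) & g = diagGL d.
Proof.
move=> tT; exists (fun a => GLmx g a a) => [a|]; first exact/borel_diag_neq0/torus_borel.
apply: GLP; rewrite diagE => [|a]; last exact/borel_diag_neq0/torus_borel.
apply/matrixP => a b; rewrite !mxE; case: (eqVneq a b) => [->//|ab] /=.
by move/torusP: tT => ->.
Qed.

Lemma permGLE (w : 'S_n) a b : GLmx (permGL R w) a b = (a == w b)%:R.
Proof. by rewrite mxE. Qed.

Lemma perm_mull (w : 'S_n) M a b : (GLmx (permGL R w) *m M) a b = M (w^-1%g a) b.
Proof.
rewrite mxE (bigD1 (w^-1%g a))//= permGLE permKV eqxx mul1r big1 ?addr0// => c ca.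
rewrite permGLE (_ : (a == w c) = false) ?mul0r//; apply: contraNF ca => /eqP->.
by rewrite permK.
Qed.

Lemma perm_mulr (w : 'S_n) M a b : (M *m GLmx (permGL R w)) a b = M a (w b).
Proof.
rewrite mxE (bigD1 (w b))//= permGLE eqxx mulr1 big1 ?addr0// => c /negbTE ca.
by rewrite permGLE ca mulr0.
Qed.

Lemma permGLV (w : 'S_n) : (permGL R w)^-1%g = permGL R w^-1%g.
Proof.
apply: (mulgI (permGL R w)); rewrite mulgV; apply: GLP; rewrite GLmxM.
apply/matrixP => a b; rewrite perm_mull permGLE mxE.
by rewrite (inj_eq perm_inj).
Qed.

End Matrices.

(** The lower unitriangular N for which v N v^-1 is upper triangular ([cell_upper]). The products v
    N represent the points of the Schubert cell of v, with the entries at inversions as free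
    coordinates; rows and columns are indexed by positions. *)
Definition cellmx (F : nzRingType) n (v : 'S_n) (N : 'M[F]_n) : Prop :=
  forall j i : 'I_n, ~~ ((i < j) && (v j < v i))%N -> N j i = (j == i)%:R.

(** * Bruhat decomposition by column elimination *)

Section Bruhat.
Variables (R : realType) (n : nat).
Local Notation C := R[i].
Local Notation GL := (GL R n).
Local Notation borel := (@borel R n).
Implicit Types (g h b : GL) (x y z : 'I_n) (f : 'I_n -> 'I_n).

Lemma GL_col_neq0 g x : exists a, GLmx g a x != 0.
Proof.
apply/not_existsP => g0; have := congr1 (fun M : 'M_n => M x x) (GLmx_Vmul g).
rewrite mxE big1 => [|a _]; first by rewrite mxE eqxx => /esym/eqP; rewrite oner_eq0.
by have /negP/negPn/eqP -> := g0 a; rewrite mulr0.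
Qed.

(** Column i has a pivot 1 in row [f i], nothing below it, and zeros in the pivot rows of all
    earlier columns. The column operations used, adding a column to a later one and scaling, are
    right multiplications by B. *)
Let pivoted (M : 'M[C]_n) f (m : nat) := forall i : 'I_n, (i < m)%N ->
  [/\ M (f i) i = 1, forall a : 'I_n, (f i < a)%N -> M a i = 0
    & forall i' : 'I_n, (i' < i)%N -> M (f i') i = 0].

Let clear_column g b f (x : 'I_n) : borel b -> pivoted (GLmx (g * b)%g) f x ->
  forall l, (l <= x)%N -> exists b', [/\ borel b', pivoted (GLmx (g * b')%g) f x &
    forall i : 'I_n, (i < l)%N -> GLmx (g * b')%g (f i) x = 0].
Proof.
move=> bB bP; elim=> [|l IH] lx; first by exists b; split.
have [b1 [b1B b1P b1l]] := IH (ltnW lx).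
pose y := Ordinal (ltn_trans lx (ltn_ord x)).
have yx : y != x by rewrite -val_eqE /= ltn_eqF.
pose c := GLmx (g * b1)%g (f y) x.
exists (b1 * elemGL y x (- c))%g.
have ME a i : GLmx (g * (b1 * elemGL y x (- c)))%g a i = GLmx (g * b1)%g a i +
    (if i == x then GLmx (g * b1)%g a y * - c else 0).
  by rewrite mulgA [in LHS]GLmxM (elemE _ yx) elemmx_mulr.
split.
- by apply: upper_triM => //; apply: elem_borel.
- move=> i ix; have iNx : (i == x) = false by rewrite -val_eqE ltn_eqF.
  have [M1 M2 M3] := b1P i ix; split => [|a|i'].
  + by rewrite ME iNx addr0.
  + by move=> /M2 M2a; rewrite ME iNx addr0.
  + by move=> /M3 M3a; rewrite ME iNx addr0.
- move=> i; rewrite ltnS leq_eqVlt ME eqxx => /orP[/eqP il|il].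
    have -> : i = y by apply/val_inj.
    by have [-> _ _] := b1P y lx; rewrite mul1r subrr.
  by have [_ _ ->] := b1P y lx; rewrite ?mul0r ?addr0 ?b1l.
Qed.

Let pivot_all g m : (m <= n)%N ->
  exists b f, borel b /\ pivoted (GLmx (g * b)%g) f m.
Proof.
elim: m => [|m IH] mn; first by exists 1%g, id; split => //; exact: upper_tri1.
have [b0 [f [b0B b0P]]] := IH (ltnW mn); pose x := Ordinal mn.
have [b [bB bP bx]] := clear_column (x := x) b0B b0P (leqnn m).
set M := GLmx (g * b)%g in bP bx.
have [a0 Ma0] := GL_col_neq0 (g * b)%g x.
(* The pivot is the last nonzero entry of the cleared column; scaling by [d] makes it 1. *)
have [p Mp pmax] := @arg_maxnP _ a0 (fun a => M a x != 0) val Ma0.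
pose d i : C := if i == x then (M p x)^-1 else 1.
have d0 i : d i != 0 by rewrite /d; case: ifP; rewrite ?oner_eq0 ?invr_eq0.
exists (b * diagGL d)%g, (fun i => if i == x then p else f i); split.
  by apply: upper_triM => //; apply/torus_borel/diag_torus.
have ME a i : GLmx (g * (b * diagGL d))%g a i = M a i * d i.
  by rewrite mulgA [in LHS]GLmxM diag_mulr.
have fN (i i' : 'I_n) : (i <= x)%N -> (i' < i)%N -> (if i' == x then p else f i') = f i'.
  move=> ix i'i; rewrite ifF//; apply/negbTE.
  by rewrite -val_eqE ltn_eqF// (leq_trans i'i).
move=> i; rewrite ltnS leq_eqVlt => /orP[/eqP il|il].
  have -> : i = x by apply/val_inj.
  rewrite eqxx; split => [|a pa|i' i'x].
  - by rewrite ME /d eqxx mulfV.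
  - rewrite ME; suff -> : M a x = 0 by rewrite mul0r.
    apply/eqP/negPn/negP => Ma; have ap : (a <= p)%N := pmax _ Ma.
    by rewrite ltnNge ap in pa.
  - by rewrite (fN x)// ME bx// mul0r.
have iN : i != x by rewrite -val_eqE ltn_eqF.
have [M1 M2 M3] := bP i il; rewrite (negbTE iN); split => [|a|i' i'i].
- by rewrite ME M1 /d (negbTE iN) mulr1.
- by move=> /M2 M2a; rewrite ME M2a mul0r.
- by rewrite (fN i) ?(ltnW il)// ME M3// mul0r.
Qed.

(** [v] sends a column to its pivot row; it is injective since an earlier pivot row vanishes in
    every later column. Being pivoted then says exactly that v^-1 g b is a cell matrix. *)
Lemma bruhat g : exists v b N,
  [/\ borel b, cellmx v (GLmx N) & (g * b = permGL R v * N)%g].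
Proof.
have [b [f [bB bP]]] := pivot_all g (leqnn n).
have f_inj : injective f.
  move=> i i' ff; apply/val_inj; case: (ltngtP i i') => // lt_ii.
    have [M1 _ /(_ _ lt_ii)] := bP i' (ltn_ord i').
    by rewrite ff M1 => /eqP; rewrite oner_eq0.
  have [M1 _ /(_ _ lt_ii)] := bP i (ltn_ord i).
  by rewrite -ff M1 => /eqP; rewrite oner_eq0.
exists (perm f_inj), b, ((permGL R (perm f_inj))^-1 * (g * b))%g; split => //.
  move=> j i; rewrite permGLV GLmxM perm_mull invgK !permE.
  have [M1 M2 M3] := bP i (ltn_ord i).
  case: (ltngtP j i) => [ji _|ij /=|/val_inj -> _]; last by rewrite eqxx M1.
    by rewrite M3// -val_eqE ltn_eqF.
  rewrite -leqNgt leq_eqVlt => /orP[/eqP/val_inj/f_inj jj|/M2 ->].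
    by move: ij; rewrite jj ltnn.
  by rewrite -val_eqE gtn_eqF.
by rewrite mulgA mulgV mul1g.
Qed.

Lemma cell_upper (v : 'S_n) N : cellmx v (GLmx N) ->
  borel (permGL R v * N * (permGL R v)^-1)%g.
Proof.
move=> Nv; apply/borelP => a b ba; rewrite permGLV 2!GLmxM perm_mulr perm_mull.
rewrite Nv; last by rewrite !permKV negb_and -!leqNgt (ltnW ba) orbT.
by rewrite (inj_eq perm_inj) -val_eqE gtn_eqF.
Qed.

End Bruhat.

(** * Levi and Borel subgroups of groups containing B *)

Section Parabolic.
Variables (R : realType) (n : nat).
Local Notation C := R[i].
Local Notation GL := (GL R n).
Local Notation borel := (@borel R n).
Local Notation torus := (@torus R n).
Implicit Types (g h b : GL) (x y z i j : 'I_n) (M : 'M[C]_n).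

Lemma elem_conj_perm (v : 'S_n) x y (s : C) : x != y ->
  ((permGL R v)^-1 * elemGL (v x) (v y) s * permGL R v)%g = elemGL x y s.
Proof.
move=> xy; have vxy : v x != v y by rewrite (inj_eq perm_inj).
apply: GLP; apply/matrixP => a b; rewrite permGLV 2!GLmxM perm_mulr perm_mull invgK.
rewrite (elemE _ vxy) (elemE _ xy); exact: elemmx_perm.
Qed.

(** Otherwise [v] would map the positions from i on into themselves, hence onto themselves, and
    could not send c < i among them. *)
Lemma perm_le_lt (v : 'S_n) (i c : 'I_n) : (c < i)%N -> (i <= v c)%N ->
  exists2 x : 'I_n, (i <= x)%N & (v x < v c)%N.
Proof.
move=> ci ivc; apply: contrapT => /forall2NP H.
pose A := [set x : 'I_n | (i <= x)%N].
have vA : v @: A \subset A.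
  apply/fintype.subsetP => _ /imsetP[x xA ->]; rewrite !inE in xA *.
  by have [//|/negP] := H x; rewrite -leqNgt; apply: leq_trans.
have /eqP vAE : v @: A == A by rewrite eqEcard vA card_imset ?leqnn//; apply: perm_inj.
have : v c \in A by rewrite inE.
rewrite -vAE mem_imset; last exact: perm_inj.
by rewrite inE leqNgt ci.
Qed.

(** * The preorder of root subgroups and the block projection *)

Section Preorder.
Variable Q : set GL.
Hypotheses (Qgrp : subgroup Q) (BQ : (borel `<=` Q)%classic).

Let Q1 : Q 1%g. Proof. by case: Qgrp. Qed.
Let QM g h : Q g -> Q h -> Q (g * h)%g. Proof. by case: Qgrp => _ + _; apply. Qed.
Let QV g : Q g -> Q g^-1%g. Proof. by case: Qgrp => _ _; apply. Qed.

(** The case x = y makes this a preorder. It extends the usual order when Q contains B, and its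
    symmetric part is the division of the indices into Levi blocks. *)
Definition rootle x y : Prop := x = y \/ forall s, Q (elemGL x y s).

Lemma rootle_leq x y : (x <= y)%N -> rootle x y.
Proof.
rewrite leq_eqVlt => /orP[/eqP/val_inj|xy]; first by left.
by right => s; apply/BQ/elem_borel.
Qed.

Lemma rootle_trans y x z : rootle x y -> rootle y z -> rootle x z.
Proof.
move=> [->//|xy] [<-|yz]; first by right.
have [->|xz] := eqVneq x z; first by left.
have [xyE|xNy] := eqVneq x y; first by right; rewrite xyE.
have [yzE|yNz] := eqVneq y z; first by right; rewrite -yzE.
right => s; rewrite -[s]mulr1 (elem_comm _ _ xNy yNz xz).
by apply: QM; [apply: QM; [apply: QM|apply: QV]|apply: QV].
Qed.

(* In the Bruhat form g b = v N, a nonzero entry of g below the diagonal makes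
   v carry some root subgroup of the Borel to the lower triangular part. *)
Lemma rootle_entry g i j : Q g -> GLmx g i j != 0 -> rootle i j.
Proof.
move=> Qg gij; have [ij|ji] := leqP i j; first exact: rootle_leq.
have [v [b [N [bB Nv gE]]]] := bruhat g.
have Qv : Q (permGL R v).
  have -> : permGL R v = ((permGL R v * N * (permGL R v)^-1)^-1 * (g * b))%g.
    by rewrite gE invMg invgK mulgKV.
  by apply: QM; [apply: QV; apply/BQ/cell_upper | apply: QM => //; apply: BQ].
(* Expand g = (g b) b^-1 at (i, j): some column c <= j of g b is nonzero in row i, so its last
   nonzero row [v c] is at least i. *)
have [c cj ivc] : exists2 c : 'I_n, (c <= j)%N & (i <= v c)%N.
  move: gij; rewrite -[g](mulgK b) GLmxM mxE => gij.
  have [c] : exists c, GLmx (g * b)%g i c * GLmx (b^-1)%g c j != 0.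
    apply/not_existsP => H; move: gij; rewrite big1 ?eqxx// => c _.
    exact/eqP/negPn/negP/(H c).
  rewrite mulf_eq0 negb_or => /andP[Mic bcj]; exists c.
    rewrite leqNgt; apply: contraNN bcj => jc; apply/eqP.
    by have /borelP -> := upper_triV bB.
  move: Mic; rewrite gE GLmxM perm_mull => Nic.
  have [/andP[_]|/Nv NE] := boolP ((c < v^-1%g i) && (v (v^-1%g i) < v c))%N.
    by rewrite permKV => /ltnW.
  move: Nic; rewrite NE; case: (v^-1%g i =P c) => [<- _|]; last by rewrite eqxx.
  by rewrite permKV.
have ci : (c < i)%N by apply: leq_ltn_trans cj ji.
(* As [v x < v c], the root subgroup (v x, v c) lies in B and conjugation by v turns it into (x, c).
   The chain i, x, c, j then gives the claim. *)
have [x ix xc] := perm_le_lt ci ivc.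
apply: rootle_trans (rootle_leq ix) _.
apply: rootle_trans (rootle_leq cj).
have xNc : x != c by rewrite -val_eqE gtn_eqF// (leq_trans ci).
right => s; rewrite -(elem_conj_perm v _ xNc).
by apply: QM => //; apply: QM; [apply: QV | apply/BQ/elem_borel].
Qed.

(** A nonzero entry (x, y) of an element of Q already has [rootle x y]; asking for [rootle y x] as
    well keeps just the diagonal blocks. *)
Definition levimx M : 'M[C]_n := \matrix_(x, y) if `[< rootle y x >] then M x y else 0.

Lemma levimxE M x y : rootle y x -> levimx M x y = M x y.
Proof. by move=> yx; rewrite mxE; case: asboolP. Qed.

Lemma levimx0 M x y : ~ rootle y x -> levimx M x y = 0.
Proof. by move=> yx; rewrite mxE; case: asboolP. Qed.

Lemma levimx1 : levimx 1%:M = 1%:M.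
Proof.
apply/matrixP => x y; have [yx|yx] := pselect (rootle y x); first by rewrite levimxE.
by rewrite levimx0// mxE; case: eqP => // xy; case: yx; rewrite xy; left.
Qed.

Lemma levimx_mull g h x y : Q g -> Q h -> rootle y x ->
  (levimx (GLmx g) *m GLmx h) x y = (GLmx g *m GLmx h) x y.
Proof.
move=> Qg Qh yx; rewrite !mxE; apply: eq_bigr => z _.
have [zx|zx] := pselect (rootle z x); first by rewrite levimxE.
rewrite levimx0// mul0r; have [->|/(rootle_entry Qh) zy] := eqVneq (GLmx h z y) 0.
  by rewrite mulr0.
by case: zx; apply: rootle_trans zy yx.
Qed.

(** Elements of Q are block triangular for the preorder: if y precedes x, a nonzero term of the
    product at (x, y) runs x, z, y in the preorder, so x, y and z share a block. *)
Lemma levimxM g h : Q g -> Q h ->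
  levimx (GLmx (g * h)%g) = levimx (GLmx g) *m levimx (GLmx h).
Proof.
move=> Qg Qh; apply/matrixP => x y; have [yx|yx] := pselect (rootle y x).
  rewrite levimxE// GLmxM -(levimx_mull Qg Qh yx) mxE [RHS]mxE.
  apply: eq_bigr => z _; have [yz|yz] := pselect (rootle y z); first by rewrite (levimxE _ yz).
  rewrite (levimx0 _ yz) mulr0; have [zx|zx] := pselect (rootle z x); last first.
    by rewrite levimx0// mul0r.
  rewrite levimxE//; have [->|/(rootle_entry Qg) xz] := eqVneq (GLmx g x z) 0.
    by rewrite mul0r.
  by case: yz; apply: rootle_trans yx xz.
rewrite levimx0// mxE big1// => z _; have [zx|zx] := pselect (rootle z x).
  have [yz|yz] := pselect (rootle y z); last by rewrite (levimx0 _ yz) mulr0.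
  by case: yx; apply: rootle_trans yz zx.
by rewrite levimx0// mul0r.
Qed.

(** With the two definitions that follow: block diagonal elements, elements with identity blocks,
    and upper triangular block diagonal ones. They turn out to be a Levi factor, the unipotent
    radical and a Borel subgroup of the Levi factor when Q is closed. *)
Definition levi : set GL := [set g | Q g /\ levimx (GLmx g) = GLmx g]%classic.
Definition radical : set GL := [set g | Q g /\ levimx (GLmx g) = 1%:M]%classic.
Definition leviborel : set GL := [set g | borel g /\ levimx (GLmx g) = GLmx g]%classic.

Lemma levimxV_eq g : Q g -> levimx (GLmx g) = GLmx g ->
  levimx (GLmx g^-1%g) = GLmx g^-1%g.
Proof.
move=> Qg Dg; have := levimxM Qg (QV Qg).
rewrite mulgV GLmx1 levimx1 Dg => /(congr1 (mulmx (GLmx g^-1%g))).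
by rewrite mulmx1 mulmxA GLmx_Vmul mul1mx.
Qed.

Lemma levi_subgroup_GL : subgroup levi.
Proof.
split=> [|g h [Qg Dg] [Qh Dh]|g [Qg Dg]]; first by split; rewrite ?levimx1.
  by split; [exact: QM | rewrite levimxM// Dg Dh].
by split; [exact: QV | exact: levimxV_eq].
Qed.

Lemma leviborel_subgroup_GL : subgroup leviborel.
Proof.
have [B1 BM BV] := borel_subgroup_GL R n.
split=> [|g h [Qg Dg] [Qh Dh]|g [Qg Dg]]; first by split; rewrite ?levimx1.
  by split; [exact: BM | rewrite levimxM ?Dg ?Dh//; apply: BQ].
by split; [exact: BV | apply: levimxV_eq => //; apply: BQ].
Qed.

Lemma radical_subgroup_GL : subgroup radical.
Proof.
split=> [|g h [Qg Dg] [Qh Dh]|g [Qg Dg]]; first by split; rewrite ?levimx1.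
  by split; [exact: QM | rewrite levimxM// Dg Dh mulmx1].
split; first exact: QV.
by have := levimxM (QV Qg) Qg; rewrite mulVg GLmx1 levimx1 Dg mulmx1.
Qed.

Lemma radical_normal : normal_in radical Q.
Proof.
split=> [g []//|g h Qg [Qh Dh]]; split; first by apply: QM; [exact: QM|exact: QV].
rewrite levimxM ?levimxM//; [|exact: QM|exact: QV].
by rewrite Dh mulmx1 -levimxM ?mulgV ?levimx1//; apply: QV.
Qed.

Lemma levi_radical1 : (levi `&` radical = [set 1%g])%classic.
Proof.
apply/seteqP; split=> [g [[_ Dg] [_ Dg1]]|_ ->]; first by apply: GLP; rewrite -Dg.
by split; split; rewrite ?levimx1.
Qed.

Lemma radical_entry g x y : radical g -> rootle y x -> GLmx g x y = (x == y)%:R.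
Proof. by move=> [_ Dg] yx; rewrite -(levimxE _ yx) Dg mxE. Qed.

Lemma radical_borel : (radical `<=` borel)%classic.
Proof.
move=> g gU; apply/borelP => x y yx.
rewrite (radical_entry gU (rootle_leq (ltnW yx))).
by rewrite -val_eqE gtn_eqF.
Qed.

Lemma borel_levimx1_radical g : borel g -> levimx (GLmx g) = 1%:M -> radical g.
Proof. by move=> /BQ. Qed.

(** [l] is the block part of g, invertible with the block part of g^-1 as inverse. That [l] lies in
    Q is deduced from [u]: below the diagonal and inside the blocks l^-1 g agrees with g^-1 g = 1,
    so it is in B. *)
Lemma levi_factor g : Q g -> exists l u, [/\ levi l, radical u,
  (g = l * u)%g & GLmx l = levimx (GLmx g)].
Proof.
move=> Qg; have QVg := QV Qg.
have DD : levimx (GLmx g) *m levimx (GLmx g^-1%g) = 1%:M.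
  by rewrite -levimxM// mulgV levimx1.
have [uD uD'] := mulmx1_unit DD.
pose l := mkGL (levimx (GLmx g)); have lE : GLmx l = levimx (GLmx g) by rewrite mkGLE.
have lVE : GLmx l^-1%g = levimx (GLmx g^-1%g).
  by rewrite GLmxV lE -[LHS]mulmx1 -DD mulKmx.
have uB : borel (l^-1 * g)%g.
  apply/borelP => x y yx; rewrite GLmxM lVE levimx_mull//; last exact/rootle_leq/ltnW.
  by rewrite -GLmxM mulVg GLmx1 mxE -val_eqE gtn_eqF.
have uD1 x y : rootle y x -> GLmx (l^-1 * g)%g x y = (x == y)%:R.
  by move=> yx; rewrite GLmxM lVE levimx_mull// -GLmxM mulVg GLmx1 mxE.
have uU : radical (l^-1 * g)%g.
  apply: borel_levimx1_radical => //; rewrite -levimx1; apply/matrixP => x y.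
  have [yx|yx] := pselect (rootle y x); last by rewrite !levimx0.
  by rewrite !levimxE// uD1// mxE.
have Ql : Q l.
  have -> : l = (g * (l^-1 * g)^-1)%g by rewrite invMg invgK mulKVg.
  by apply: QM => //; apply: QV; case: uU.
exists l, (l^-1 * g)%g; split => //; last by rewrite mulKVg.
split=> //; rewrite lE; apply/matrixP => x y.
by have [yx|yx] := pselect (rootle y x); rewrite ?(levimxE _ yx) ?(levimx0 _ yx).
Qed.

Lemma levi_radicalE : (Q = [set (l * u)%g | l in levi & u in radical])%classic.
Proof.
apply/seteqP; split=> [g Qg|_ [l [Ql _] [u [Qu _] <-]]]; last exact: QM.
by have [l [u [lL uU -> _]]] := levi_factor Qg; exists l => //; exists u.
Qed.

Lemma torus_leviborel : (torus `<=` leviborel)%classic.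
Proof.
move=> t tT; split; first exact: torus_borel.
apply/matrixP => x y; have [yx|yx] := pselect (rootle y x); first by rewrite levimxE.
rewrite levimx0//; have /torusP -> // := tT.
by apply: contra_notN yx => /eqP->; left.
Qed.

Lemma leviborel_levi : (leviborel `<=` levi)%classic.
Proof. by move=> g [/BQ]. Qed.

Lemma elem_levimx x y s : x != y -> rootle y x ->
  levimx (GLmx (elemGL x y s)) = GLmx (elemGL x y s).
Proof.
move=> xNy yx; apply/matrixP => a b; have [ba|ba] := pselect (rootle b a).
  by rewrite levimxE.
rewrite levimx0// (elemE _ xNy) elemmx_entry; case: eqP => [ab|_].
  by case: ba; rewrite ab; left.
case: eqP => [ax|_]; last by rewrite mulr0 addr0.
case: eqP => [by_|_]; last by rewrite mulr0 addr0.
by case: ba; rewrite ax by_.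
Qed.

End Preorder.
End Parabolic.

Section TriangularMatrices.
Variables (F : comNzRingType) (n : nat).
Implicit Types (M : 'M[F]_n) (a b : 'I_n).

Lemma strict_upper_nilp M : (forall a b, (b <= a)%N -> M a b = 0) -> M ^+ n = 0.
Proof.
move=> M0; have MX k a b : (b < a + k)%N -> (M ^+ k) a b = 0.
  elim: k a b => [|k IH] a b ba.
    by rewrite addn0 in ba; rewrite expr0 mxE -val_eqE gtn_eqF.
  rewrite exprS mxE big1// => c _; have [ca|ac] := leqP c a; first by rewrite M0 ?mul0r.
  by rewrite IH ?mulr0// (leq_trans ba)// addnS -addSn leq_add2r.
by apply/matrixP => a b; rewrite MX ?mxE// (leq_trans (ltn_ord b)) ?leq_addl.
Qed.

Lemma upper_exp_diag M k a : (forall a b, (b < a)%N -> M a b = 0) ->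
  (M ^+ k) a a = M a a ^+ k.
Proof.
move=> M0; suff H : (forall b, (b < a)%N -> (M ^+ k) a b = 0) /\ (M ^+ k) a a = M a a ^+ k.
  by case: H.
elim: k => [|k [IH0 IH]].
  by rewrite !expr0; split => [b ba|]; rewrite mxE ?eqxx// -val_eqE gtn_eqF.
rewrite !exprSr; split => [b ba|].
  rewrite mxE big1// => c _; have [ca|ac] := ltnP c a; first by rewrite IH0 ?mul0r.
  by rewrite M0 ?mulr0// (leq_trans ba).
rewrite mxE (bigD1 a)//= IH big1 ?addr0// => c ca.
have [{}ca|ac] := ltnP c a; first by rewrite IH0 ?mul0r.
by rewrite M0 ?mulr0// ltn_neqAle ac eq_sym andbT.
Qed.

End TriangularMatrices.

(** All eigenvalues are 0, so the characteristic polynomial is a power of X, and the trace is minus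
    its subleading coefficient. *)
Lemma nilpotent_trace (F : closedFieldType) n (M : 'M[F]_n) k :
  M ^+ k = 0 -> \tr M = 0.
Proof.
case: n M => [|n] M Mk; first by rewrite /mxtrace big_ord0.
have [rs rsE] := closed_field_poly_normal (char_poly M).
have /eqP lc1 := char_poly_monic M.
rewrite lc1 scale1r in rsE.
have rs0 a : a \in rs -> a = 0.
  move=> ars; have : root (char_poly M) a by rewrite rsE root_prod_XsubC.
  rewrite -eigenvalue_root_char => /eigenvalueP[v vM v0].
  have vX j : v *m M ^+ j = a ^+ j *: v.
    elim: j => [|j IH]; first by rewrite !expr0 mulmx1 scale1r.
    by rewrite exprSr -mulmxE mulmxA IH -scalemxAl vM scalerA -exprSr.
  have /eqP := vX k; rewrite Mk mulmx0 eq_sym scaler_eq0 (negbTE v0) orbF.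
  by rewrite expf_eq0 => /andP[_ /eqP].
have := char_poly_trace M isT.
rewrite (_ : char_poly M = 'X^(size rs)); last first.
  rewrite rsE (eq_big_seq (fun=> 'X)) => [|a /rs0 ->]; last by rewrite subr0.
  by rewrite big_const_seq count_predT iter_mulr_1.
have := size_char_poly M; rewrite rsE size_prod_XsubC => -[->].
by rewrite coefXn /= (ltn_eqF (ltnSn n)) => /eqP; rewrite eq_sym oppr_eq0 => /eqP.
Qed.

Lemma elemmx_diag_conj (F : fieldType) n (x y : 'I_n) (d : 'I_n -> F) s :
  d y != 0 -> diag_mx (\row_a d a) *m elemmx x y s =
  elemmx x y (d x / d y * s) *m diag_mx (\row_a d a).
Proof.
move=> dy; apply/matrixP => a b; rewrite mul_diag_mx mul_mx_diag [LHS]mxE [RHS]mxE.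
rewrite !elemmx_entry !mxE.
have [/andP[/eqP-> /eqP->]|_] := boolP ((a == x) && (b == y)).
  by have [->|_] := eqVneq x y; rewrite /= ?mulr0n; field.
by have [->|_] := eqVneq a b; rewrite /= ?mulr0n !mulr0 !addr0 ?mulr0 ?mul0r// mulrC.
Qed.

(* The torus of SL_2 is generated by the two root subgroups. *)
Lemma sl2_diag (F : fieldType) n (x y : 'I_n) (c : F) : x != y -> c != 0 ->
  elemmx x y c *m (elemmx y x (- c^-1) *m (elemmx x y (c - 1) *m
    (elemmx y x 1 *m elemmx x y (- 1)))) =
  diag_mx (\row_a (if a == x then c else if a == y then c^-1 else 1)).
Proof.
move=> xy c0; apply/matrixP => a b; rewrite !(elemmx_mull, elemmx_entry) !mxE.
rewrite !eqxx (eq_sym y x) (negbTE xy) /= (eq_sym x b) (eq_sym y b).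
have [->|ax] := eqVneq a x.
  rewrite (negbTE xy) (eq_sym x b) /=; case: (b == x); case: (b == y);
  rewrite /= ?mulr0n ?mulr1n; by field.
rewrite /=; have [->|ay] := eqVneq a y; last by rewrite mulr0 !addr0.
rewrite (eq_sym y b); case: (b == x); case: (b == y);
by rewrite /= ?mulr0n ?mulr1n; field.
Qed.

(** * Polynomial functions and the Zariski topology on GL *)

Section MatrixPolynomials.
Variables (F : comNzRingType) (n : nat).

Definition mev (p : {mpoly F[n * n]}) (M : 'M[F]_n) : F :=
  p.@[fun k => mxvec M 0 k].

Definition entrypoly (a b : 'I_n) : {mpoly F[n * n]} := 'X_(mxvec_index a b).

Lemma mev_entry a b M : mev (entrypoly a b) M = M a b.
Proof. by rewrite /mev mevalXU mxvecE. Qed.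

Lemma subalg_mev T (K : (T -> F) -> Prop) p (M : T -> 'M[F]_n) : subalg K ->
  (forall a b, K (fun x => M x a b)) -> K (fun x => mev p (M x)).
Proof.
move=> KA KM; apply: (subalg_meval KA) => k; case/mxvec_indexP: k => a b.
by apply: (subalg_ext _ (KM a b)) => x; rewrite mxvecE.
Qed.

End MatrixPolynomials.

Lemma polyfn_line (F : numFieldType) n (A B : 'M[F]_n) a b :
  polyfn (fun s => (A + s *: B) a b).
Proof.
have PA := polyfn_subalg F.
apply: (@subalg_ext _ _ _ _ (fun s => A a b + s * B a b)) => [s|].
  by rewrite !mxE.
by apply: (subalgD PA); [exact: subalgC | apply: (subalgM PA); [exact: polyfn_id|exact: subalgC]].
Qed.

Section ZariskiGL.
Variables (R : realType) (n : nat).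
Local Notation C := R[i].
Local Notation GL := (GL R n).
Local Notation borel := (@borel R n).
Local Notation torus := (@torus R n).
Implicit Types (g h : GL) (x y z : 'I_n) (M : 'M[C]_n).

Lemma pevalE p g : peval p g = mev p (GLmx g). Proof. by []. Qed.

Definition pfun (f : GL -> C) : Prop := exists p, f =1 peval p.

Lemma pfun_subalg : subalg pfun.
Proof.
split=> [c|f g [p fp] [q gq]|f g [p fp] [q gq]].
- by exists c%:MP => s; rewrite /peval mevalC.
- by exists (p + q) => s; rewrite fp gq /peval mevalD.
- by exists (p * q) => s; rewrite fp gq /peval mevalM.
Qed.

Lemma pfun_entry a b : pfun (fun g => GLmx g a b).
Proof. by exists (entrypoly _ a b) => g; rewrite pevalE mev_entry. Qed.

Lemma pfun_mev p (M : GL -> 'M[C]_n) :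
  (forall a b, pfun (fun g => M g a b)) -> pfun (fun g => mev p (M g)).
Proof. exact: subalg_mev pfun_subalg. Qed.

Lemma pfun_mull p h : pfun (fun g => peval p (h * g)%g).
Proof.
apply: pfun_mev => a b; apply: (subalg_mulmx pfun_subalg) => c d.
  exact: subalgC pfun_subalg _.
exact: pfun_entry.
Qed.

Lemma pfun_mulr p h : pfun (fun g => peval p (g * h)%g).
Proof.
apply: pfun_mev => a b; apply: (subalg_mulmx pfun_subalg) => c d.
  exact: pfun_entry.
exact: subalgC pfun_subalg _.
Qed.

Lemma open_GLE (U : set GL) : open U = zariski_open U. Proof. by []. Qed.

Lemma closed_GLP (A : set GL) : closed A <-> exists S, A = zero_locus S.
Proof.
rewrite -openC open_GLE; split=> -[S AE]; exists S.
  by rewrite -[A]setCK AE setCK.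
by rewrite AE.
Qed.

Lemma closed_pfun I (f : I -> GL -> C) : (forall i, pfun (f i)) ->
  closed [set g | forall i, f i g = 0]%classic.
Proof.
move=> /choice[p fp]; apply/closed_GLP; exists (range p).
apply/seteqP; split=> [g fg _ [i _ <-]|g fg i]; first by rewrite -fp.
by rewrite fp; apply: fg; exists i.
Qed.

Lemma open_GL_nonzero (U : set GL) g : open U -> U g ->
  exists2 p, peval p g != 0 & forall h, peval p h != 0 -> U h.
Proof.
rewrite open_GLE => -[S ->] /existsNP[p /not_implyP[Sp /eqP pg]].
by exists p => // h /eqP ph /(_ _ Sp).
Qed.

Lemma open_nonzero (p : {mpoly C[n * n]}) : open [set g : GL | peval p g != 0]%classic.
Proof.
rewrite open_GLE; exists [set p]%classic; apply/seteqP; split=> [g /eqP pg /(_ p erefl)//|g Ng].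
by apply/eqP => pg; apply: Ng => _ ->.
Qed.

(** Let B be a nonempty relatively clopen part containing b and missing a. On the line through a and
    b, lying in the open set, lying off the closed set and invertibility are guaranteed by three
    nonzero polynomials; a common non-root gives a point both in B and outside it. *)
Lemma line_connected (A : set GL) :
  (forall a b s, A a -> A b ->
     GLmx a + s *: (GLmx b - GLmx a) \in unitmx ->
     A (mkGL (GLmx a + s *: (GLmx b - GLmx a)))) -> connected A.
Proof.
move=> Aline B [b Bb] [Co Coo BCo] [Cc Ccc BCc].
have AB : (B `<=` A)%classic by rewrite BCo => ? [].
apply/seteqP; split=> // a Aa; apply: contrapT => NBa.
have Cob : Co b by move: Bb; rewrite BCo => -[].
have NCca : (~` Cc)%classic a by move=> Cca; apply: NBa; rewrite BCc.
have [p pb pCo] := open_GL_nonzero Coo Cob.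
have [q qa qCc] := open_GL_nonzero (closed_openC Ccc) NCca.
pose M s := GLmx a + s *: (GLmx b - GLmx a).
have M0 : M 0 = GLmx a by rewrite /M scale0r addr0.
have M1 : M 1 = GLmx b by rewrite /M scale1r addrC subrK.
have PA := polyfn_subalg C.
have PM x y : polyfn (fun s => M s x y) by exact: polyfn_line.
have Pp : polyfn (fun s => mev p (M s)) by exact: subalg_mev.
have Pq : polyfn (fun s => mev q (M s)) by exact: subalg_mev.
have Pd : polyfn (fun s => \det (M s)) by exact: subalg_det.
have [s [pq ds]] : exists s, mev p (M s) * mev q (M s) != 0 /\ \det (M s) != 0.
  apply: (polyfn_neq0M (subalgM PA Pp Pq) Pd).
    have [||s [ps qs]] := polyfn_neq0M Pp Pq; last by exists s; apply: mulf_neq0.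
      by exists 1; rewrite M1.
    by exists 0; rewrite M0.
  by exists 0; rewrite M0 -unitfE -unitmxE GLmx_unit.
have uM : M s \in unitmx by rewrite unitmxE unitfE.
move: pq; rewrite mulf_eq0 negb_or => /andP[ps qs].
have AM : A (mkGL (M s)) by apply: Aline => //; exact: AB.
have : B (mkGL (M s)) by rewrite BCo; split=> //; apply: pCo; rewrite pevalE mkGLE.
by rewrite BCc => -[_]; apply: qCc; rewrite pevalE mkGLE.
Qed.

End ZariskiGL.

(** * Solvability of B and non-solvability of pairs of opposite root subgroups *)

Section DerivedSubgroup.
Variable G : groupType.
Implicit Types H K : set G.
Local Open Scope group_scope.

Lemma generated_subgroup A : @subgroup G (generated A).
Proof.
split=> [H [[]]//|x y Ax Ay H HA|x Ax H HA]; have [[_ HM HV] _] := HA.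
  by apply: HM; [exact: Ax|exact: Ay].
by apply: HV; exact: Ax.
Qed.

Lemma derived_sub H K : subgroup K ->
  (forall x y, H x -> H y -> K (x^-1 * y^-1 * x * y)) ->
  (derived_subgroup H `<=` K)%classic.
Proof.
move=> KG HK x; apply; split=> // _ [a Ha [b Hb <-]]; exact: HK.
Qed.

Lemma derived_comm H x y : H x -> H y -> derived_subgroup H (x^-1 * y^-1 * x * y).
Proof. by move=> Hx Hy K [_ HK]; apply: HK; exists x => //; exists y. Qed.

End DerivedSubgroup.

Section UpperFiltration.
Variables (R : realType) (n : nat).
Local Notation C := R[i].
Local Notation GL := (GL R n).
Local Notation borel := (@borel R n).
Implicit Types (g h : GL) (x y z : 'I_n).

(** Level 0 is B, level m > 0 the unitriangular matrices with m - 1 zero superdiagonals, and level n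
    is trivial. *)
Definition upper_filtration m : set GL :=
  [set g | borel g /\ forall x y : 'I_n, (y < x + m)%N -> GLmx g x y = (x == y)%:R]%classic.

Lemma upper_filtration_subgroup m : subgroup (upper_filtration m).
Proof.
have [B1 BM BV] := borel_subgroup_GL R n.
split=> [|g h [gB gm] [hB hm]|g [gB gm]].
- by split=> // x y _; rewrite GLmx1 mxE.
- split=> [|x y yxm]; first exact: BM.
  rewrite GLmxM mxE (bigD1 x)//= big1 => [|z zx].
    have [xm|mx] := ltnP x (x + m); first by rewrite gm// eqxx mul1r hm ?addr0.
    have m0 : m = 0 by lia.
    by rewrite m0 addn0 in yxm; rewrite hm ?m0 ?addn0// -val_eqE gtn_eqF// mulr0 addr0.
  have [yz|zy] := ltnP y z; first by rewrite ((borelP _).1 hB)// mulr0.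
  by rewrite gm ?(leq_ltn_trans zy)// eq_sym (negbTE zx) mul0r.
- split=> [|x y yxm]; first exact: BV.
  have hB := BV _ gB.
  have [yx|xy] := ltnP y x; first by rewrite (borelP _).1// -val_eqE gtn_eqF.
  have := congr1 (fun M : 'M_n => M x y) (GLmx_mulV g).
  rewrite mxE (bigD1 x)//= big1 => [|z zx].
    by rewrite gm ?eqxx ?mul1r ?addr0 ?mxE// (leq_ltn_trans xy).
  have [yz|zy] := ltnP y z; first by rewrite ((borelP _).1 hB)// mulr0.
  by rewrite gm ?(leq_ltn_trans zy)// eq_sym (negbTE zx) mul0r.
Qed.

Lemma upper_mulmx_diag (M N : 'M[C]_n) x :
  (forall a b : 'I_n, (b < a)%N -> M a b = 0) ->
  (forall a b : 'I_n, (b < a)%N -> N a b = 0) ->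
  (M *m N) x x = M x x * N x x.
Proof.
move=> M0 N0; rewrite mxE (bigD1 x)//= big1 ?addr0// => z zx.
have [zx'|xz] := ltnP z x; first by rewrite M0 ?mul0r.
by rewrite N0 ?mulr0// ltn_neqAle xz eq_sym andbT.
Qed.

(** The products g h and h g agree at all entries (a, b) with b <= a + m: at level 0 because
    diagonals commute, above because only the two factors' own entries survive. Multiplying by the
    upper triangular (h g)^-1 keeps this range. *)
Lemma upper_filtration_comm m g h : upper_filtration m g -> upper_filtration m h ->
  upper_filtration m.+1 (g^-1 * h^-1 * g * h)%g.
Proof.
move=> gF hF; have [[gB gm] [hB hm]] := (gF, hF).
have [B1 BM BV] := borel_subgroup_GL R n.
have cB : borel (g^-1 * h^-1 * g * h)%g by exact: BM (BM _ _ (BM _ _ (BV _ gB) (BV _ hB)) gB) hB.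
split=> // x y; rewrite addnS ltnS => yxm.
have gh_comm (a b : 'I_n) : (b <= a + m)%N ->
    (GLmx g *m GLmx h) a b = (GLmx h *m GLmx g) a b :> C.
  move=> bam; have [m0|m0] := posnP m.
    move: bam; rewrite m0 addn0 leq_eqVlt => /orP[/eqP/val_inj->|ba].
      have [g0 h0] := ((borelP g).1 gB, (borelP h).1 hB).
      by rewrite (upper_mulmx_diag _ g0 h0) (upper_mulmx_diag _ h0 g0) mulrC.
    have [gh0 hg0] := ((borelP _).1 (BM _ _ gB hB), (borelP _).1 (BM _ _ hB gB)).
    by rewrite -!GLmxM gh0// hg0.
  rewrite !mxE.
  have H (M N : GL) : upper_filtration m M -> upper_filtration m N ->
      \sum_c GLmx M a c * GLmx N c b = 
      (if a == b then 1 else GLmx M a b + GLmx N a b) :> C.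
    move=> [_ Mm] [_ Nm].
    have Maa : GLmx M a a = 1 by rewrite Mm ?eqxx//; lia.
    have Nbb : GLmx N b b = 1 by rewrite Nm ?eqxx//; lia.
    have rest c : c != a -> c != b -> GLmx M a c * GLmx N c b = 0.
      move=> ca cb; have [cam|amc] := ltnP c (a + m).
        by rewrite Mm// eq_sym (negbTE ca) mul0r.
      by rewrite Nm ?(negbTE cb) ?mulr0//; lia.
    rewrite (bigD1 a)//= Maa mul1r; have [ab|ab] := eqVneq a b.
      rewrite -ab in Nbb *; rewrite Nbb big1 ?addr0// => c ca.
      by move: (rest c ca); rewrite -ab; apply.
    rewrite (bigD1 b) 1?eq_sym//= Nbb mulr1 big1 ?addr0 1?addrC// => c /andP[].
    exact: rest.
  by rewrite H// H//; case: ifP => // _; rewrite addrC.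
have -> : (g^-1 * h^-1 * g * h)%g = ((h * g)^-1 * (g * h))%g.
  by rewrite invMg !mulgA.
have hgB : borel (h * g)^-1%g by apply/BV/BM.
transitivity ((GLmx (h * g)^-1%g *m GLmx (h * g)%g) x y); last first.
  by rewrite GLmx_Vmul mxE.
rewrite GLmxM !mxE; apply: eq_bigr => z _.
have [zx|xz] := ltnP z x; first by rewrite ((borelP _).1 hgB)// !mul0r.
by congr (_ * _); rewrite !GLmxM; apply: gh_comm; lia.
Qed.

Lemma borel_sub_solvable (H : set GL) : (H `<=` borel)%classic -> solvable_subgroup H.
Proof.
move=> HB; exists n.
have FH k : (iter k (@derived_subgroup GL) H `<=` upper_filtration k)%classic.
  elim: k => [g /HB gB|k IH].
    by split=> // x y; rewrite addn0 => yx; rewrite (borelP g).1// -val_eqE gtn_eqF.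
  apply: derived_sub => [|g h /IH gF /IH hF]; first exact: upper_filtration_subgroup.
  exact: upper_filtration_comm.
move=> g /FH[_ gn]; apply: GLP; apply/matrixP => x y.
by rewrite gn ?GLmx1 ?mxE// (leq_trans (ltn_ord y)) ?leq_addl.
Qed.

Lemma sl2_diag_mem (H : set GL) x y : subgroup H -> x != y ->
  (forall s, H (elemGL x y s)) -> (forall s, H (elemGL y x s)) ->
  H (diagGL (fun a => if a == x then 2 else if a == y then 2^-1 else 1)).
Proof.
move=> [_ HM _] xy Hx Hy; have yx : y != x by rewrite eq_sym.
have two0 : (2 : C) != 0 by rewrite pnatr_eq0.
set d := fun a => _; have d0 a : d a != 0.
  by rewrite /d; case: ifP => _; [|case: ifP => _]; rewrite ?invr_eq0 ?oner_eq0.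
have -> : diagGL d = (elemGL x y 2%R * (elemGL y x (- 2^-1)%R *
    (elemGL x y (2 - 1)%R * (elemGL y x 1%R * elemGL x y (- 1)%R))))%g.
  apply: GLP; rewrite diagE// !GLmxM !(elemE _ xy) !(elemE _ yx).
  by rewrite sl2_diag.
exact: HM (Hx _) (HM _ _ (Hy _) (HM _ _ (Hx _) (HM _ _ (Hy _) (Hx _)))).
Qed.

Lemma elem_derived (H : set GL) x y : subgroup H -> x != y ->
  (forall s, H (elemGL x y s)) -> (forall s, H (elemGL y x s)) ->
  forall s, derived_subgroup H (elemGL x y s).
Proof.
move=> HG xy Hx Hy s; have Hd := sl2_diag_mem HG xy Hx Hy.
have [_ HM HV] := HG; have two0 : (2 : C) != 0 by rewrite pnatr_eq0.
set d := (fun a => _) in Hd; have d0 a : d a != 0.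
  by rewrite /d; case: ifP => _; [|case: ifP => _]; rewrite ?invr_eq0 ?oner_eq0.
have dconj t : (diagGL d * elemGL x y t = elemGL x y (d x / d y * t)%R * diagGL d)%g.
  apply: GLP; rewrite !GLmxM diagE// !(elemE _ xy).
  exact: elemmx_diag_conj.
(* Here [d x / d y] = 4, so the commutator of [diagGL d] with a root element multiplies its
   parameter by 4 - 1; whence s / 3. *)
have -> : elemGL x y s = ((diagGL d)^-1^-1 * (elemGL x y (- (s / 3))%R)^-1 *
    (diagGL d)^-1 * elemGL x y (- (s / 3))%R)%g.
  rewrite invgK (elemV _ xy) opprK dconj mulgK (elemM _ _ xy); congr elemGL.
  rewrite /d eqxx (eq_sym y x) (negbTE xy) eqxx.
  by field.
apply: derived_comm; first exact: HV.
exact: Hx.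
Qed.

(** Both opposite root subgroups survive in every derived subgroup, by [elem_derived] applied in
    both directions. *)
Lemma elem_not_solvable (H : set GL) x y : subgroup H -> x != y ->
  (forall s, H (elemGL x y s)) -> (forall s, H (elemGL y x s)) -> ~ solvable_subgroup H.
Proof.
move=> HG xy Hx Hy [k Hk]; have yx : y != x by rewrite eq_sym.
have [_ [HE _]] : [/\ subgroup (iter k (@derived_subgroup GL) H) &
    (forall s, iter k (@derived_subgroup GL) H (elemGL x y s)) /\
    (forall s, iter k (@derived_subgroup GL) H (elemGL y x s))].
  elim: k {Hk} => [//|k [G' [IHx IHy]]] /=; split; first exact: generated_subgroup.
  by split; apply: elem_derived.
have /(congr1 (fun g : GL => GLmx g x y)) := Hk _ (HE 1).
rewrite (elemE _ xy) elemmx_entry GLmx1 mxE (negbTE xy) !eqxx mulr1 add0r => /eqP.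
by rewrite oner_eq0.
Qed.

End UpperFiltration.

(** * Levi decomposition and Borel subgroup of a closed group containing B *)

Section Levi.
Variables (R : realType) (n : nat).
Local Notation C := R[i].
Local Notation GL := (GL R n).
Local Notation borel := (@borel R n).
Local Notation torus := (@torus R n).
Implicit Types (g h : GL) (x y z : 'I_n) (M : 'M[C]_n).

Lemma unipotent_trace g : unipotent g -> \tr (GLmx g) = n%:R.
Proof.
move=> [k gk]; have := nilpotent_trace gk.
by rewrite raddfB /= mxtrace1 => /eqP; rewrite subr_eq0 => /eqP.
Qed.

(* Constancy of tr (h t h' t^-1) along a one-parameter subgroup t of T
   isolates one product of opposite entries. *)
Lemma unipotent_opposite_entries (N : set GL) h h' x y : x != y ->
  (forall d, (forall a, d a != 0) ->
     unipotent (h * (diagGL d * h' * (diagGL d)^-1))%g) ->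
  GLmx h x y * GLmx h' y x = 0.
Proof.
(* The weights 0 at x, 2 at y and 1 elsewhere make (x, y) the only pair (a, b) with 2 + e b - e a =
   4. The shift by 2 keeps exponents nonnegative, so the coefficient of X^4 in [q] is the wanted
   product. *)
move=> xy huni; pose e (a : 'I_n) : nat := if a == x then 0 else if a == y then 2 else 1.
pose c a b := GLmx h a b * GLmx h' b a.
pose q : {poly C} := \sum_a \sum_b c a b *: 'X^(2 + e b - e a) - n%:R *: 'X^2.
have q0 s : s != 0 -> q.[s] = 0.
  move=> s0; pose d a := s ^+ e a; have d0 a : d a != 0 by rewrite expf_neq0.
  have := unipotent_trace (huni d d0); rewrite diagV// !GLmxM => tr.
  rewrite /q hornerD hornerN hornerZ hornerXn -tr.
  apply/eqP; rewrite subr_eq0; apply/eqP.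
  rewrite horner_sum /mxtrace mulr_suml; apply: eq_bigr => a _.
  rewrite mxE mulr_suml horner_sum; apply: eq_bigr => b _.
  rewrite diag_mulr => [|a']; last by rewrite invr_eq0.
  rewrite diag_mull// hornerZ hornerXn /c /d.
  have -> : s ^+ (2 + e b - e a) = s ^+ 2 * s ^+ e b / s ^+ e a.
    rewrite -exprD expfB_cond// (negbTE s0) add0n.
    by apply: leq_trans (leq_addr _ _); rewrite /e; case: ifP => // _; case: ifP.
  by field; rewrite expf_neq0.
have {}q0 : q = 0.
  apply: contrapT => /eqP qN; have /poly_nonroot[s] : q * 'X != 0.
    by rewrite mulf_neq0 ?polyX_eq0.
  by rewrite hornerM hornerX mulf_eq0 negb_or => /andP[/eqP + /q0].
have := congr1 (coefp 4) q0; rewrite /= coef0 coefB coefZ coefXn /= mulr0 subr0.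
rewrite coef_sum (bigD1 x)//= coef_sum (bigD1 y)//= coefZ coefXn.
rewrite {1 2}/e !eqxx (eq_sym y x) (negbTE xy) /= mulr1.
rewrite big1 => [|b by_]; last first.
  rewrite coefZ coefXn (_ : (4 == 2 + e b - e x)%N = false) ?mulr0// /e eqxx (negbTE by_).
  by case: ifP.
rewrite addr0 big1 ?addr0// => a ax; rewrite coef_sum big1// => b _.
rewrite coefZ coefXn (_ : (4 == 2 + e b - e a)%N = false) ?mulr0// /e (negbTE ax).
by case: (a == y); case: (b == x); case: (b == y).
Qed.

Section ClosedOverBorel.
Variable Q : set GL.
Hypotheses (Qgrp : subgroup Q) (BQ : (borel `<=` Q)%classic) (Qcl : closed Q).

Let QM g h : Q g -> Q h -> Q (g * h)%g. Proof. by case: Qgrp => _ + _; apply. Qed.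
Let QV g : Q g -> Q g^-1%g. Proof. by case: Qgrp => _ _; apply. Qed.

Let pf_levimx x y : pfun (fun g => levimx Q (GLmx g) x y).
Proof.
have [yx|yx] := pselect (rootle Q y x).
  by apply: (@subalg_ext _ _ (@pfun R n) _ (fun g => GLmx g x y)) => [g|];
    [rewrite levimxE | exact: pfun_entry].
by apply: (@subalg_ext _ _ (@pfun R n) _ (fun=> 0)) => [g|];
  [rewrite levimx0 | exact: subalgC (pfun_subalg R n) _].
Qed.

Lemma closed_levi : closed (levi Q).
Proof.
have -> : levi Q = (Q `&` [set g | forall xy : 'I_n * 'I_n,
    levimx Q (GLmx g) xy.1 xy.2 - GLmx g xy.1 xy.2 = 0])%classic.
  apply/seteqP; split=> [g [Qg Dg]|g [Qg Dg]]; split=> //.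
    by move=> xy; rewrite Dg subrr.
  by apply/matrixP => x y; apply/eqP; rewrite -subr_eq0 (Dg (x, y)).
apply: closedI => //; apply: closed_pfun => -[x y] /=.
by apply: (subalgB (pfun_subalg R n)); [exact: pf_levimx | exact: pfun_entry].
Qed.

Lemma closed_radical : closed (radical Q).
Proof.
have -> : radical Q = (Q `&` [set g | forall xy : 'I_n * 'I_n,
    levimx Q (GLmx g) xy.1 xy.2 - (1%:M : 'M[C]_n) xy.1 xy.2 = 0])%classic.
  apply/seteqP; split=> [g [Qg Dg]|g [Qg Dg]]; split=> //.
    by move=> xy; rewrite Dg subrr.
  by apply/matrixP => x y; apply/eqP; rewrite -subr_eq0 (Dg (x, y)).
apply: closedI => //; apply: closed_pfun => -[x y] /=.
by apply: (subalgB (pfun_subalg R n)); [exact: pf_levimx | exact: subalgC (pfun_subalg R n) _].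
Qed.

Lemma closed_leviborel : closed (leviborel Q).
Proof.
have -> : leviborel Q = ([set g | forall xy : 'I_n * 'I_n,
     (if (xy.2 < xy.1)%N then GLmx g xy.1 xy.2 else 0) = 0] `&` levi Q)%classic.
  apply/seteqP; split=> [g [gB Dg]|g [gB [_ Dg]]]; split=> //.
  - by move=> [x y] /=; case: ifP => // yx; apply: (borelP g).1.
  - by split=> //; apply: BQ.
  - by apply/borelP => x y yx; have := gB (x, y); rewrite /= yx.
apply: closedI closed_levi; apply: closed_pfun => -[x y] /=.
case: (y < x)%N; first exact: pfun_entry.
exact: subalgC (pfun_subalg R n) _.
Qed.

Lemma levimx_line (A B : 'M[C]_n) s :
  levimx Q (A + s *: (B - A)) = levimx Q A + s *: (levimx Q B - levimx Q A).
Proof.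
apply/matrixP => x y; rewrite !mxE; case: ifP => // _.
by rewrite subrr mulr0 addr0.
Qed.

Lemma borel_line (A B : GL) s : borel A -> borel B ->
  GLmx A + s *: (GLmx B - GLmx A) \in unitmx ->
  borel (mkGL (GLmx A + s *: (GLmx B - GLmx A))).
Proof.
move=> /borelP AB /borelP BB uM; apply/borelP => x y yx.
by rewrite mkGLE// !mxE AB// BB// subrr mulr0 addr0.
Qed.

Lemma connected_leviborel : connected (leviborel Q).
Proof.
apply: line_connected => a b s [aB Da] [bB Db] uM; split; first exact: borel_line.
by rewrite mkGLE// levimx_line Da Db.
Qed.

Lemma connected_radical : connected (radical Q).
Proof.
apply: line_connected => a b s aU bU uM.
have [[_ Da] [_ Db]] := (aU, bU); split; last first.
  by rewrite mkGLE// levimx_line Da Db subrr scaler0 addr0.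
by apply: BQ; apply: borel_line => //; exact: (radical_borel BQ).
Qed.

Lemma radical_unipotent g : radical Q g -> unipotent g.
Proof.
move=> gU; exists n; apply: strict_upper_nilp => x y yx.
by rewrite 2!mxE (radical_entry gU (rootle_leq BQ yx)) mxE subrr.
Qed.

(** If [g x y] were nonzero, every conjugate of g by the root subgroup (y, x) would have zero entry
    at (y, x), by [unipotent_opposite_entries] for g and that conjugate. But this entry is quadratic
    in the parameter with leading coefficient [- g x y]. *)
Lemma unip_normal_entry (N : set GL) g x y : unip_normal_subgroup Q N -> N g ->
  rootle Q y x -> x != y -> GLmx g x y = 0.
Proof.
move=> [[_ NM _] [NQ Nn] _ _ Nu] Ng yx xy; apply/eqP/negPn/negP => gxy.
have yNx : y != x by rewrite eq_sym.
have Qyx s : Q (elemGL y x s).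
  by case: yx => [/eqP|//]; rewrite (negbTE yNx).
pose g' s := (elemGL y x s * g * (elemGL y x s)^-1)%g.
have Ng' s : N (g' s) by apply: Nn.
have g'0 s : GLmx (g' s) y x = 0.
  have /eqP : GLmx g x y * GLmx (g' s) y x = 0.
    apply: (unipotent_opposite_entries N xy) => d d0; apply/Nu/NM => //.
    by apply: Nn => //; apply/BQ/torus_borel/diag_torus.
  by rewrite mulf_eq0 (negbTE gxy) => /eqP.
have g'E s : GLmx (g' s) y x =
    GLmx g y x + s * GLmx g x x - (GLmx g y y + s * GLmx g x y) * s.
  rewrite /g' (elemV _ yNx) GLmxM (elemE _ yNx) elemmx_mulr eqxx GLmxM (elemE _ yNx).
  by rewrite !elemmx_mull eqxx mulrN.
(* The second difference at -1, 0, 1 isolates the leading coefficient. *)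
have := g'0 1; have := g'0 (- 1); have := g'0 0; rewrite !g'E => e0 e1 e2.
have : 2 * GLmx g x y = 0.
  transitivity (2 * (GLmx g y x + 0 * GLmx g x x - (GLmx g y y + 0 * GLmx g x y) * 0) -
    (GLmx g y x + -1 * GLmx g x x - (GLmx g y y + -1 * GLmx g x y) * -1) -
    (GLmx g y x + 1 * GLmx g x x - (GLmx g y y + 1 * GLmx g x y) * 1)); first by ring.
  by rewrite e0 e1 e2 mulr0 !subr0.
by move/eqP; rewrite mulf_eq0 (negbTE gxy) pnatr_eq0.
Qed.

(** Off-diagonal block entries vanish by [unip_normal_entry], as do all entries below the diagonal;
    so g is upper triangular, and nilpotency of g - 1 forces its diagonal to be 1. *)
Lemma unip_normal_radical (N : set GL) :
  unip_normal_subgroup Q N -> (N `<=` radical Q)%classic.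
Proof.
move=> NU g Ng; have [_ [NQ _] _ _ Nu] := NU; split; first exact: NQ.
have off x y : rootle Q y x -> x != y -> GLmx g x y = 0 by exact: unip_normal_entry NU Ng.
apply/matrixP => x y; have [yx|yx] := pselect (rootle Q y x); last first.
  by rewrite levimx0// mxE; case: eqP => // xy; case: yx; rewrite xy; left.
rewrite levimxE// mxE; have [<-|xy] := eqVneq x y; last exact: off.
have [k gk] := Nu _ Ng; have := congr1 (fun M : 'M_n => M x x) gk.
rewrite upper_exp_diag => [|a b ba]; last first.
  by rewrite 2!mxE off ?mxE -?val_eqE ?gtn_eqF//; [rewrite subrr|exact/(rootle_leq BQ)/ltnW].
by rewrite !mxE eqxx => /eqP; rewrite expf_eq0 subr_eq0 => /andP[_ /eqP].
Qed.

Lemma levi_subgroup_of : levi_subgroup Q (levi Q).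
Proof.
split; [exact: levi_subgroup_GL | exact: closed_levi|exists (radical Q)]; split.
- split; last exact: unip_normal_radical.
  split; [exact: radical_subgroup_GL | exact: radical_normal | exact: closed_radical
    | exact: connected_radical | exact: radical_unipotent].
- exact: levi_radical1.
- exact: levi_radicalE.
Qed.

(** For maximality, an element of a larger H with a nonzero entry (x, y) below the diagonal forces
    the root subgroup (x, y) into H. Its opposite is there already, and together they contradict
    solvability. *)
Lemma borel_subgroup_of : borel_subgroup (levi Q) (leviborel Q).
Proof.
have BLL := leviborel_levi BQ.
split.
  split=> //; [exact: leviborel_subgroup_GL | exact: closed_leviborel
    | exact: connected_leviborel | by apply: borel_sub_solvable => g []].
move=> H [HG HL _ _ Hs] BLH; apply/seteqP; split=> // h Hh.
split; last by have [_] := HL _ Hh.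
apply/borelP => x y yx; apply/eqP/negPn/negP => hxy.
have [[H1 HM HV] [_ Dh]] := (HG, HL _ Hh).
have xNy : x != y by rewrite -val_eqE gtn_eqF.
have yNx : y != x by rewrite eq_sym.
have yleQx : rootle Q y x by exact/(rootle_leq BQ)/ltnW.
have xleQy : rootle Q x y by exact/(rootle_entry Qgrp BQ _ hxy)/(HL _ Hh).1.
(* [rootle_entry] applies to groups containing B. Multiplying H by the radical gives such a group,
   and taking block parts afterwards leads back to H. *)
pose K : set GL := [set (l * u)%g | l in H & u in radical Q]%classic.
have [U1 UM UV] := radical_subgroup_GL Qgrp BQ.
have [UQ Un] := radical_normal Qgrp BQ.
have KG : subgroup K.
  split; first by exists 1%g => //; exists 1%g; rewrite ?mulg1.
    move=> _ _ [l Hl [u Uu <-]] [l' Hl' [u' Uu' <-]]; exists (l * l')%g; first exact: HM.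
    exists (l'^-1 * u * l' * u')%g; last by rewrite !mulgA mulgK.
    apply: UM => //; have := Un (l'^-1)%g u; rewrite invgK; apply => //.
    by apply: QV; case: (HL _ Hl').
  move=> _ [l Hl [u Uu <-]]; exists l^-1%g; first exact: HV.
  exists (l * u^-1 * l^-1)%g; last by rewrite invMg !mulgA mulVg mul1g.
  by apply: Un; [case: (HL _ Hl)|exact: UV].
have BK : (borel `<=` K)%classic.
  move=> b bB; have [l [u [lL uU bE lE]]] := levi_factor Qgrp BQ (BQ bB).
  exists l; last by exists u.
  apply: BLH; split; last by case: lL.
  have -> : l = (b * u^-1)%g by rewrite bE mulgK.
  by apply: upper_triM => //; apply: upper_triV; exact: (radical_borel BQ).
have Kh : K h by exists h => //; exists 1%g; rewrite ?mulg1.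
have Hxy s : H (elemGL x y s).
  have [/eqP|/(_ s) [l Hl [u Uu lu]]] := rootle_entry KG BK Kh hxy.
    by rewrite (negbTE xNy).
  suff <- : l = elemGL x y s by [].
  apply: GLP; rewrite -(elem_levimx _ xNy yleQx) -lu (levimxM Qgrp BQ); last 2 first.
  - by case: (HL _ Hl).
  - by case: Uu.
  by case: (HL _ Hl) => _ ->; case: Uu => _ ->; rewrite mulmx1.
have Hyx s : H (elemGL y x s).
  by apply: BLH; split; [exact: elem_borel | exact: elem_levimx].
exact: (elem_not_solvable HG xNy Hxy Hyx).
Qed.

End ClosedOverBorel.
End Levi.

(** * Schubert varieties *)

Section FlagTopology.
Variables (R : realType) (n : nat).
Local Notation C := R[i].
Local Notation GL := (GL R n).
Local Notation Fl := (Fl R n).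
Local Notation borel := (@borel R n).
Local Notation torus := (@torus R n).
Implicit Types (g h b : GL) (M : 'M[C]_n).

Lemma coset_repr (x : Fl) : coset (generic_quotient.repr x) = x.
Proof. exact: generic_quotient.reprK. Qed.

Lemma coset_mulr g b : borel b -> coset (g * b)%g = coset g.
Proof. by move=> bB; apply/esym/coset_eq; rewrite mulKg. Qed.

Lemma cosetP g h : coset g = coset h -> exists2 b, borel b & h = (g * b)%g.
Proof. by move=> /coset_eq gh; exists (g^-1 * h)%g; rewrite ?mulKVg. Qed.

Lemma repr_coset g : exists2 b, borel b & generic_quotient.repr (coset g) = (g * b)%g.
Proof. by apply: cosetP; rewrite coset_repr. Qed.

Lemma open_FlE (U : set Fl) : open U = open (@coset R n @^-1` U)%classic.
Proof. by []. Qed.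

Lemma open_Fl_nonzero (V : set Fl) g : open V -> V (coset g) ->
  exists2 p, peval p g != 0 & forall h, peval p h != 0 -> V (coset h).
Proof.
rewrite open_FlE => oV Vg.
have [p pg pV] := @open_GL_nonzero R n (@coset R n @^-1` V)%classic g oV Vg.
by exists p.
Qed.

(* G -> G/B is an open map. *)
Lemma open_image_nonzero (q : {mpoly C[n * n]}) : exists V : set Fl, open V /\
  forall g, V (coset g) <-> exists2 b, borel b & peval q (g * b)%g != 0.
Proof.
exists [set coset g | g in [set g : GL | peval q g != 0]]%classic.
have VE g : [set coset g | g in [set g : GL | peval q g != 0]]%classic (coset g) <->
    exists2 b, borel b & peval q (g * b)%g != 0.
  split=> [[h qh /esym/cosetP[b bB hE]]|[b bB qgb]]; first by exists b; rewrite -?hE.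
  by exists (g * b)%g; rewrite ?coset_mulr.
split=> //; rewrite open_FlE open_GLE.
exists [set p | exists2 b, borel b & forall g, peval p g = peval q (g * b)%g]%classic.
apply/seteqP; split=> [g /VE[b bB qgb] Z0|g Ng].
  have [p pE] := pfun_mulr q b; case/eqP: qgb; rewrite pE; apply: Z0.
  by exists b.
apply/VE; apply: contrapT => /forall2NP NE; apply: Ng => p [b bB ->].
by have [//|/negP/negPn/eqP] := NE b.
Qed.

End FlagTopology.

Section Cells.
Variables (R : realType) (n : nat) (w : 'S_n).
Local Notation C := R[i].
Local Notation GL := (GL R n).
Local Notation Fl := (Fl R n).
Local Notation borel := (@borel R n).
Local Notation torus := (@torus R n).
Local Notation X := (schubert R w).
Implicit Types (g h : GL) (M N : 'M[C]_n) (p q : {mpoly C[n * n]}).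

Definition bruhat_cell : set GL :=
  [set h | exists b b', [/\ borel b, borel b' & h = (b * permGL R w * b')%g]]%classic.

Lemma orbit_cell g :
  orbit_under borel (coset (permGL R w)) (coset g) <-> bruhat_cell g.
Proof.
split=> [[b bB]|[b [b' [bB bB' ->]]]].
  rewrite act_coset => /cosetP[b' bB' ->]; exists b, b'; split=> //.
by exists b => //; rewrite act_coset (coset_mulr _ bB').
Qed.

(** Closure in G/B is tested by polynomials on GL because the quotient map is continuous and open: a
    polynomial that is nonzero at g yields a neighbourhood of its coset, and every neighbourhood
    contains one of this kind. *)
Lemma mem_schubert g : X (coset g) <->
  forall p, (forall h, bruhat_cell h -> peval p h = 0) -> peval p g = 0.
Proof.
split=> [Xg p pC|gI].
  apply/eqP/negPn/negP => pg; have [V [Vo VE]] := open_image_nonzero p.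
  have Vg : V (coset g).
    by apply/VE; exists 1%g; rewrite ?mulg1//; exact: upper_tri1.
  have [y [Cy Vy]] := Xg V (open_nbhs_nbhs (conj Vo Vg)).
  rewrite -(coset_repr y) in Cy Vy; move/orbit_cell: Cy => Cy.
  have [b bB /eqP] := (VE _).1 Vy; apply; apply: pC.
  have [b1 [b2 [b1B b2B ->]]] := Cy; exists b1, (b2 * b)%g; split=> //.
    exact: upper_triM.
  by rewrite mulgA.
move=> B; rewrite nbhsE => -[V [Vo Vg] VB].
have [p pg pV] := open_Fl_nonzero Vo Vg.
apply: contrapT => BN; case/eqP: pg; apply: gI => h hC.
apply/eqP/negPn/negP => ph; apply: BN; exists (coset h); split.
  exact/orbit_cell.
exact/VB/pV.
Qed.

Lemma bruhat_cell_schubert g : bruhat_cell g -> X (coset g).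
Proof. by move=> gC; apply/mem_schubert => p; apply. Qed.

Lemma schubert_nonzero q h : X (coset h) -> peval q h != 0 ->
  exists2 h', bruhat_cell h' & peval q h' != 0.
Proof.
move=> Xh qh; apply: contrapT => /forall2NP H; case/eqP: qh.
apply: (mem_schubert h).1 => // h' Ch'; apply/eqP/negPn/negP.
by have [] := H h'.
Qed.

Lemma schubert_mull g : (forall h, bruhat_cell h -> X (coset (g * h)%g)) ->
  forall h, X (coset h) -> X (coset (g * h)%g).
Proof.
move=> gC h Xh; apply/mem_schubert => p pI; have [p' p'E] := pfun_mull p g.
rewrite p'E; apply: (mem_schubert h).1 => // h' /gC/mem_schubert gh'.
by rewrite -p'E; apply: gh'.
Qed.

Lemma bruhat_cell_mull b h : borel b -> bruhat_cell h -> bruhat_cell (b * h)%g.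
Proof.
move=> bB [b1 [b2 [b1B b2B ->]]]; exists (b * b1)%g, b2; split=> //.
  exact: upper_triM.
by rewrite !mulgA.
Qed.

Lemma stabilizerP g : stabilizer X g <->
  (forall h, X (coset h) -> X (coset (g * h)%g)) /\
  (forall h, X (coset h) -> X (coset (g^-1 * h)%g)).
Proof.
split=> [gX|[gX gVX]].
  have gX' h : X (coset h) -> X (coset (g * h)%g).
    by move=> Xh; rewrite -gX; exists (coset h) => //; rewrite act_coset.
  split=> // h; rewrite -{1}gX => -[x Xx]; rewrite -(coset_repr x) act_coset.
  move=> /cosetP[b bB ->]; rewrite -mulgA mulKg (coset_mulr _ bB) coset_repr.
  exact: Xx.
apply/seteqP; split=> [_ [x Xx <-]|x Xx].
  by rewrite -(coset_repr x) act_coset; apply: gX; rewrite coset_repr.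
exists (coset (g^-1 * generic_quotient.repr x)%g).
  by apply: gVX; rewrite coset_repr.
by rewrite act_coset mulKVg coset_repr.
Qed.

Lemma stabilizer_subgroup : subgroup (stabilizer X).
Proof.
split=> [|g h /stabilizerP[g1 g2] /stabilizerP[h1 h2]|g /stabilizerP[g1 g2]].
- by apply/stabilizerP; rewrite invg1; split=> h; rewrite mul1g.
- apply/stabilizerP; rewrite invMg.
  by split=> k Xk; rewrite -mulgA; [apply/g1/h1 | apply/h2/g2].
- by apply/stabilizerP; rewrite invgK.
Qed.

Lemma stabilizer_borel : (borel `<=` stabilizer X)%classic.
Proof.
move=> b bB; apply/stabilizerP; split; apply: schubert_mull => h hC.
  exact/bruhat_cell_schubert/bruhat_cell_mull.
by apply/bruhat_cell_schubert/bruhat_cell_mull => //; apply: upper_triV.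
Qed.

Lemma pfun_adj h a b : pfun (fun g => (\adj (GLmx g) *m GLmx h) a b).
Proof.
have PA := pfun_subalg R n.
apply: (subalg_mulmx PA) => [i j|i j]; last exact: subalgC PA _.
apply: (@subalg_ext _ _ (@pfun R n) _ (fun g => (-1) ^+ (j + i) *
    \det (row' j (col' i (GLmx g))))) => [g|]; first by rewrite mxE /cofactor.
apply: (subalgM PA); first exact: subalgC PA _.
apply: (subalg_det PA) => k l.
apply: (@subalg_ext _ _ (@pfun R n) _ (fun g => GLmx g (lift j k) (lift i l))) => [g|].
  by rewrite !mxE.
exact: pfun_entry.
Qed.

(** The adjugate is a polynomial substitute for g^-1: the scalar factor is a diagonal matrix on the
    right, invisible in G/B. *)
Lemma adj_mulE g h :
  \adj (GLmx g) *m GLmx h = GLmx (g^-1 * h * diagGL (fun=> \det (GLmx g)))%g.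
Proof.
have dg : \det (GLmx g) != 0 by rewrite -unitfE -unitmxE GLmx_unit.
rewrite GLmxM diagE// GLmxM GLmxV /invmx GLmx_unit.
have -> : diag_mx (\row_a \det (GLmx g)) = (\det (GLmx g))%:M :> 'M_n.
  by apply/matrixP => a b; rewrite !mxE.
by rewrite mul_mx_scalar -scalemxAl scalerA mulfV// scale1r.
Qed.

(** Both g X in X and g^-1 X in X are families of polynomial equations in g, indexed by a point of X
    and a polynomial vanishing on the cell; the second family uses the adjugate. *)
Lemma closed_stabilizer : closed (stabilizer X).
Proof.
pose I := (GL * {mpoly C[n * n]})%type.
pose ok (hp : I) := X (coset hp.1) /\ forall h, bruhat_cell h -> peval hp.2 h = 0.
have -> : stabilizer X = ([set g | forall hp : I,
      (if `[< ok hp >] then peval hp.2 (g * hp.1)%g else 0) = 0] `&`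
    [set g | forall hp : I,
      (if `[< ok hp >] then mev hp.2 (\adj (GLmx g) *m GLmx hp.1) else 0) = 0])%classic.
  have dB g : borel (diagGL (fun=> \det (GLmx g))).
    by apply/torus_borel/diag_torus => _; rewrite -unitfE -unitmxE GLmx_unit.
  apply/seteqP; split=> [g /stabilizerP[g1 g2]|g [g1 g2]].
    split=> -[h p] /=; case: asboolP => // -[/= Xh pI].
      exact: (mem_schubert _).1 (g1 _ Xh) p pI.
    rewrite adj_mulE -pevalE; apply: (mem_schubert _).1 p pI.
    by rewrite (coset_mulr _ (dB g)); apply: g2.
  apply/stabilizerP; split=> h Xh.
    by apply/mem_schubert => p pI; have := g1 (h, p); rewrite asboolT.
  rewrite -(coset_mulr _ (dB g)); apply/mem_schubert => p pI.
  by have := g2 (h, p); rewrite asboolT// adj_mulE.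
apply: closedI; apply: closed_pfun => -[h p] /=; case: asboolP => _.
- exact: pfun_mulr.
- exact: subalgC (pfun_subalg R n) _.
- by apply: pfun_mev => a b; exact: pfun_adj.
- exact: subalgC (pfun_subalg R n) _.
Qed.

End Cells.

(** * Affine coordinates on the open cell *)

Section LinearCells.
Variables (F : numFieldType) (n : nat).
Implicit Types (M N : 'M[F]_n) (w : 'S_n).

Lemma cellmx_unit w N : cellmx w N -> N \in unitmx.
Proof.
move=> Nw; have NT : is_trig_mx N.
  by apply/is_trig_mxP => i j ij; rewrite Nw -?val_eqE ?ltn_eqF// ltnNge (ltnW ij).
rewrite unitmxE (det_trig NT) big1 ?unitr1// => i _.
by rewrite Nw ?eqxx// ltnn.
Qed.

Lemma cellmx_line w N N' s : cellmx w N -> cellmx w N' ->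
  cellmx w (N + s *: (N' - N)).
Proof.
by move=> Nw N'w j i ij; rewrite !mxE Nw// N'w// subrr mulr0 addr0.
Qed.

Lemma cellmx_delta w N s (i k : 'I_n) : (i < k)%N -> (w k < w i)%N ->
  cellmx w N -> cellmx w (N + s *: delta_mx k i).
Proof.
move=> ik wki Nw b a ab; rewrite !mxE Nw//.
case: (b =P k) => [bk|_]; last by rewrite /= mulr0 addr0.
case: (a =P i) => [ai|_]; last by rewrite /= mulr0 addr0.
by case/negP: ab; rewrite bk ai ik.
Qed.

(* Functions polynomial along every affine line; on the affine space of cell
   matrices this is all that is used of polynomial functions. *)
Definition linefn (f : 'M[F]_n -> F) : Prop :=
  forall A B, polyfn (fun s => f (A + s *: B)).

Lemma linefn_subalg : subalg linefn.
Proof.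
have PA := polyfn_subalg F.
split=> [c|f g fp gp|f g fp gp] A B.
- exact: subalgC PA _.
- exact: (subalgD PA (fp A B) (gp A B)).
- exact: (subalgM PA (fp A B) (gp A B)).
Qed.

Lemma linefn_entry a b : linefn (fun M => M a b).
Proof. by move=> A B; exact: polyfn_line. Qed.

Definition cell_nonzero w (f : 'M[F]_n -> F) : Prop :=
  exists2 N, cellmx w N & f N != 0.

Lemma cell_irred w f g : linefn f -> linefn g -> cell_nonzero w f ->
  cell_nonzero w g -> cell_nonzero w (fun N => f N * g N).
Proof.
move=> lf lg [N Nw fN] [N' N'w gN].
have [||s [fs gs]] := polyfn_neq0M (lf N (N' - N)) (lg N (N' - N)).
- by exists 0; rewrite scale0r addr0.
- by exists 1; rewrite scale1r addrC subrK.
by exists (N + s *: (N' - N)); [exact: cellmx_line | exact: mulf_neq0].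
Qed.

Definition onesmx w : 'M[F]_n :=
  \matrix_(j, i) ((j == i) || ((i < j) && (w j < w i))%N)%:R.

Lemma onesmx_cell w : cellmx w (onesmx w).
Proof. by move=> j i /negbTE ji; rewrite mxE ji orbF. Qed.

Lemma onesmxE w (i j : 'I_n) : (i < j)%N -> (w j < w i)%N -> onesmx w j i = 1.
Proof. by move=> ij wji; rewrite mxE ij wji orbT. Qed.

End LinearCells.

Section CellPoints.
Variables (R : realType) (n : nat) (w : 'S_n).
Local Notation C := R[i].
Local Notation GL := (GL R n).
Local Notation Fl := (Fl R n).
Local Notation borel := (@borel R n).
Local Notation torus := (@torus R n).
Local Notation X := (schubert R w).
Implicit Types (g h : GL) (M N : 'M[C]_n) (p q : {mpoly C[n * n]}).

Definition cellpt (v : 'S_n) N : Fl := coset (permGL R v * mkGL N)%g.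

Lemma cell_mem N : cellmx w N -> bruhat_cell w (permGL R w * mkGL N)%g.
Proof.
move=> Nw; exists (permGL R w * mkGL N * (permGL R w)^-1)%g, 1%g; split.
- by apply: cell_upper; rewrite mkGLE// (cellmx_unit Nw).
- exact: upper_tri1.
- by rewrite mulg1 mulgKV.
Qed.

Lemma cellpt_schubert N : cellmx w N -> X (cellpt w N).
Proof. by move=> Nw; apply/bruhat_cell_schubert/cell_mem. Qed.

(** Disjointness of Bruhat cells. The entry (v j, j) is the nonzero [b' j j] on one side and
    [b (v j) (w j)] on the other, so [v j <= w j] for all j; the values of v and w have equal
    sums. *)
Lemma bruhat_perm_eq (v : 'S_n) b b' : borel b -> borel b' ->
  (b * permGL R w = permGL R v * b')%g -> v = w.
Proof.
move=> bB bB' E; apply/permP => i; apply/val_inj/eqP; rewrite /=.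
have le_vw j : (v j <= w j)%N.
  rewrite leqNgt; apply/negP => wv; have := borel_diag_neq0 j bB'.
  have /(congr1 (fun g : GL => GLmx g (v j) j)) := E.
  rewrite !GLmxM perm_mulr perm_mull permK => <-.
  by rewrite (borelP b).1 ?eqxx.
have : (\sum_j (w j - v j) == 0)%N.
  rewrite sumnB => [|j _]; last exact: le_vw.
  rewrite (reindex_inj (@perm_inj _ w^-1%g)) [X in (_ - X)%N](reindex_inj (@perm_inj _ v^-1%g)) /=.
  under eq_bigr do rewrite permKV; under [X in (_ - X)%N]eq_bigr do rewrite permKV.
  by rewrite subnn.
rewrite sum_nat_eq0 => /forallP/(_ i); rewrite implyTb subn_eq0 => wv.
by rewrite eqn_leq le_vw wv.
Qed.

Lemma bruhat_cellP h : bruhat_cell w h -> exists N b,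
  [/\ cellmx w N, borel b & h = (permGL R w * mkGL N * b)%g].
Proof.
move=> [b1 [b2 [b1B b2B hE]]].
have [v [b [N [bB Nv hbE]]]] := bruhat h.
have vw : v = w.
  apply: (@bruhat_perm_eq v ((permGL R v * N * (permGL R v)^-1)^-1 * b1)%g (b2 * b)^-1%g).
  - by apply: upper_triM => //; apply: upper_triV; apply: cell_upper.
  - by apply: upper_triV; apply: upper_triM.
  - have bwE : (b1 * permGL R w = permGL R v * N * (b2 * b)^-1)%g.
      by rewrite -hbE hE -[(_ * b2 * b)%g]mulgA mulgK.
    have cancelE (x y z : GL) : ((x * y^-1)^-1 * (x * z) = y * z)%g.
      by rewrite invMg invgK -mulgA mulKg.
    by rewrite -mulgA bwE cancelE.
exists (GLmx N), b^-1%g; split; [by rewrite -vw | exact: upper_triV |].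
rewrite -{1}vw (_ : mkGL (GLmx N) = N); last by apply: GLP; rewrite mkGLE// GLmx_unit.
by rewrite -hbE mulgK.
Qed.

Lemma linefn_mev p M M' : linefn (fun N => mev p (M *m N *m M')).
Proof.
move=> A B; have PA := polyfn_subalg C.
apply: (subalg_mev _ PA); apply: (subalg_mulmx PA) => i j; last exact: subalgC PA _.
by apply: (subalg_mulmx PA) => k l; [exact: subalgC PA _ | exact: polyfn_line].
Qed.

(** [q] need not be invariant under B on the right, so a single b is fixed at which it is nonzero
    somewhere on the cell. The condition then passes to cell coordinates, with v N b as the
    representative of the cell point. *)
Lemma cell_generic q h : X (coset h) -> peval q h != 0 ->
  exists f, [/\ linefn f, cell_nonzero w f & forall N, cellmx w N -> f N != 0 ->
    exists2 h', coset h' = cellpt w N & peval q h' != 0].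
Proof.
move=> Xh qh; have [h1 /bruhat_cellP[N [b [Nw bB ->]]] qN] := schubert_nonzero Xh qh.
exists (fun M => mev q (GLmx (permGL R w) *m M *m GLmx b)); split.
- exact: linefn_mev.
- by exists N; [exact: Nw | move: qN; rewrite pevalE !GLmxM (mkGLE (cellmx_unit Nw))].
move=> N' N'w qN'; exists (permGL R w * mkGL N' * b)%g; first exact: coset_mulr.
by rewrite pevalE !GLmxM (mkGLE (cellmx_unit N'w)).
Qed.

(** Both points may be taken of the form w N b, and N and b are interpolated at the same time; the
    determinant keeps the second factor in B. *)
Lemma schubert_irred q q' h h' : X (coset h) -> peval q h != 0 ->
  X (coset h') -> peval q' h' != 0 ->
  exists k, [/\ X (coset k), peval q k != 0 & peval q' k != 0].
Proof.
move=> Xh qh Xh' qh'.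
have [_ /bruhat_cellP[N [b [Nw bB ->]]] qN] := schubert_nonzero Xh qh.
have [_ /bruhat_cellP[N' [b' [N'w bB' ->]]] qN'] := schubert_nonzero Xh' qh'.
have PA := polyfn_subalg C.
pose L (A A' : 'M[C]_n) s := A + s *: (A' - A).
have L0 A A' : L A A' 0 = A by rewrite /L scale0r addr0.
have L1 A A' : L A A' 1 = A' by rewrite /L scale1r addrC subrK.
pose H s := GLmx (permGL R w) *m L N N' s *m L (GLmx b) (GLmx b') s.
have PH p : polyfn (fun s => mev p (H s)).
  apply: (subalg_mev _ PA); apply: (subalg_mulmx PA) => i j; last exact: polyfn_line.
  by apply: (subalg_mulmx PA) => k l; [exact: subalgC PA _ | exact: polyfn_line].
have Pd : polyfn (fun s => \det (L (GLmx b) (GLmx b') s)).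
  by apply: (subalg_det PA) => i j; exact: polyfn_line.
have q0 : exists s, mev q (H s) != 0.
  by exists 0; move: qN; rewrite /H !L0 pevalE !GLmxM (mkGLE (cellmx_unit Nw)).
have q1 : exists s, mev q' (H s) != 0.
  by exists 1; move: qN'; rewrite /H !L1 pevalE !GLmxM (mkGLE (cellmx_unit N'w)).
have [s [qs qs']] := polyfn_neq0M (PH q) (PH q') q0 q1.
have [||t [qt ut]] := polyfn_neq0M (subalgM PA (PH q) (PH q')) Pd.
- by exists s; apply: mulf_neq0.
- by exists 0; rewrite L0 -unitfE -unitmxE GLmx_unit.
rewrite -unitfE -unitmxE in ut; move: qt; rewrite mulf_eq0 negb_or => /andP[qt qt'].
have Lw : cellmx w (L N N' t) by exact: cellmx_line.
pose k := (permGL R w * mkGL (L N N' t) * mkGL (L (GLmx b) (GLmx b') t))%g.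
have kH : GLmx k = H t by rewrite /k !GLmxM (mkGLE (cellmx_unit Lw)) mkGLE.
exists k; rewrite !pevalE kH; split=> //.
by rewrite coset_mulr; [exact: cellpt_schubert | exact: borel_line].
Qed.

Lemma generically_intro (Q : Fl -> Prop) q h : X (coset h) -> peval q h != 0 ->
  (forall k, X (coset k) -> peval q k != 0 -> Q (coset k)) -> generically X Q.
Proof.
move=> Xh qh qQ; have [V [Vo VE]] := open_image_nonzero q.
exists V; split=> //.
  exists (coset h); split=> //; apply/VE; exists 1%g; first exact: upper_tri1.
  by rewrite mulg1.
move=> x Xx; rewrite -(coset_repr x) => /VE[b bB qb].
by rewrite -(coset_mulr _ bB); apply: qQ => //; rewrite coset_mulr// coset_repr.
Qed.

Lemma generically_elim (Q : Fl -> Prop) : generically X Q ->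
  exists q h, [/\ X (coset h), peval q h != 0 &
    forall k, X (coset k) -> peval q k != 0 -> Q (coset k)].
Proof.
move=> [V [Vo [x [Xx Vx]] VQ]].
have [|q qx qV] := open_Fl_nonzero (g := generic_quotient.repr x) Vo.
  by rewrite coset_repr.
exists q, (generic_quotient.repr x); split=> [|//|k Xk qk]; first by rewrite coset_repr.
by apply: VQ => //; apply: qV.
Qed.

(* t = v d^-1 v^-1 carries the cell point of N' = d N d^-1 to that of N. *)
Lemma torus_cellpt (v : 'S_n) N N' d : N \in unitmx -> N' \in unitmx ->
  (forall a, d a != 0) -> (forall j i, N' j i * d i = d j * N j i) ->
  exists2 t, torus t & cellpt v N = act t (cellpt v N').
Proof.
move=> uN uN' d0 NN'.
exists (permGL R v * (diagGL d)^-1 * (permGL R v)^-1)%g.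
  apply/torusP => a b ab; rewrite diagV// permGLV 2!GLmxM perm_mulr perm_mull.
  rewrite diag_entry => [|c]; last by rewrite invr_eq0.
  by rewrite (inj_eq perm_inj) (negbTE ab).
rewrite act_coset.
have dB : borel (diagGL d) by exact/torus_borel/diag_torus.
rewrite -(coset_mulr _ dB); congr coset.
have ndE : (mkGL N' * diagGL d = diagGL d * mkGL N)%g.
  apply: GLP; rewrite !GLmxM !mkGLE//; apply/matrixP => j i.
  by rewrite diag_mulr// diag_mull.
rewrite -!mulgA; congr (_ * _)%g.
by rewrite ndE mulKg mulKg.
Qed.

End CellPoints.

Section ForestScaling.
Variables (F : fieldType) (n : nat) (p : 'I_n -> 'I_n) (P : pred 'I_n) (r : 'I_n -> F).
Hypotheses (p_gt : forall i, P i -> (i < p i)%N) (r_neq0 : forall i, P i -> r i != 0).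

(** The edges from i to [p i] increase the index and so form a forest; [d] is chosen from the last
    index downwards, each edge determining the value at its smaller end. *)
Lemma forest_scaling : exists d : 'I_n -> F,
  (forall i, d i != 0) /\ forall i, P i -> d (p i) = r i * d i.
Proof.
suff H m : (m <= n)%N -> exists d : 'I_n -> F, (forall i, d i != 0) /\
    forall i : 'I_n, (n - m <= i)%N -> P i -> d (p i) = r i * d i.
  have [d [d0 dP]] := H n (leqnn n); exists d; split=> // i.
  by apply: dP; rewrite subnn.
elim: m => [_|m IH mn].
  exists (fun=> 1); split=> [i|i]; first by rewrite oner_eq0.
  by rewrite subn0 leqNgt ltn_ord.
have [d [d0 dP]] := IH (ltnW mn).
have lt_i : (n - m.+1 < n)%N by lia.
pose i0 := Ordinal lt_i.
exists (fun i => if (i == i0) && P i0 then d (p i0) / r i0 else d i); split=> [i|i].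
  by case: ifP => // /andP[_ Pi]; rewrite mulf_neq0// invr_eq0 r_neq0.
rewrite leq_eqVlt => /orP[/eqP ii0|lt_i0i] Pi.
  have -> : i = i0 by apply/val_inj.
  have Pi0 : P i0 by rewrite (_ : i0 = i)//; apply/val_inj.
  rewrite Pi0 eqxx !andbT ifF; last by rewrite -val_eqE gtn_eqF// p_gt.
  by rewrite mulrCA mulfV ?mulr1// r_neq0.
have lt_pi := p_gt Pi.
rewrite !ifF ?dP//; first by lia.
  by rewrite -val_eqE gtn_eqF.
by rewrite -val_eqE gtn_eqF// (ltn_trans lt_i0i).
Qed.

End ForestScaling.

Lemma cell_scaling (F : fieldType) n (p : 'I_n -> 'I_n) (P : pred 'I_n) (N N' : 'M[F]_n) :
  (forall i, P i -> [/\ (i < p i)%N, N (p i) i != 0 & N' (p i) i != 0]) ->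
  exists d : 'I_n -> F, (forall i, d i != 0) /\
    forall i, P i -> N' (p i) i * d i = d (p i) * N (p i) i.
Proof.
move=> H; have [|i Pi|d [d0 dP]] := @forest_scaling F n p P (fun i => N' (p i) i / N (p i) i).
- by move=> i /H[].
- by have [_ N0 N'0] := H i Pi; rewrite mulf_neq0// invr_eq0.
exists d; split=> // i Pi; rewrite dP// mulrAC divfK//.
by have [] := H i Pi.
Qed.

(** * Sphericality *)

Section SimpleRoot.
Variables (R : realType) (n : nat) (w : 'S_n).
Local Notation C := R[i].
Local Notation GL := (GL R n).
Local Notation borel := (@borel R n).
Local Notation X := (schubert R w).
Variables (b b' : 'I_n).
Hypotheses (b'E : b' = b.+1 :> nat) (wb : (w^-1%g b' < w^-1%g b)%N).
Implicit Types (g h : GL).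

Let b'Nb : b' != b. Proof. by rewrite -val_eqE /= b'E gtn_eqF. Qed.
Let wb'Nb : w^-1%g b' != w^-1%g b. Proof. by rewrite (inj_eq perm_inj). Qed.

(** By [wb] the value b + 1 stands before b in w. The entry (b', b) is cleared by a root element on
    the right; its inverse, moved past w, becomes upper triangular because of [wb], so g w stays in
    B w B. *)
Lemma minimal_parabolic_schubert_generic g :
  (forall x y : 'I_n, (y < x)%N -> (x, y) != (b', b) -> GLmx g x y = 0) ->
  GLmx g b' b' != 0 -> X (coset (g * permGL R w)%g).
Proof.
move=> gP g0; pose s := - (GLmx g b' b / GLmx g b' b').
have gB : borel (g * elemGL b' b s)%g.
  apply/borelP => x y yx; rewrite GLmxM (elemE _ b'Nb) elemmx_mulr.
  case: (y =P b) => [yb|/eqP yNb]; last first.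
    by rewrite addr0 gP// xpair_eqE (negbTE yNb) andbF.
  rewrite yb; have [->|xNb'] := eqVneq x b'; first by rewrite /s mulrN mulrCA mulfV ?mulr1 ?subrr.
  rewrite (gP x b) ?(gP x b') ?mul0r ?addr0//.
  - by rewrite ltn_neqAle eq_sym -val_eqE in xNb' *; rewrite xNb' b'E -yb.
  - by rewrite xpair_eqE (negbTE xNb').
  - by rewrite -yb.
  - by rewrite xpair_eqE (negbTE xNb').
have rB : borel (elemGL (w^-1%g b') (w^-1%g b) (- s)) by exact: elem_borel.
have -> : (g * permGL R w = g * elemGL b' b s * permGL R w *
    elemGL (w^-1 b') (w^-1 b) (- s)%R)%g.
  rewrite -(elem_conj_perm w _ wb'Nb) !permKV -(elemV s b'Nb) -!mulgA.
  by rewrite !mulKVg.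
rewrite (coset_mulr _ rB); apply: bruhat_cell_schubert.
exists (g * elemGL b' b s)%g, 1%g; split=> //; last by rewrite mulg1.
exact: upper_tri1.
Qed.

(** A zero pivot is a limit case: after adding s at (b', b') the previous lemma applies for all but
    finitely many s, and a polynomial vanishing there vanishes at s = 0. *)
Lemma minimal_parabolic_schubert g :
  (forall x y : 'I_n, (y < x)%N -> (x, y) != (b', b) -> GLmx g x y = 0) ->
  X (coset (g * permGL R w)%g).
Proof.
move=> gP; have [g0|] := eqVneq (GLmx g b' b') 0; last exact: minimal_parabolic_schubert_generic.
apply/mem_schubert => p pI.
have PA := polyfn_subalg C.
pose M s := GLmx g + s *: delta_mx b' b'.
have PM i j : polyfn (fun s => M s i j) by exact: polyfn_line.
have Pp : polyfn (fun s => mev p (M s *m GLmx (permGL R w))).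
  apply: (subalg_mev _ PA); apply: (subalg_mulmx PA) => i j; first exact: PM.
  exact: subalgC PA _.
have Pd : polyfn (fun s => \det (M s)) by exact: subalg_det.
have [||s0 [s00 ds0]] := polyfn_neq0M (polyfn_id C) Pd.
- by exists 1; rewrite oner_eq0.
- by exists 0; rewrite /M scale0r addr0 -unitfE -unitmxE GLmx_unit.
suff pz s : mev p (M s *m GLmx (permGL R w)) = 0.
  by have := pz 0; rewrite /M scale0r addr0 -GLmxM.
apply: (polyfn_eq0 Pp (subalgM PA (polyfn_id C) Pd) (ex_intro _ s0 (mulf_neq0 s00 ds0))).
move=> {}s; rewrite mulf_eq0 negb_or -unitfE => /andP[s0' ds].
have uM : M s \in unitmx by rewrite unitmxE.
rewrite -(mkGLE uM) -GLmxM -pevalE.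
have : X (coset (mkGL (M s) * permGL R w)%g).
  apply: minimal_parabolic_schubert_generic => [x y yx xy|].
    rewrite mkGLE// !mxE gP// add0r; case: (x =P b') => [xb|_]; last by rewrite mulr0.
    case: (y =P b') => [yb|_]; last by rewrite mulr0.
    by rewrite xb yb ltnn in yx.
  by rewrite mkGLE// !mxE g0 !eqxx add0r mulr1.
by move/mem_schubert; apply.
Qed.

Lemma elem_stabilizer s : stabilizer X (elemGL b' b s).
Proof.
suff H t h : X (coset h) -> X (coset (elemGL b' b t * h)%g).
  by apply/stabilizerP; split=> h; [|rewrite (elemV _ b'Nb)]; exact: H.
apply: schubert_mull => _ [b1 [b2 [b1B b2B ->]]].
rewrite mulgA (coset_mulr _ b2B) mulgA; apply: minimal_parabolic_schubert => x y yx xy.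
rewrite GLmxM (elemE _ b'Nb) elemmx_mull (borelP b1).1// add0r.
case: (x =P b') => // xb; rewrite (borelP b1).1 ?mulr0//.
rewrite xpair_eqE xb eqxx /= -val_eqE in xy.
by rewrite xb b'E ltnS in yx; rewrite ltn_neqAle xy yx.
Qed.

End SimpleRoot.

Section HessenbergOrbits.
Variables (R : realType) (n : nat).
Local Notation C := R[i].
Local Notation GL := (GL R n).
Local Notation borel := (@borel R n).
Local Notation torus := (@torus R n).
Implicit Types (g h : GL) (v : 'S_n).

Definition zeroonemx v (e : {ffun 'I_n * 'I_n -> bool}) : 'M[C]_n :=
  \matrix_(j, i) ((j == i) || [&& (i < j)%N, (v j < v i)%N & e (j, i)])%:R.

Lemma zeroonemx_cell v e : cellmx v (zeroonemx v e).
Proof. by move=> j i /negbTE ji; rewrite mxE andbA ji orbF. Qed.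

(** Column i of g b is supported in rows up to i + 1 and nonzero in row [v i], so [v i <= i + 1] and
    each position has at most one inversion. The forest scaling then turns every nonzero coordinate
    into 1, leaving finitely many [zeroonemx]. *)
Lemma hessenberg_orbit g :
  (forall a m : 'I_n, (m.+1 < a)%N -> GLmx g a m = 0) ->
  exists v e t, torus t /\ coset g = act t (cellpt v (zeroonemx v e)).
Proof.
move=> gH; have [v [b [N [bB Nv gE]]]] := bruhat g.
have NM j i : GLmx N j i = GLmx (g * b)%g (v j) i.
  by rewrite gE GLmxM perm_mull permK.
have vH i : (v i <= i.+1)%N.
  rewrite leqNgt; apply/negP => iv; have := NM i i.
  rewrite Nv ?ltnn// eqxx GLmxM mxE big1 => [/eqP|c _]; first by rewrite oner_eq0.
  have [ci|ic] := leqP c i; first by rewrite gH ?mul0r// (leq_ltn_trans _ iv).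
  by rewrite (borelP b).1 ?mulr0.
have inv1 i j k : j \in inversions v i -> k \in inversions v i -> j = k.
  by move: (hess_perm_inversions i vH) => /card_le1_eqP H ji ki; exact: H.
pose P i := [exists j in inversions v i, GLmx N j i != 0].
pose p i := odflt i [pick j in inversions v i | GLmx N j i != 0].
have pP i : P i -> p i \in inversions v i /\ GLmx N (p i) i != 0.
  move=> /existsP[j Hj]; rewrite /p; case: pickP => [k /andP[]|/(_ j)] //=.
  by rewrite Hj.
pose e := [ffun ji : 'I_n * 'I_n => GLmx N ji.1 ji.2 != 0].
have [i /pP[+ Np]|d [d0 dP]] := @cell_scaling _ n p P (GLmx N) (zeroonemx v e).
  rewrite inE => /andP[ip vip]; split=> //.
  by rewrite mxE ip vip ffunE /= Np orbT oner_eq0.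
exists v, e; have [t tT tE] : exists2 t, torus t &
    cellpt v (GLmx N) = act t (cellpt v (zeroonemx v e)).
  apply: (torus_cellpt v _ _ d0); [exact: GLmx_unit | exact: cellmx_unit (@zeroonemx_cell v e) |].
  move=> j i; have [ji|ji] := boolP (j \in inversions v i); last first.
    rewrite inE in ji; rewrite (zeroonemx_cell _ ji) (Nv _ _ ji).
    by case: eqP => [->|_]; rewrite ?mul1r ?mulr1 ?mul0r ?mulr0.
  have [N0|N0] := eqVneq (GLmx N j i) 0.
    rewrite N0 mulr0 mxE ffunE N0 eqxx !andbF orbF.
    move: ji; rewrite inE => /andP[ij _].
    by rewrite -val_eqE gtn_eqF// mul0r.
  have Pi : P i by apply/existsP; exists j; rewrite ji.
  have -> : j = p i by apply: inv1 ji _; case: (pP i Pi).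
  exact: dP.
exists t; split=> //; rewrite -tE /cellpt (_ : mkGL (GLmx N) = N); last first.
  by apply: GLP; rewrite mkGLE// GLmx_unit.
by rewrite -gE coset_mulr.
Qed.

End HessenbergOrbits.

Section Spherical.
Variables (R : realType) (n : nat) (w : 'S_n).
Local Notation C := R[i].
Local Notation GL := (GL R n).
Local Notation Fl := (Fl R n).
Local Notation borel := (@borel R n).
Local Notation torus := (@torus R n).
Local Notation X := (schubert R w).
Implicit Types (g h : GL).

Lemma act_act g h (x : Fl) : act g (act h x) = act (g * h)%g x.
Proof. by rewrite -(coset_repr x) !act_coset mulgA. Qed.

Lemma orbit_under_act (H : set GL) g (x : Fl) : subgroup H -> H g ->
  orbit_under H (act g x) = orbit_under H x.
Proof.
move=> [_ HM HV] Hg; apply/seteqP; split=> [_ [h Hh <-]|_ [h Hh <-]].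
  by exists (h * g)%g; [exact: HM | rewrite act_act].
exists (h * g^-1)%g; first by apply: HM => //; apply: HV.
by rewrite act_act mulgKV.
Qed.

Lemma torus_conj_perm (s : 'S_n) t : torus t ->
  torus (permGL R s * t * (permGL R s)^-1)%g.
Proof.
move=> /torusP tT; apply/torusP => a c ac; rewrite permGLV 2!GLmxM perm_mulr perm_mull.
by rewrite tT// (inj_eq perm_inj).
Qed.

Variable i0 : 'I_n.
Hypotheses (c2 : #|inversions w i0| = 2%N)
  (c1 : forall i, i != i0 -> (#|inversions w i| <= 1)%N).

(** The last row in which column m of a flag in X_w can be nonzero; only column i0 exceeds the
    Hessenberg bound. *)
Let hbound (m : 'I_n) : nat := if m == i0 then i0.+2 else m.+1.

Let w_hbound m : (w m <= hbound m)%N.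
Proof.
apply: leq_trans (perm_leq_inversions w m) _; rewrite /hbound; case: eqP => [->|/eqP mi].
  by rewrite c2 addn2.
by rewrite -addn1 leq_add2l c1.
Qed.

Let hbound_mono (m m' : 'I_n) : (m <= m')%N -> (hbound m <= hbound m')%N.
Proof.
rewrite /hbound -!val_eqE /= => mm'.
by case: eqP => mi; case: eqP => m'i; lia.
Qed.

Lemma hyper_schubert_entries g (a m : 'I_n) : X (coset g) -> (hbound m < a)%N -> GLmx g a m = 0.
Proof.
move=> Xg ma; rewrite -mev_entry -pevalE; apply: (mem_schubert w g).1 => // h.
move=> [b1 [b2 [b1B b2B ->]]]; rewrite pevalE mev_entry GLmxM mxE big1// => c _.
have [cm|mc] := leqP c m; last by rewrite (borelP b2).1 ?mulr0.
rewrite GLmxM perm_mulr (borelP b1).1 ?mul0r//.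
exact: leq_ltn_trans (leq_trans (w_hbound c) (hbound_mono cm)) ma.
Qed.

Lemma hyper_spherical : spherical X.
Proof.
have w0 := hyper_perm_value c2 c1.
have lt_b : (i0.+1 < n)%N by have := ltn_ord (w i0); rewrite w0; apply: ltnW.
have [b bE] : exists b : 'I_n, b = i0.+1 :> nat by exists (Ordinal lt_b).
have [b' b'w] : exists b', b' = w i0 by exists (w i0).
have b'E : b' = b.+1 :> nat by rewrite b'w w0 bE.
have bNb' : b != b' by apply/eqP => /(congr1 val) /=; rewrite b'E; lia.
have b'Nb : b' != b by rewrite eq_sym.
(* Positions before i0 carry values at most i0, so the value b = i0 + 1 stands after b' = w i0; this
   is the criterion for [elem_stabilizer]. *)
have wb : (w^-1%g b' < w^-1%g b)%N.
  rewrite b'w permK ltnNge; apply/negP; set j := w^-1%g b.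
  have wj : w j = b by rewrite permKV.
  rewrite leq_eqVlt => /orP[/eqP/val_inj ji|ji].
    by move: bNb'; rewrite b'w -wj ji eqxx.
  have := w_hbound j; rewrite wj /hbound -val_eqE ltn_eqF//= bE ltnS.
  by rewrite leqNgt ji.
have Ybb' s : stabilizer X (elemGL b' b s) by exact: elem_stabilizer.
have Pgrp := stabilizer_subgroup R w.
have BP := @stabilizer_borel R n w.
have Pcl : closed (stabilizer X) by exact: closed_stabilizer.
set Q := stabilizer X in Ybb' Pgrp BP Pcl.
have BLgrp := leviborel_subgroup_GL Pgrp BP.
have TBL := @torus_leviborel R n Q.
have UBL s : leviborel Q (elemGL b b' s).
  split; first by apply: elem_borel; rewrite b'E.
  by apply: elem_levimx => //; right.
exists (levi Q), (leviborel Q); split.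
- exact: levi_subgroup_of.
- by move=> t /TBL; exact: leviborel_levi.
- exact: borel_subgroup_of.
- exact: TBL.
pose s := permGL R (tperm b b').
pose F (d : ('S_n * {ffun 'I_n * 'I_n -> bool}) * bool) : Fl :=
  if d.2 then act s (cellpt d.1.1 (zeroonemx R d.1.1 d.1.2))
  else cellpt d.1.1 (zeroonemx R d.1.1 d.1.2).
apply: (@sub_finite_set _ _ ((fun d => orbit_under (leviborel Q) (F d)) @` setT)%classic);
  last exact/finite_image/finite_finset.
move=> _ [x Xx <-]; rewrite -(coset_repr x) in Xx *; set g := generic_quotient.repr x in Xx *.
have gh a m := @hyper_schubert_entries g a m Xx.
have [g0|gN0] := eqVneq (GLmx g b' i0) 0.
  have [|v [e [t [tT ->]]]] := @hessenberg_orbit R n g.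
    move=> a m ma; have [mi|mi] := eqVneq m i0; last by apply: gh; rewrite /hbound (negbTE mi).
    have [->|ab'] := eqVneq a b'; first by rewrite mi.
    apply: gh; rewrite /hbound mi eqxx.
    by move: ab' ma; rewrite -val_eqE /= b'E bE mi; lia.
  by exists ((v, e), false); rewrite //= orbit_under_act//; exact: TBL.
(* The root element (b, b') with parameter - tau clears the entry (b, i0) by means of (b', i0).
   Exchanging rows b and b' then leaves column i0 with its last nonzero entry in row i0 + 1. *)
pose tau := GLmx g b i0 / GLmx g b' i0.
pose g' := (s^-1 * (elemGL b b' (- tau) * g))%g.
have g'E a m : GLmx g' a m = GLmx g (tperm b b' a) m +
    (if tperm b b' a == b then - tau * GLmx g b' m else 0).
  rewrite /g' /s permGLV [in LHS]GLmxM perm_mull invgK [in LHS]GLmxM (elemE _ bNb').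
  by rewrite elemmx_mull.
have [|v [e [t [tT g't]]]] := @hessenberg_orbit R n g'.
  move=> a m ma; rewrite g'E.
  have small (m' c : 'I_n) : (m' < i0)%N -> (i0 < c)%N -> GLmx g c m' = 0.
    move=> m'i ic; apply: gh; rewrite /hbound -val_eqE ltn_eqF//=.
    exact: leq_ltn_trans m'i ic.
  have [ab'|ab'] := eqVneq a b'.
    rewrite ab' tpermR eqxx; move: ma; rewrite ab' b'E bE !ltnS leq_eqVlt.
    move=> /orP[/eqP/val_inj->|mi].
      by rewrite mulNr divfK// subrr.
    by rewrite !small ?mulr0 ?addr0// ?b'E bE.
  have [ab|ab] := eqVneq a b.
    rewrite ab tpermL (negbTE b'Nb) addr0; move: ma; rewrite ab bE ltnS => mi.
    by rewrite small// b'E bE; apply: ltnW.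
  have -> : tperm b b' a = a by rewrite tpermD // eq_sym.
  rewrite (negbTE ab) addr0; apply: gh; rewrite /hbound.
  case: eqP => // mi; move: ab'; rewrite -val_eqE /= b'E bE; move: ma; rewrite mi; lia.
exists ((v, e), true) => //=.
(* Undoing both moves: the torus element passes through the reflection as a conjugate, still in T,
   so only elements of the Levi Borel stand in front of the finite list [F]. *)
have -> : coset g = act (elemGL b b' tau * (s * t * s^-1))%g
    (act s (cellpt v (zeroonemx R v e))).
  rewrite act_act -!mulgA mulVg mulg1 -act_act -act_act -g't !act_coset; congr coset.
  by rewrite /g' mulKVg mulgA elemM// subrr elem0// mul1g.
rewrite orbit_under_act//; have [_ BLM _] := BLgrp; apply: BLM; first exact: UBL.
by apply: TBL; exact: torus_conj_perm.
Qed.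

End Spherical.

(** * Torus complexity *)

Section AlgebraicDependence.
Variable F : numFieldType.

Lemma poly_dependent (I : finType) (Q : I -> {poly F}) S :
  (forall i, size (Q i) <= S)%N -> (S < #|I|)%N ->
  exists c : I -> F, (exists i, c i != 0) /\ \sum_i c i *: Q i = 0.
Proof.
move=> sQ SI; pose A : 'M[F]_(#|I|, S) := \matrix_(k, s) (Q (enum_val k))`_s.
have /rowV0Pn[v /sub_kermxP vA v0] : kermx A != 0.
  rewrite kermx_eq0; apply/negP => /eqP rA.
  by have := rank_leq_col A; rewrite rA leqNgt SI.
exists (fun i => v 0 (enum_rank i)); split.
  have [k vk] : exists k, v 0 k != 0.
    apply/existsP; apply: contraNT v0 => /existsPn H.
    by apply/eqP/rowP => k; rewrite mxE; apply/eqP/negPn/H.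
  by exists (enum_val k); rewrite enum_valK.
apply/polyP => s; rewrite coef0 coef_sum; have [sS|Ss] := ltnP s S; last first.
  rewrite big1// => i _; rewrite coefZ nth_default ?mulr0//.
  exact: leq_trans (sQ i) Ss.
have /(congr1 (fun M : 'rV_S => M 0 (Ordinal sS))) := vA; rewrite !mxE => E; rewrite -[RHS]E.
rewrite [RHS](reindex _ (onW_bij _ (@enum_rank_bij I))).
by apply: eq_bigr => i _; rewrite coefZ !mxE enum_rankK.
Qed.

Lemma size_expM_leq (A B : {poly F}) e a b : (size A <= e.+1)%N -> (size B <= e.+1)%N ->
  (size (A ^+ a * B ^+ b)%R <= (e * (a + b)).+1)%N.
Proof.
move=> sA sB; apply: leq_trans (size_polyMleq _ _) _.
have hA : (size (A ^+ a)%R <= (e * a).+1)%N.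
  apply: leq_trans (size_poly_exp_leq _ _) _; rewrite ltnS leq_mul2r.
  by apply/orP; right; lia.
have hB : (size (B ^+ b)%R <= (e * b).+1)%N.
  apply: leq_trans (size_poly_exp_leq _ _) _; rewrite ltnS leq_mul2r.
  by apply/orP; right; lia.
by rewrite mulnDr; lia.
Qed.

(* For large m there are more monomials of bidegree at most (m, m) than the
   dimension of the space containing their numerators. *)
Lemma ratfun_dependent (A1 B1 A2 B2 : {poly F}) k (x y : 'I_k) : x != y ->
  exists P : {mpoly F[k]}, P != 0 /\ forall s v, B1.[s] != 0 -> B2.[s] != 0 ->
    v x = A1.[s] / B1.[s] -> v y = A2.[s] / B2.[s] -> P.@[v] = 0.
Proof.
(* After clearing denominators, the (m + 1)^2 monomials become polynomials of degree at most 2 e m;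
   m = 2 e makes m^2 + 1 < (m + 1)^2. *)
move=> xy; pose e := (size A1 + size B1 + size A2 + size B2).+1; pose m := (2 * e)%N.
pose I := ('I_m.+1 * 'I_m.+1)%type.
pose Q (ab : I) := A1 ^+ ab.1 * B1 ^+ (m - ab.1) * (A2 ^+ ab.2 * B2 ^+ (m - ab.2)).
have sQ ab : (size (Q ab) <= (2 * e * m).+1)%N.
  case: ab => a b; rewrite /Q /=; apply: leq_trans (size_polyMleq _ _) _.
  have am : (a <= m)%N by rewrite -ltnS ltn_ord.
  have bm : (b <= m)%N by rewrite -ltnS ltn_ord.
  have h1 : (size (A1 ^+ a * B1 ^+ (m - a))%R <= (e * (a + (m - a))).+1)%N.
    by apply: size_expM_leq; rewrite /e; lia.
  have h2 : (size (A2 ^+ b * B2 ^+ (m - b))%R <= (e * (b + (m - b))).+1)%N.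
    by apply: size_expM_leq; rewrite /e; lia.
  rewrite !subnKC// in h1 h2; move: (leq_add h1 h2); lia.
have ltI : ((2 * e * m).+1 < #|{: I}|)%N.
  by rewrite card_prod !card_ord /m; have : (0 < e)%N by []; nia.
have [c [[ab0 c0] cQ]] := poly_dependent sQ ltI.
pose mon (ab : I) : 'X_{1..k} := (U_(x) *+ ab.1 + U_(y) *+ ab.2)%MM.
have mon_inj : injective mon.
  move=> [a b] [a' b'] /mnmP E; have := E x; have := E y.
  rewrite !mnmDE !mulmnE !mnm1E !eqxx (eq_sym y x) (negbTE xy) !mul0n !mul1n !addn0 !add0n /=.
  by move=> /val_inj -> /val_inj ->.
exists (\sum_ab c ab *: 'X_[mon ab]); split.
  apply: contraNneq c0 => /(congr1 (mcoeff (mon ab0))).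
  rewrite raddf_sum mcoeff0 (bigD1 ab0)//= mcoeffZ mcoeffX eqxx mulr1 big1 ?addr0 => [->//|ab abN].
  by rewrite mcoeffZ mcoeffX (inj_eq mon_inj) (negbTE abN) mulr0.
move=> s v b1 b2 vx vy; have /(congr1 (horner^~ s)) := cQ.
rewrite horner_sum horner0 raddf_sum /= => cQs.
apply/eqP; rewrite -(mulrI_eq0 _ (mulfI (mulf_neq0 (expf_neq0 m b1) (expf_neq0 m b2)))).
apply/eqP; rewrite -[RHS]cQs mulr_sumr; apply: eq_bigr => -[a b] _.
rewrite mevalZ mpolyXD -!mpolyXn mevalM !rmorphXn /= !mevalXU vx vy hornerZ mulrCA.
congr (_ * _); rewrite /Q !hornerM !horner_exp /=.
have expE (u t : F) (j : 'I_m.+1) : t != 0 -> t ^+ m * (u / t) ^+ j = u ^+ j * t ^+ (m - j).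
  move=> t0; have jm : (j <= m)%N by rewrite -ltnS ltn_ord.
  rewrite -{1}(subnKC jm) exprD.
  rewrite expr_div_n mulrCA mulrAC mulfV ?expf_neq0// mul1r.
  by rewrite mulrC.
by rewrite -!expE//; ring.
Qed.

End AlgebraicDependence.

(** * Rational invariants restricted to cell coordinates *)

Section RationalInvariants.
Variables (R : realType) (n : nat) (w : 'S_n).
Local Notation C := R[i].
Local Notation GL := (GL R n).
Local Notation Fl := (Fl R n).
Local Notation torus := (@torus R n).
Local Notation X := (schubert R w).
Implicit Types (g h : GL) (f : ratfun X) (M N : 'M[C]_n).

(* Germs at g of regular functions on the preimage of X in GL. *)
Definition regular_at g (F : GL -> C) : Prop :=
  exists p q, peval q g != 0 /\
    forall h, X (coset h) -> peval q h != 0 -> F h = peval p h / peval q h.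

Lemma regular_at_subalg g : subalg (regular_at g).
Proof.
split=> [c|F F' [p [q [qg pqF]]] [p' [q' [q'g pqF']]]|F F' [p [q [qg pqF]]] [p' [q' [q'g pqF']]]].
- exists c%:MP, 1; rewrite {1}/peval meval1 oner_eq0; split=> // h _ _.
  by rewrite /peval mevalC meval1 divr1.
- exists (p * q' + p' * q), (q * q'); rewrite {1}/peval mevalM mulf_neq0//; split=> // h Xh.
  rewrite {1}/peval mevalM mulf_eq0 negb_or => /andP[qh q'h].
  rewrite pqF// pqF'// /peval mevalD !mevalM; apply: addf_div => //.
- exists (p * p'), (q * q'); rewrite {1}/peval mevalM mulf_neq0//; split=> // h Xh.
  rewrite {1}/peval mevalM mulf_eq0 negb_or => /andP[qh q'h].
  by rewrite pqF// pqF'// /peval !mevalM mulf_div.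
Qed.

Lemma ratfun_local f g : rdom f (coset g) -> exists p q, peval q g != 0 /\
  forall h, X (coset h) -> peval q h != 0 ->
    rdom f (coset h) /\ rval f (coset h) = peval p h / peval q h.
Proof.
move=> fg; have [V0 V0o domE] := rdom_open f.
have [V [F [Vo Vg FV fF]]] := rval_regular fg.
have [p [q [qg FE]]] := FV g Vg.
have V0g : V0 (coset g) by move: fg; rewrite domE => -[].
have [r0 r0g r0V] := open_Fl_nonzero V0o V0g.
have [r rg rV] := open_Fl_nonzero Vo Vg.
exists (p * (r0 * r)), (q * (r0 * r)); split.
  by rewrite /peval !mevalM; do !apply: mulf_neq0.
move=> h Xh; rewrite /peval !mevalM !mulf_eq0 !negb_or => /and3P[qh r0h rh].
have fh : rdom f (coset h) by rewrite domE; split=> //; apply: r0V.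
have Vh : V (coset h) by exact: rV.
split=> //; rewrite fF// -[F _]/((F \o @coset R n) h) FE// /peval.
by rewrite -mulf_div divff ?mulr1// mulf_neq0.
Qed.

(** If the numerator were nonzero at g, the open set where numerator and denominator are both
    nonzero would contain no zero of F, against [dense]. *)
Lemma regular_at_zero g F : X (coset g) -> regular_at g F ->
  (forall q h, X (coset h) -> peval q h != 0 ->
     exists k, [/\ X (coset k), peval q k != 0 & F k = 0]) -> F g = 0.
Proof.
move=> Xg [p [q [qg FE]]] dense; apply/eqP/negPn/negP; rewrite FE// => pqg.
have pg : peval p g != 0 by apply: contraNneq pqg => ->; rewrite mul0r.
have pqN : peval (p * q) g != 0 by rewrite /peval mevalM mulf_neq0.
have [k [Xk]] := dense _ _ Xg pqN.
rewrite {1}/peval mevalM mulf_eq0 negb_or => /andP[pk qk].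
rewrite FE// => /eqP; rewrite mulf_eq0 invr_eq0.
by rewrite -/(peval p k) -/(peval q k) in pk qk; rewrite (negbTE pk) (negbTE qk).
Qed.

Lemma torus_schubert t h : torus t -> X (coset h) -> X (coset (t * h)%g).
Proof.
by move=> /torus_borel/(@stabilizer_borel R n w)/stabilizerP[+ _]; apply.
Qed.

Lemma rdom_schubert f x : rdom f x -> X x.
Proof. by have [V _ ->] := rdom_open f => -[]. Qed.

(** [torus_invariant] gives the equality only on an open set depending on t. The difference of the
    two sides is regular at g and has zeros in every nonempty open set. Equality at each point
    matters below, where t depends on the point. *)
Lemma torus_invariant_val f t x : torus_invariant f -> torus t ->
  rdom f x -> rdom f (act t x) -> rval f (act t x) = rval f x.
Proof.
move=> ft tT; rewrite -(coset_repr x) act_coset; set g := generic_quotient.repr x.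
move=> fg ftg; pose F h := rval f (coset (t * h)%g) - rval f (coset h).
apply/eqP; rewrite -subr_eq0 -/(F g); apply/eqP.
have Xg := rdom_schubert fg.
apply: (regular_at_zero Xg).
  have [p [q [qg fE]]] := ratfun_local fg.
  have [p' [q' [q'g f'E]]] := ratfun_local ftg.
  apply: (subalgB (regular_at_subalg g)); last by exists p, q; split=> // h Xh /(fE h Xh)[].
  have [pt ptE] := pfun_mull p' t; have [qt qtE] := pfun_mull q' t.
  exists pt, qt; rewrite -qtE; split=> // h Xh; rewrite -qtE -ptE => qh.
  by have [] := f'E _ (torus_schubert tT Xh) qh.
move=> q h Xh qh; have [r [k [Xk rk rQ]]] := generically_elim (ft t tT).
have [l [Xl ql rl]] := schubert_irred Xh qh Xk rk.
exists l; split=> //; rewrite /F; have [_ _] := rQ l Xl rl.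
by rewrite act_coset => ->; rewrite subrr.
Qed.

Lemma ratfun_cell f : exists a b, [/\ linefn a, linefn b, cell_nonzero w b &
  forall N, cellmx w N -> b N != 0 ->
    rdom f (cellpt w N) /\ rval f (cellpt w N) = a N / b N].
Proof.
have [x fx] := rdom_neq0 f; rewrite -(coset_repr x) in fx.
have [p [q [qg fE]]] := ratfun_local fx.
have [_ /bruhat_cellP[N0 [c [N0w cB ->]]] qN0] := schubert_nonzero (rdom_schubert fx) qg.
pose m r (N : 'M[C]_n) := mev r (GLmx (permGL R w) *m N *m GLmx c).
have mE r N : cellmx w N -> m r N = peval r (permGL R w * mkGL N * c)%g.
  by move=> Nw; rewrite pevalE !GLmxM (mkGLE (cellmx_unit Nw)).
exists (m p), (m q); split; [exact: linefn_mev | exact: linefn_mev | |].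
  by exists N0; [exact: N0w | rewrite (mE q _ N0w); exact: qN0].
move=> N Nw; rewrite !mE// => qN; have := fE _ _ qN.
by rewrite coset_mulr//; apply; apply: cellpt_schubert.
Qed.

Lemma schubert_nonzero_prod k (q : 'I_k -> {mpoly C[n * n]}) :
  (forall j, exists h, X (coset h) /\ peval (q j) h != 0) ->
  exists h, X (coset h) /\ forall j, peval (q j) h != 0.
Proof.
move=> qN; suff [h [Xh]] : exists h, X (coset h) /\ peval (\prod_j q j) h != 0.
  rewrite /peval rmorph_prod => /prodf_neq0 H.
  by exists h; split=> // j; apply: H.
elim/big_ind: _ => [|p p' [h [Xh ph]] [h' [Xh' p'h']]|j _]; last exact: qN.
  exists (permGL R w * mkGL (onesmx C w))%g; split; first exact/cellpt_schubert/onesmx_cell.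
  by rewrite /peval meval1 oner_eq0.
have [l [Xl pl p'l]] := schubert_irred Xh ph Xh' p'h'.
by exists l; split=> //; rewrite /peval mevalM mulf_neq0.
Qed.

(** Independence is refuted by a relation on an open set; by regularity it is enough to have it at
    cell points that meet every nonempty open condition of the cell. *)
Lemma dependent_family k (f : 'I_k -> ratfun X) (P : {mpoly C[k]}) : P != 0 ->
  (forall a, linefn a -> cell_nonzero w a -> exists N, [/\ cellmx w N, a N != 0 &
     (forall j, rdom (f j) (cellpt w N)) ->
     P.@[fun j => rval (f j) (cellpt w N)] = 0]) ->
  ~ alg_independent f.
Proof.
move=> P0 dense /(_ P) H; case/eqP: P0; apply: H.
have /choice[q qE] j : exists q, (exists h, X (coset h) /\ peval q h != 0) /\
    forall h, X (coset h) -> peval q h != 0 -> rdom (f j) (coset h).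
  have [x fx] := rdom_neq0 (f j); rewrite -(coset_repr x) in fx.
  have [p [q [qg fE]]] := ratfun_local fx.
  exists q; split; first by exists (generic_quotient.repr x); split=> //; exact: rdom_schubert fx.
  by move=> h Xh /(fE h Xh)[].
have [|h [Xh qh]] := @schubert_nonzero_prod k q; first by move=> j; case: (qE j).
have prodE l : (peval (\prod_j q j) l != 0) = [forall j, peval (q j) l != 0].
  rewrite /peval rmorph_prod; apply/prodf_neq0/forallP => H j; first exact: H.
  by move=> _; apply: H.
have qhN : peval (\prod_j q j) h != 0 by rewrite prodE; apply/forallP.
apply: (generically_intro Xh qhN) => l Xl; rewrite prodE => /forallP ql.
have fl j : rdom (f j) (coset l) by apply: (qE j).2.
split=> //.
apply: (@regular_at_zero l (fun l => P.@[fun j => rval (f j) (coset l)]) Xl).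
  apply: (subalg_meval (regular_at_subalg l)) => j.
  have [p [r [rl fE]]] := ratfun_local (fl j).
  by exists p, r; split=> // m Xm /(fE m Xm)[].
move=> r m Xm rm; have [s [Xs rs qs]] := schubert_irred Xm rm Xh qhN.
have rqs : peval (r * \prod_j q j) s != 0 by rewrite /peval mevalM mulf_neq0.
have [a [la aN aE]] := cell_generic Xs rqs.
have [N [Nw aN0 PN]] := dense a la aN.
have [m' m'N] := aE N Nw aN0.
rewrite /peval mevalM mulf_eq0 negb_or => /andP[rm' qm'].
have Xm' : X (coset m') by rewrite m'N; exact: cellpt_schubert.
exists m'; split=> //; rewrite m'N; apply: PN => j; rewrite -m'N.
apply: (qE j).2; first exact: Xm'.
by move: qm'; rewrite -/(peval _ m') prodE => /forallP; apply.
Qed.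

End RationalInvariants.

(** * Upper bounds for the number of independent invariants *)

Section UpperBound.
Variables (R : realType) (n : nat) (w : 'S_n).
Local Notation C := R[i].
Local Notation torus := (@torus R n).
Local Notation X := (schubert R w).
Implicit Types (f : ratfun X) (M N : 'M[C]_n).

Definition inversion_prod N : C := \prod_i \prod_(j in inversions w i) N j i.

Lemma inversion_prod_line : linefn inversion_prod.
Proof.
apply: (subalg_prod (linefn_subalg C n)) => i _; apply: (subalg_prod (linefn_subalg C n)) => j _.
exact: linefn_entry.
Qed.

Lemma inversion_prod_nonzero : cell_nonzero w inversion_prod.
Proof.
exists (onesmx C w); first exact: onesmx_cell.
apply/prodf_neq0 => i _; apply/prodf_neq0 => j; rewrite inE => /andP[ij wji].
by rewrite onesmxE ?oner_eq0.
Qed.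

Lemma inversion_prodP N i j : inversion_prod N != 0 -> j \in inversions w i -> N j i != 0.
Proof. by move=> /prodf_neq0/(_ i isT)/prodf_neq0/(_ j); apply. Qed.

(* A single inversion per position: T has a dense orbit. *)
Lemma no_invariants k (f : 'I_k -> ratfun X) :
  (forall i, #|inversions w i| <= 1)%N ->
  (forall j, torus_invariant (f j)) -> alg_independent f -> k = 0%N.
Proof.
move=> c1 fT find; case: k f fT find => // k f fT; pose j0 := @ord0 k.
have [a [b [la lb bN fE]]] := ratfun_cell (f j0).
have LA := linefn_subalg C n.
have [N0 N0w] := cell_irred lb inversion_prod_line bN inversion_prod_nonzero.
rewrite mulf_eq0 negb_or => /andP[bN0 iN0].
have [fN0 fN0E] := fE N0 N0w bN0.
set v := rval (f j0) (cellpt w N0).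
(* On the dense orbit of [N0] the invariant is constantly v, which gives this linear relation. *)
case/(@dependent_family _ _ _ _ f ('X_j0 - v%:MP)).
  apply/eqP => /(congr1 (mcoeff U_(j0)%MM)).
  rewrite mcoeffB mcoeffX eqxx mcoeffC mcoeff0 (_ : (U_(j0)%MM == 0%MM) = false) ?mulr0 ?subr0.
    by move/eqP; rewrite oner_eq0.
  by apply/negP => /eqP/mnmP/(_ j0); rewrite mnm1E mnm0E eqxx.
move=> a' la' a'N.
have [N Nw] := cell_irred la' (subalgM LA lb inversion_prod_line) a'N
  (ex_intro2 _ _ N0 N0w (mulf_neq0 bN0 iN0)).
rewrite !mulf_eq0 !negb_or => /and3P[aN' bN' iN']; exists N; split=> // fN.
have [fNj fNE] := fE N Nw bN'.
pose P i := inversions w i != finset.set0.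
pose p i := odflt i [pick j in inversions w i].
have pP i : P i -> p i \in inversions w i.
  by move=> /set0Pn[j ji]; rewrite /p; case: pickP => [//|/(_ j)]; rewrite ji.
have [i /pP pi|d [d0 dP]] := @cell_scaling _ n p P N N0.
  split; last exact: inversion_prodP iN0 pi.
    by move: pi; rewrite inE => /andP[].
  exact: inversion_prodP iN' pi.
have [t tT tE] : exists2 t, torus t & cellpt w N = act t (cellpt w N0).
  apply: (torus_cellpt w (cellmx_unit Nw) (cellmx_unit N0w) d0) => j i.
  have [ji|ji] := boolP (j \in inversions w i); last first.
    rewrite inE in ji; rewrite (N0w _ _ ji) (Nw _ _ ji).
    by case: eqP => [->|_]; rewrite ?mul1r ?mulr1 ?mul0r ?mulr0.
  have Pi : P i by apply/set0Pn; exists j.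
  have /card_le1_eqP inv1 := c1 i.
  have -> : j = p i by apply: inv1; rewrite ?pP.
  exact: dP.
rewrite mevalB mevalXU mevalC tE torus_invariant_val ?subrr// -tE.
exact: fN.
Qed.

(* The T-orbits of the points of a line in the cell form a dense set. *)
Lemma invariants_le1 k (f : 'I_k -> ratfun X) i0 :
  #|inversions w i0| = 2%N -> (forall i, i != i0 -> (#|inversions w i| <= 1)%N) ->
  (forall j, torus_invariant (f j)) -> alg_independent f -> (k <= 1)%N.
Proof.
move=> c2 c1 fT find; rewrite leqNgt; apply/negP => k1.
pose x := Ordinal (ltnW k1); pose y := Ordinal k1.
have xy : x != y by [].
have [a1 [b1 [la1 lb1 b1N f1E]]] := ratfun_cell (f x).
have [a2 [b2 [la2 lb2 b2N f2E]]] := ratfun_cell (f y).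
have LA := linefn_subalg C n; have PA := polyfn_subalg C.
have /eqP/cards2P[j0 [k0 [jk0 invE]]] := c2.
have k0i : k0 \in inversions w i0 by rewrite invE !inE eqxx orbT.
have j0i : j0 \in inversions w i0 by rewrite invE !inE eqxx.
pose gd N := b1 N * b2 N * inversion_prod N.
have lgd : linefn gd := subalgM LA (subalgM LA lb1 lb2) inversion_prod_line.
have gdN : cell_nonzero w gd := cell_irred (subalgM LA lb1 lb2) inversion_prod_line
  (cell_irred lb1 lb2 b1N b2N) inversion_prod_nonzero.
have gdP N : gd N != 0 -> [/\ b1 N != 0, b2 N != 0 & inversion_prod N != 0].
  by rewrite /gd !mulf_eq0 !negb_or -andbA => /and3P[].
have [N0 N0w gN0] := gdN; have [b1N0 b2N0 iN0] := gdP _ gN0.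
pose E : 'M[C]_n := delta_mx k0 i0.
have wE N s : cellmx w N -> cellmx w (N + s *: E).
  by move: k0i; rewrite inE => /andP[ik wki]; apply: cellmx_delta.
have [A1 A1E] := la1 N0 E; have [B1 B1E] := lb1 N0 E.
have [A2 A2E] := la2 N0 E; have [B2 B2E] := lb2 N0 E.
have [P [P0 PE]] := ratfun_dependent A1 B1 A2 B2 xy.
case/(@dependent_family _ _ _ _ f P): find => // a la aN.
have [N1 N1w] := cell_irred la lgd aN gdN.
rewrite mulf_eq0 negb_or => /andP[aN1 gN1]; have [b1N1 b2N1 iN1] := gdP _ gN1.
pose Pd i := inversions w i != finset.set0.
(* At i0 the torus is used to match the entry (j0, i0); the entry (k0, i0) remains as the parameter
   of the line. *)
pose p i := if i == i0 then j0 else odflt i [pick j in inversions w i].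
have pP i : Pd i -> p i \in inversions w i.
  rewrite /p; case: eqP => [-> //|_] /set0Pn[j ji].
  by case: pickP => [//|/(_ j)]; rewrite ji.
have [i /pP pi|d [d0 dP]] := @cell_scaling _ n p Pd N1 N0.
  split; last exact: inversion_prodP iN0 pi.
    by move: pi; rewrite inE => /andP[].
  exact: inversion_prodP iN1 pi.
(* Chosen so that d carries N1 + s E to N0 + (al + c s) E: compare the entries (k0, i0). *)
pose c := d k0 / d i0; have c0 : c != 0 by rewrite mulf_neq0 ?invr_eq0.
pose al := c * N1 k0 i0 - N0 k0 i0.
have Pal (q : {poly C}) : polyfn (fun s => q.[al + c * s]).
  exists (q \Po (al%:P + c *: 'X)) => s.
  by rewrite horner_comp !hornerE.
(* The two conditions are satisfiable separately, the first at s = 0, the second where al + c s = 0,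
   which is the point N0. *)
have [||s [as_ Bs]] := @polyfn_neq0M _ (fun s => a (N1 + s *: E) * gd (N1 + s *: E))
    (fun s => (B1 * B2).[al + c * s]) (subalgM PA (la N1 E) (lgd N1 E)) (Pal _).
- by exists 0; rewrite scale0r addr0 mulf_neq0.
- exists (- al / c); rewrite mulrCA mulfV// mulr1 subrr hornerM -B1E -B2E scale0r addr0.
  exact: mulf_neq0.
move: as_; rewrite mulf_eq0 negb_or => /andP[aNs gNs].
have [b1Ns b2Ns iNs] := gdP _ gNs.
set N := N1 + s *: E in aNs gNs b1Ns b2Ns iNs.
have Nw : cellmx w N by exact: wE.
exists N; split=> // fN; set sg := al + c * s in Bs.
move: Bs; rewrite hornerM mulf_eq0 negb_or => /andP[B1s B2s].
pose N' := N0 + sg *: E; have N'w : cellmx w N' by exact: wE.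
have b1N' : b1 N' != 0 by rewrite B1E.
have b2N' : b2 N' != 0 by rewrite B2E.
have [t tT tE] : exists2 t, torus t & cellpt w N = act t (cellpt w N').
  apply: (torus_cellpt w (cellmx_unit Nw) (cellmx_unit N'w) d0) => j i.
  have [ji|ji] := boolP (j \in inversions w i); last first.
    rewrite inE in ji; rewrite (N'w _ _ ji) (Nw _ _ ji).
    by case: eqP => [->|_]; rewrite ?mul1r ?mulr1 ?mul0r ?mulr0.
  have [/andP[/eqP-> /eqP->]|jiN] := boolP ((j == k0) && (i == i0)).
    rewrite /N' /N !mxE !eqxx !mulr1 /sg /al /c; field; exact: d0.
  have -> : N' j i = N0 j i by rewrite !mxE (negbTE jiN) mulr0 addr0.
  have -> : N j i = N1 j i by rewrite !mxE (negbTE jiN) mulr0 addr0.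
  have Pi : Pd i by apply/set0Pn; exists j.
  suff -> : j = p i by exact: dP.
  have [ii|ii] := eqVneq i i0.
    move: ji jiN; rewrite ii invE !inE eqxx andbT /p eqxx => /orP[/eqP->//|-> //].
  have /card_le1_eqP inv1 := c1 i ii.
  by apply: inv1; rewrite ?pP.
have [f1N' f1N'E] := f1E N' N'w b1N'; have [f2N' f2N'E] := f2E N' N'w b2N'.
apply: (PE sg) => //; rewrite tE torus_invariant_val// -?tE//.
  by rewrite f1N'E A1E B1E.
by rewrite f2N'E A2E B2E.
Qed.

End UpperBound.

Lemma mulf_cancel_l (F : fieldType) (c x y : F) : c != 0 -> c * x / (c * y) = x / y.
Proof. by move=> c0; rewrite -mulf_div divff// mul1r. Qed.

(* The minor on rows 0, .., b-1, a and columns 0, .., b, as an n x n determinant. *)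
Section FlagMinors.
Variables (F : comNzRingType) (n : nat).
Implicit Types (a b c q : 'I_n) (M U : 'M[F]_n).

Definition minormx a b M : 'M[F]_n := \matrix_(q, c)
  if (q < b)%N then M q c *+ (c <= b)%N
  else if q == b then M a c *+ (c <= b)%N else (q == c)%:R.

Definition flag_minor a b M : F := \det (minormx a b M).

(** Right multiplication by B changes the minor by a character depending on b alone, so quotients
    with balanced column indices descend to G/B. *)
Lemma flag_minor_mulr a b M U : (forall c q : 'I_n, (q < c)%N -> U c q = 0) ->
  flag_minor a b (M *m U) = flag_minor a b M * \prod_(c : 'I_n | (c <= b)%N) U c c.
Proof.
move=> U0; pose U' : 'M[F]_n := \matrix_(c, d) if (d <= b)%N then U c d else (c == d)%:R.
have U'T : is_trig_mx U'^T.
  apply/is_trig_mxP => c d cd; rewrite !mxE; case: ifP => _; first exact: U0.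
  by rewrite -val_eqE gtn_eqF.
have -> : \prod_(c : 'I_n | (c <= b)%N) U c c = \det U'.
  rewrite -det_tr (det_trig U'T) big_mkcond; apply: eq_bigr => c _.
  by rewrite !mxE eqxx.
rewrite /flag_minor -det_mulmx; congr (\det _); apply/matrixP => q d.
have rowE (r : 'I_n) : (M *m U) r d *+ (d <= b)%N =
    \sum_c M r c *+ (c <= b)%N * U' c d.
  rewrite mxE -sumrMnl; apply: eq_bigr => c _; rewrite mxE.
  have [db|bd] := leqP d b.
    have [cb|bc] := leqP c b; first by [].
    by rewrite mulr1n mulr0n mul0r U0 ?mulr0// (leq_ltn_trans db).
  rewrite mulr0n; have [cb|bc] := leqP c b; last by rewrite mulr0n mul0r.
  rewrite (_ : c == d = false) ?mulr0//; apply/negbTE; rewrite -val_eqE ltn_eqF//.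
  exact: leq_ltn_trans cb bd.
rewrite [LHS]mxE [RHS]mxE; case: ifP => qb.
  by rewrite rowE; apply: eq_bigr => c _; rewrite [minormx _ _ _ _ _]mxE qb.
case: ifP => [qE|qN].
  by rewrite rowE; apply: eq_bigr => c _; rewrite [minormx _ _ _ _ _]mxE qb qE.
rewrite (bigD1 q)//= big1 ?addr0 => [|c cq]; last first.
  by rewrite [minormx _ _ _ _ _]mxE qb qN eq_sym (negbTE cq) mul0r.
rewrite !mxE qb qN eqxx mul1r; case: leqP => // db.
have bq : (b < q)%N by rewrite ltn_neqAle eq_sym val_eqE qN leqNgt qb.
by rewrite U0 -?val_eqE ?gtn_eqF// (leq_ltn_trans db).
Qed.

Lemma flag_minor_diag a b (d : 'I_n -> F) M :
  flag_minor a b (\matrix_(q, c) (d q * M q c)) =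
  (\prod_(q : 'I_n | (q < b)%N) d q) * d a * flag_minor a b M.
Proof.
pose d' q := if (q < b)%N then d q else if q == b then d a else 1.
have -> : (\prod_(q : 'I_n | (q < b)%N) d q) * d a = \det (diag_mx (\row_q d' q)).
  rewrite det_diag [RHS](bigD1 b)//= mxE /d' ltnn eqxx mulrC; congr (_ * _).
  rewrite big_mkcond [RHS]big_mkcond /=; apply: eq_bigr => q _; rewrite mxE.
  by case: ifP => qb; case: eqP => // qE; rewrite qE ltnn in qb.
rewrite /flag_minor -det_mulmx; congr (\det _); apply/matrixP => q c.
rewrite mul_diag_mx !mxE /d'; case: ifP => _; first by rewrite mulrnAr.
by case: ifP => _; rewrite ?mulrnAr ?mul1r.
Qed.

(** Above row b a cell matrix is lower unitriangular, so the minor is triangular and reduces to its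
    corner entry. *)
Lemma flag_minor_cell (w : 'S_n) a b M : cellmx w M -> (b <= a)%N ->
  flag_minor a b M = M a b.
Proof.
move=> Mw ba; have T : is_trig_mx (minormx a b M).
  apply/is_trig_mxP => q c qc; rewrite mxE; case: ifP => qb.
    by rewrite Mw -?val_eqE ?ltn_eqF ?mul0rn// ltnNge (ltnW qc).
  case: eqP => [qE|_]; last by rewrite -val_eqE ltn_eqF.
  by rewrite leqNgt -qE qc.
rewrite /flag_minor (det_trig T) (bigD1 b)//= mxE ltnn eqxx leqnn big1 ?mulr1// => q qb.
rewrite mxE (negbTE qb) eqxx; case: ifP => // qb'.
by rewrite (ltnW qb') Mw ?eqxx// ltnn.
Qed.

End FlagMinors.

Section Triangles.
Variables (R : realType) (n : nat) (w : 'S_n).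
Local Notation C := R[i].
Local Notation GL := (GL R n).
Local Notation Fl := (Fl R n).
Local Notation borel := (@borel R n).
Local Notation torus := (@torus R n).
Local Notation X := (schubert R w).
Implicit Types (g h : GL) (f : ratfun X) (M N : 'M[C]_n).

Let m a b g : C := flag_minor a b (GLmx ((permGL R w)^-1 * g)%g).
Let chi (b : 'I_n) g : C := \prod_(c : 'I_n | (c <= b)%N) GLmx g c c.

Let pfun_m a b : pfun (m a b).
Proof.
have PA := pfun_subalg R n.
apply: (subalg_det PA) => q c.
have PM q' : pfun (fun g => GLmx ((permGL R w)^-1 * g)%g q' c).
  apply: (subalg_mulmx PA) => k l; last exact: pfun_entry.
  exact: subalgC PA _.
have PMn q' (e : bool) : pfun (fun g => GLmx ((permGL R w)^-1 * g)%g q' c *+ e).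
  by case: e; [exact: PM | exact: subalgC PA _].
apply: (@subalg_ext _ _ (@pfun R n) _ (fun g =>
  if (q < b)%N then GLmx ((permGL R w)^-1 * g)%g q c *+ (c <= b)%N
  else if q == b then GLmx ((permGL R w)^-1 * g)%g a c *+ (c <= b)%N
  else (q == c)%:R)) => [g|]; first by rewrite mxE.
case: (q < b)%N; first exact: PMn.
case: (q == b); first exact: PMn.
exact: subalgC PA _.
Qed.

Let m_borel a b g u : borel u -> m a b (g * u)%g = m a b g * chi b u.
Proof.
move=> uB; rewrite /m mulgA [in LHS]GLmxM flag_minor_mulr//.
exact/borelP.
Qed.

Let chi_neq0 b u : borel u -> chi b u != 0.
Proof. by move=> uB; apply/prodf_neq0 => c _; exact: borel_diag_neq0. Qed.

Let m_torus a b (d : 'I_n -> C) g : (forall c, d c != 0) -> m a b (diagGL d * g)%g =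
  (\prod_(q : 'I_n | (q < b)%N) d (w q)) * d (w a) * m a b g.
Proof.
move=> d0; rewrite /m -(flag_minor_diag a b (fun q => d (w q))); congr flag_minor.
have VE (h : GL) q c : GLmx ((permGL R w)^-1 * h)%g q c = GLmx h (w q) c.
  by rewrite permGLV GLmxM perm_mull invgK.
by apply/matrixP => q c; rewrite [RHS]mxE !VE GLmxM diag_mull.
Qed.

Let m_cell N (a b : 'I_n) : cellmx w N -> (b <= a)%N ->
  m a b (permGL R w * mkGL N)%g = N a b.
Proof.
move=> Nw ba; rewrite /m mulKg mkGLE; last exact: cellmx_unit Nw.
exact: flag_minor_cell Nw ba.
Qed.

Section OneTriangle.
Variables (i j k : 'I_n).
Hypothesis tri : triangle w i j k.

Let den g := m j i g * m k j g.
(** On the cell this is N k i / (N j i * N k j). The factor [m j j], equal to 1 there, balances the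
    characters: numerator and denominator both get the B-characters of columns i and j, and the same
    T-weight. *)
Let val g := m k i g * m j j g / den g.
Local Notation reprFl x := (generic_quotient.repr (x : Fl) : GL).

Let den_borel g u : borel u -> den (g * u)%g = den g * (chi i u * chi j u).
Proof. by move=> uB; rewrite /den (m_borel j i g uB) (m_borel k j g uB); exact: mulrACA. Qed.

Let val_borel g u : borel u -> val (g * u)%g = val g.
Proof.
move=> uB; rewrite /val (den_borel g uB) (m_borel k i g uB) (m_borel j j g uB).
have c0 := mulf_neq0 (chi_neq0 i uB) (chi_neq0 j uB).
by rewrite [X in X / _]mulrACA -mulf_div (divff c0) mulr1.
Qed.

Let den_coset g : (den (reprFl (coset g)) != 0) = (den g != 0).
Proof.
have [u uB ->] := repr_coset g; rewrite (den_borel g uB) mulf_eq0.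
by rewrite (negbTE (mulf_neq0 (chi_neq0 i uB) (chi_neq0 j uB))) orbF.
Qed.

Let val_coset g : val (reprFl (coset g)) = val g.
Proof. by have [u uB ->] := repr_coset g; exact: val_borel. Qed.

Let V : set Fl := [set x | den (reprFl x) != 0]%classic.

Let V_open : open V.
Proof.
rewrite open_FlE; have [p pE] := subalgM (pfun_subalg R n) (pfun_m j i) (pfun_m k j).
rewrite (_ : _ @^-1` _ = [set g : GL | peval p g != 0])%classic; first exact: open_nonzero.
by apply/seteqP; split=> g; rewrite /V /= den_coset /den -pE.
Qed.

Let cell_val N : cellmx w N ->
  (den (permGL R w * mkGL N)%g = N j i * N k j) *
  (val (permGL R w * mkGL N)%g = N k i / (N j i * N k j)).
Proof.
move: tri => /and4P[ij jk _ _] Nw; have ik := ltn_trans ij jk.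
have denE : den (permGL R w * mkGL N)%g = N j i * N k j.
  by rewrite /den (m_cell Nw (ltnW ij)) (m_cell Nw (ltnW jk)).
split=> //; rewrite /val denE (m_cell Nw (ltnW ik)) (m_cell Nw (leqnn j)).
by rewrite [N j j]Nw ?eqxx ?mulr1// ltnn.
Qed.

Let triangle_dom_open : exists2 V' : set Fl, open V' & (X `&` V = X `&` V')%classic.
Proof. by exists V. Qed.

Let triangle_dom_neq0 : (X `&` V !=set0)%classic.
Proof.
exists (cellpt w (onesmx C w)); split; first exact/cellpt_schubert/onesmx_cell.
rewrite /V /= den_coset cell_val; last exact: onesmx_cell.
move: tri => /and4P[ij jk wji wkj].
by rewrite !onesmxE// mulr1 oner_eq0.
Qed.

Let triangle_regular : regular_on (X `&` V)%classic (fun x => val (reprFl x)).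
Proof.
move=> x [Xx Vx]; exists V, (fun x => val (reprFl x)); split=> // g Vg.
have PA := pfun_subalg R n.
have [q qE] := subalgM PA (pfun_m j i) (pfun_m k j).
have [p pE] := subalgM PA (pfun_m k i) (pfun_m j j).
exists p, q; split; first by rewrite -qE -/(den g) -den_coset.
by move=> h _ _; rewrite /= val_coset -pE -qE.
Qed.

Lemma triangle_ratfun : exists f : ratfun X, torus_invariant f /\
  forall N, cellmx w N -> N j i != 0 -> N k j != 0 ->
    rval f (cellpt w N) = N k i / (N j i * N k j).
Proof.
exists (RatFun triangle_dom_open triangle_dom_neq0 triangle_regular); split; last first.
  by move=> N Nw _ _; rewrite /= val_coset cell_val.
move=> t tT; exists V; split; [exact: V_open | exact: triangle_dom_neq0 |].
move=> x; rewrite -(coset_repr x) act_coset; set g := generic_quotient.repr x.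
move=> Xg Vg; have [d d0 tE] := torus_diag tT.
rewrite [V _]/(is_true (den (reprFl (coset g)) != 0)) den_coset in Vg.
pose c1 := (\prod_(q : 'I_n | (q < i)%N) d (w q)) * d (w j).
pose c2 := (\prod_(q : 'I_n | (q < j)%N) d (w q)) * d (w k).
have c0 : c1 * c2 != 0.
  by apply: mulf_neq0; apply: mulf_neq0 => //; apply/prodf_neq0.
have denE : den (t * g)%g = c1 * c2 * den g.
  by rewrite tE /den (m_torus j i g d0) (m_torus k j g d0) [LHS]mulrACA.
have numE : m k i (t * g)%g * m j j (t * g)%g = c1 * c2 * (m k i g * m j j g).
  rewrite tE (m_torus k i g d0) (m_torus j j g d0) [LHS]mulrACA; congr (_ * _).
  by rewrite /c1 /c2 [LHS]mulrACA [RHS]mulrACA; congr (_ * _); exact: mulrC.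
have Vtg : V (coset (t * g)%g).
  rewrite [V _]/(is_true (den (reprFl (coset (t * g)%g)) != 0)) den_coset denE.
  exact: mulf_neq0.
split.
- by split; [exact: Xg | rewrite [V _]/(is_true (den (reprFl (coset g)) != 0)) den_coset].
- by split; [exact: torus_schubert | exact: Vtg].
transitivity (val (t * g)%g); first exact: val_coset.
transitivity (val g); last exact/esym/val_coset.
by rewrite /val denE numE; exact: mulf_cancel_l.
Qed.

End OneTriangle.

(* Moving the long edge of one triangle changes its own invariant linearly and
   the invariants of the later triangles not at all. *)
Lemma triangles_independent l (f : 'I_l -> ratfun X) (ti tj tk : 'I_l -> 'I_n) :
  (forall a, triangle w (ti a) (tj a) (tk a)) ->
  (forall a b : 'I_l, (a < b)%N ->
     [/\ (tk a, ti a) != (tk b, ti b), (tk a, ti a) != (tj b, ti b)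
       & (tk a, ti a) != (tk b, tj b)]) ->
  (forall a N, cellmx w N -> N (tj a) (ti a) != 0 -> N (tk a) (tj a) != 0 ->
    rval (f a) (cellpt w N) =
    N (tk a) (ti a) / (N (tj a) (ti a) * N (tk a) (tj a))) ->
  alg_independent f.
Proof.
move=> tri sep fE P /generically_elim[q [h [Xh qh qP]]].
have [phi0 [lphi0 phi0N phi0E]] := cell_generic Xh qh.
have LA := linefn_subalg C n; have PA := polyfn_subalg C.
pose phi N := phi0 N * inversion_prod w N.
have lphi : linefn phi := subalgM LA lphi0 (@inversion_prod_line R n w).
have [N1 N1w N1phi] : cell_nonzero w phi :=
  cell_irred lphi0 (@inversion_prod_line R n w) phi0N (inversion_prod_nonzero R w).
pose den a (N : 'M[C]_n) := N (tj a) (ti a) * N (tk a) (tj a).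
pose val a (N : 'M[C]_n) := N (tk a) (ti a) / den a N.
have denN a N : phi N != 0 -> N (tj a) (ti a) != 0 /\ N (tk a) (tj a) != 0.
  rewrite mulf_eq0 negb_or => /andP[_ iN]; move: (tri a) => /and4P[ij jk wji wkj].
  by split; apply: (inversion_prodP iN); rewrite inE ?ij ?jk.
(* The invariants are freed one at a time: at stage s the first s of them have been replaced by
   arbitrary values v, and at stage l the polynomial P vanishes everywhere. *)
have claim s : (s <= l)%N -> forall N, cellmx w N -> phi N != 0 -> forall v,
    P.@[fun a => if (a < s)%N then v a else val a N] = 0.
  elim: s => [_ N Nw phiN v|s IH sl N Nw phiN v].
    have [h' h'N qh'] : exists2 h', coset h' = cellpt w N & peval q h' != 0.
      by apply: phi0E => //; move: phiN; rewrite mulf_eq0 negb_or => /andP[].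
    have [|_ <-] := qP h' _ qh'; first by rewrite h'N; exact: cellpt_schubert.
    by apply: meval_eq => a; have [d1 d2] := denN a N phiN; rewrite h'N fE.
  pose a0 := Ordinal sl; move: (tri a0) => /and4P[ij jk wji wkj].
  pose E : 'M[C]_n := delta_mx (tk a0) (ti a0).
  have NEw t : cellmx w (N + t *: E).
    by apply: cellmx_delta Nw; [exact: ltn_trans ij jk | exact: ltn_trans wkj wji].
  have NEother t x y : (tk a0, ti a0) != (x, y) -> (N + t *: E) x y = N x y.
    by rewrite eq_sym xpair_eqE => /negbTE xy; rewrite !mxE xy mulr0 addr0.
  have denE t : den a0 (N + t *: E) = den a0 N.
    have n1 : (tk a0, ti a0) != (tj a0, ti a0).
      by rewrite xpair_eqE eqxx andbT -val_eqE gtn_eqF.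
    have n2 : (tk a0, ti a0) != (tk a0, tj a0).
      by rewrite xpair_eqE eqxx /= -val_eqE ltn_eqF.
    by rewrite /den (NEother _ _ _ n1) (NEother _ _ _ n2).
  have den0 : den a0 N != 0 by have [d1 d2] := denN a0 N phiN; exact: mulf_neq0.
  have valE t : val a0 (N + t *: E) = val a0 N + t / den a0 N.
    by rewrite /val denE !mxE !eqxx mulr1 mulrDl.
  pose r t := P.@[fun a => if (a < s)%N then v a else
    if a == a0 then val a0 N + t / den a0 N else val a N].
  have Pr : polyfn r.
    apply: (subalg_meval PA) => a; case: (a < s)%N; first exact: subalgC PA _.
    case: (a == a0); last exact: subalgC PA _.
    apply: (subalgD PA); first exact: subalgC PA _.
    by apply: (subalgM PA); [exact: polyfn_id | exact: subalgC PA _].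
  have r0 : forall t, r t = 0.
    apply: (polyfn_eq0 Pr (lphi N E)).
      by exists 0; rewrite scale0r addr0.
    move=> t phit; rewrite -[RHS](IH (ltnW sl) _ (NEw t) phit v).
    apply: meval_eq => a; case: ifP => // as_; case: eqP => [->|/eqP aa0].
      by rewrite valE.
    have a0a : (a0 < a)%N.
      by rewrite ltn_neqAle /= leqNgt as_ andbT eq_sym; move: aa0; rewrite -val_eqE.
    have [s1 s2 s3] := sep _ _ a0a.
    by rewrite /val /den !NEother.
  (* The parameter t solving [val a0 N + t / den a0 N] = [v a0]. *)
  rewrite -[RHS](r0 ((v a0 - val a0 N) * den a0 N)); apply: meval_eq => a.
  rewrite ltnS leq_eqVlt -[(a == s :> nat)]/(a == a0).
  have [->|_] := eqVneq a a0; last by [].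
  by rewrite /= ltnn mulfK// addrC subrK.
apply: mpoly_eq0 => v; rewrite -[RHS](claim l (leqnn l) N1 N1w N1phi v).
by apply: meval_eq => a; rewrite ltn_ord.
Qed.

End Triangles.

Section Complexity.
Variables (R : realType) (n : nat) (w : 'S_n).
Local Notation X := (schubert R w).
Hypothesis av : avoids312 w.

(** Excess 0 leaves no independent invariant, excess at least 2 gives two from a pair of triangles,
    and excess 1 gives one from a triangle and no more by [invariants_le1]. *)
Lemma T_complexity1P : T_complexity_is X 1 <-> excess w = 1.
Proof.
split=> [[[f [fT find]] max]|e1].
  apply/eqP; rewrite eqn_leq; apply/andP; split; last first.
    rewrite lt0n; apply/eqP => /excess0 c1.
    by have := no_invariants c1 fT find.
  rewrite leqNgt; apply/negP => /(two_triangles av).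
  move=> [i1 [j1 [k1 [i2 [j2 [k2 [t1 t2 s1 s2 s3]]]]]]].
  have [f1 [f1T f1E]] := triangle_ratfun R t1.
  have [f2 [f2T f2E]] := triangle_ratfun R t2.
  pose pick2 (A : Type) (x y : A) (a : 'I_2) := if a == ord0 then x else y.
  have : (2 <= 1)%N; last by [].
  apply: (max 2 (pick2 _ f1 f2)) => [a|]; first by rewrite /pick2; case: ifP.
  apply: (@triangles_independent _ _ w _ _ (pick2 _ i1 i2) (pick2 _ j1 j2) (pick2 _ k1 k2)).
  - by move=> a; rewrite /pick2; case: ifP.
  - by case=> [[|[|a]] //= ha] [[|[|b]] //= hb] _; rewrite /pick2 /=; split.
  - by move=> a; rewrite /pick2; case: ifP.
split=> [|k f fT find].
  have [|i [j [k t]]] := one_triangle av; first by rewrite e1.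
  have [f [fT fE]] := triangle_ratfun R t.
  exists (fun=> f); split=> //.
  apply: (@triangles_independent _ _ w _ _ (fun=> i) (fun=> j) (fun=> k)) => // a b.
  by rewrite !ord1.
have [i0 [c2 c1]] := excess1 e1.
exact: (@invariants_le1 R n w k f i0 c2 c1 fT find).
Qed.

Lemma T_complexity1_spherical : T_complexity_is X 1 -> spherical X.
Proof.
by move=> /T_complexity1P/excess1[i0 [c2 c1]]; exact: hyper_spherical c2 c1.
Qed.

Lemma nearly_toricP : nearly_toric R w <-> excess w = 1.
Proof.
rewrite -T_complexity1P; split=> [[]//|cX].
by split=> //; exact: T_complexity1_spherical.
Qed.

End Complexity.

Local Close Scope ring_scope.

Theorem theorem1p3 (R : realType) (n : nat) :
  (forall w : 'S_n, w \in S312 n ->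
     T_complexity_is (schubert R w) 1 -> spherical (schubert R w)) /\
  (1 < n -> #|NT312 R n| = (n - 2) * 2 ^ (n - 3)).
Proof.
split=> [w|n1]; first by rewrite inE; exact: T_complexity1_spherical.
rewrite -card_hyper_perms//; apply: eq_card => w; rewrite !inE.
case av: (avoids312 w) => //=.
by apply/asboolP/eqP => /(nearly_toricP R av).
Qed.
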